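(* Let $\lambda$ be a dominant integral weight of $\mathfrak{g}=\mathfrak{sl}_{n+1}(\mathbb{C})$ and let $I(\lambda)\subset S(\mathfrak{n}^-)$ be the annihilating ideal of the cyclic $S(\mathfrak{n}^-)$-module $gr\,V(\lambda)=S(\mathfrak{n}^-)v_\lambda$, so that $gr\,V(\lambda)\simeq S(\mathfrak{n}^-)/I(\lambda)$. Then $$I(\lambda)=S(\mathfrak{n}^-)\left(U(\mathfrak{n}^+)\circ \mathrm{span}\{f_\alpha^{(\lambda,\alpha)+1} : \alpha>0\}\right),$$ i.e. $I(\lambda)$ is the ideal of $S(\mathfrak{n}^-)$ generated by the $U(\mathfrak{n}^+)$-submodule of $S(\mathfrak{n}^-)$ generated by the elements $f_\alpha^{(\lambda,\alpha)+1}$, $\alpha$ a positive root.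
   Context: Let $\mathfrak{g}=\mathfrak{sl}_{n+1}(\mathbb{C})=\mathfrak{n}^+\oplus\mathfrak{h}\oplus\mathfrak{n}^-$ be a Cartan decomposition, with simple roots $\alpha_1,\dots,\alpha_n$ and fundamental weights $\omega_1,\dots,\omega_n$. The positive roots are $\alpha_{p,q}=\alpha_p+\alpha_{p+1}+\dots+\alpha_q$, $1\le p\le q\le n$; ''$\alpha>0$'' means that $\alpha$ is a positive root. For each positive root $\alpha$ fix a nonzero root vector $f_\alpha\in\mathfrak{n}^-_{-\alpha}$. The form $(\cdot,\cdot)$ is normalized so that $(\omega_i,\alpha_j)=\delta_{ij}$; thus for $\lambda=\sum m_i\omega_i$ one has $(\lambda,\alpha_{p,q})=m_p+\dots+m_q$. PBW filtration: $U(\mathfrak{n}^-)_s=\mathrm{span}\{x_1\cdots x_l : x_i\in\mathfrak{n}^-,\ l\le s\}$, and $gr\,U(\mathfrak{n}^-)\simeq S(\mathfrak{n}^-)$, the symmetric algebra. For a dominant integral weight $\lambda$ let $V(\lambda)$ be the irreducible $\mathfrak{g}$-module of highest weight $\lambda$ with fixed highest weight vector $v_\lambda$, and put $V(\lambda)_s=U(\mathfrak{n}^-)_s v_\lambda$. Then $gr\,V(\lambda)=\bigoplus_{s\ge0}V(\lambda)_s/V(\lambda)_{s-1}$ (with $V(\lambda)_{-1}=0$) is a cyclic $S(\mathfrak{n}^-)$-module generated by (the class of) $v_\lambda$. Action $\circ$ of $U(\mathfrak{n}^+)$ on $S(\mathfrak{n}^-)$: the adjoint action of $\mathfrak{n}^+$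 on $\mathfrak{g}$ induces an action of $U(\mathfrak{n}^+)$ on $S(\mathfrak{g})$ (by derivations), and hence on $S(\mathfrak{n}^-)\simeq S(\mathfrak{g})/S(\mathfrak{n}^-)S_+(\mathfrak{h}\oplus\mathfrak{n}^+)$, where $S_+(\mathfrak{h}\oplus\mathfrak{n}^+)\subset S(\mathfrak{h}\oplus\mathfrak{n}^+)$ is the ideal of polynomials without constant term. *)

(* Defs.v *)
From HB Require Import structures.
From mathcomp Require Import all_boot all_order all_algebra.
From mathcomp Require Import boolp functions reals.
From mathcomp Require Import complex ssrcomplements mpoly.

Set Implicit Arguments.
Unset Strict Implicit.
Unset Printing Implicit Defensive.

Import GRing.Theory.
Local Open Scope ring_scope.

Section Span.
Variables (K : pzRingType) (W : lmodType K).
Implicit Type G : W -> Prop.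

(* The K-submodule of W generated by G. *)
Definition lspan G (w : W) : Prop :=
  exists2 c : seq (K * W), forall a, a \in c -> G a.2
    & w = \sum_(a <- c) a.1 *: a.2.

Lemma lspan_gen G w : G w -> lspan G w.
Proof.
move=> Gw; exists [:: (1, w)]; last by rewrite big_seq1 scale1r.
by move=> a; rewrite inE => /eqP->.
Qed.

Lemma lspan0 G : lspan G 0.
Proof. by exists [::] => //; rewrite big_nil. Qed.

Lemma lspanD G u w : lspan G u -> lspan G w -> lspan G (u + w).
Proof.
move=> [c cP ->] [d dP ->]; exists (c ++ d); last by rewrite big_cat.
by move=> a; rewrite mem_cat => /orP[/cP | /dP].
Qed.

Lemma lspanZ G k w : lspan G w -> lspan G (k *: w).
Proof.
move=> [c cP ->]; exists [seq (k * a.1, a.2) | a <- c].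
  by move=> a /mapP[b /cP ? ->].
by rewrite big_map scaler_sumr; apply: eq_bigr => a _; rewrite scalerA.
Qed.

Lemma lspan_ind G (P : W -> Prop) :
  P 0 -> (forall k u w, P u -> P w -> P (k *: u + w)) ->
  (forall w, G w -> P w) -> forall w, lspan G w -> P w.
Proof.
move=> P0 PL PG _ [c cP ->]; elim: c cP => [|a c IHc] cP; first by rewrite big_nil.
rewrite big_cons; apply: PL; first by apply/PG/cP; rewrite inE eqxx.
by apply: IHc => b cb; apply: cP; rewrite inE cb orbT.
Qed.

End Span.

Definition ideal_gen (K : comPzRingType) (G : K -> Prop) : K -> Prop :=
  @lspan K K^o G.

Definition annihilator (K : comPzRingType) (W : lmodType K) (p : K) : Prop :=
  forall w : W, p *: w = 0.

Section SymmetricAlgebra.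
Variable F : fieldType.
Implicit Types U W : vectType F.

(* The symmetric algebra S(U), realised as the polynomial ring on a basis of U,
   with its canonical injection U -> S(U). *)
Definition Sym U := {mpoly F[\dim {:U}]}.

Definition sym_in U (u : U) : Sym U :=
  \sum_(i < \dim {:U}) coord (vbasis {:U}) i u *: 'X_i.

(* The algebra morphism S(U) -> S(W) extending a linear map U -> W. *)
Definition sym_map U W (f : U -> W) (p : Sym U) : Sym W :=
  mmap (@mpolyC _ F) (fun i => sym_in (f (vbasis {:U})`_i)) p.

(* The derivation of S(U) extending a linear endomorphism of U. *)
Definition sym_der U (f : U -> U) (p : Sym U) : Sym U :=
  \sum_(i < \dim {:U}) sym_in (f (vbasis {:U})`_i) * mderiv i p.

Lemma sym_in_linear U : linear (@sym_in U).
Proof.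
move=> a u w; rewrite /sym_in scaler_sumr -big_split; apply: eq_bigr => i _ /=.
by rewrite linearP scalerDl scalerA.
Qed.
HB.instance Definition _ U :=
  GRing.isLinear.Build F U (Sym U) _ (@sym_in U) (@sym_in_linear U).

Lemma vbasis_coord U (u : U) :
  u = \sum_(i < \dim {:U}) coord (vbasis {:U}) i u *: (vbasis {:U})`_i.
Proof. exact/coord_vbasis/memvf. Qed.

Lemma sym_map_in U W (f : {linear U -> W}) u :
  sym_map f (sym_in u) = sym_in (f u).
Proof.
rewrite [in RHS](vbasis_coord u) !linear_sum /= /sym_map raddf_sum.
by apply: eq_bigr => i _; rewrite /= mmapZ mmapX mmap1U mul_mpolyC !linearZ.
Qed.

Lemma sym_mapM U W (f : U -> W) p q :
  sym_map f (p * q) = sym_map f p * sym_map f q.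
Proof. exact: rmorphM. Qed.

Lemma sym_der_in U (f : {linear U -> U}) u :
  sym_der f (sym_in u) = sym_in (f u).
Proof.
rewrite [in RHS](vbasis_coord u) !linear_sum /sym_der /=; apply: eq_bigr => i _.
rewrite /= linear_sum (bigD1 i) //= big1 ?addr0 => [|j ne_ji].
  rewrite linearZ /= mderivX mnm1E eqxx scale1r -[X in (X - _)%MM]add0m addmK mpolyX0.
  by rewrite -scalerAr mulr1 !linearZ.
by rewrite linearZ /= mderivX mnm1E (negbTE ne_ji) scale0r scaler0.
Qed.

Lemma sym_derM U (f : U -> U) p q :
  sym_der f (p * q) = sym_der f p * q + p * sym_der f q.
Proof.
rewrite /sym_der mulr_suml mulr_sumr -big_split; apply: eq_bigr => i _ /=.
by rewrite mderivM mulrDr !mulrA [p * _]mulrC.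
Qed.

End SymmetricAlgebra.

(* N pairwise commuting linear endomorphisms T_i of a vector space G make G a
   module over F[X_0, ..., X_(N-1)], with X_i acting by T_i. *)
Section PolynomialModule.
Variables (F : fieldType) (N : nat) (G : lmodType F).
Variable T : 'I_N -> G -> G.
Hypothesis T_linear : forall i, linear (T i).
Hypothesis T_comm : forall i j w, T i (T j w) = T j (T i w).

Definition mon_act (m : 'X_{1..N}) (w : G) : G :=
  foldr (fun i => iter (m i) (T i)) w (enum 'I_N).

Definition poly_act (p : {mpoly F[N]}) (w : G) : G :=
  \sum_(m <- msupp p) p@_m *: mon_act m w.

Lemma iterT_linear i k : linear (iter k (T i)).
Proof. by elim: k => [|k IHk] a u w //=; rewrite IHk T_linear. Qed.

Lemma mon_act_linear m : linear (mon_act m).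
Proof.
rewrite /mon_act => a u w.
by elim: (enum _) => [|i s IHs] //=; rewrite IHs iterT_linear.
Qed.

Lemma iterT_comm i j k l w :
  iter k (T i) (iter l (T j) w) = iter l (T j) (iter k (T i) w).
Proof.
have comm1 h u : T i (iter h (T j) u) = iter h (T j) (T i u).
  by elim: h => //= h IHh; rewrite T_comm IHh.
by elim: k => //= k ->; rewrite comm1.
Qed.

Lemma mon_actD m1 m2 w : mon_act (m1 + m2)%MM w = mon_act m1 (mon_act m2 w).
Proof.
rewrite /mon_act; elim: (enum _) => //= i s ->.
rewrite mnmDE iterD; congr (iter _ _ _).
elim: s {w}(foldr _ w s) => //= j s IHs w.
by rewrite iterT_comm IHs.
Qed.

Lemma poly_actE k p w : (msize p <= k)%N ->
  poly_act p w = \sum_(m : 'X_{1..N < k}) p@_m *: mon_act m w.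
Proof.
move=> le_pk; rewrite /poly_act (big_mksub 'X_{1..N < k}) ?msupp_uniq //=.
  by rewrite big_rmcond //= => i /memN_msupp_eq0 ->; rewrite scale0r.
by move=> m /msize_mdeg_lt /leq_trans; apply.
Qed.

Lemma poly_actDl p q w : poly_act (p + q) w = poly_act p w + poly_act q w.
Proof.
pose k := maxn (msize p) (msize q).
have le_pq : (msize (p + q) <= k)%N by apply: leq_trans (msizeD_le p q) _.
rewrite (poly_actE w le_pq) (poly_actE w (leq_maxl _ _ : (_ <= k)%N)).
rewrite (poly_actE w (leq_maxr _ _ : (_ <= k)%N)) -big_split /=.
by apply: eq_bigr => m _; rewrite mcoeffD scalerDl.
Qed.

Lemma poly_act0l w : poly_act 0 w = 0.
Proof. by rewrite /poly_act msupp0 big_nil. Qed.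

Lemma poly_actMX c m w : poly_act (c *: 'X_[m]) w = c *: mon_act m w.
Proof.
have le_k : (msize (c *: 'X_[m]) <= (mdeg m).+1)%N.
  by rewrite (leq_trans (msizeZ_le _ _)) ?msizeX.
rewrite (poly_actE w le_k) (bigD1 (BMultinom (ltnSn (mdeg m)))) //=.
rewrite mcoeffZ mcoeffX eqxx mulr1 big1 ?addr0 // => m' ne_m'.
rewrite mcoeffZ mcoeffX; case: eqP => [eq_m|_]; last by rewrite mulr0 scale0r.
by case/eqP: ne_m'; apply: val_inj.
Qed.

Lemma poly_act_linear p : linear (poly_act p).
Proof.
move=> a u w; rewrite /poly_act scaler_sumr -big_split; apply: eq_bigr => m _ /=.
by rewrite mon_act_linear scalerDr !scalerA mulrC.
Qed.

Lemma poly_actDr : right_distributive poly_act +%R.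
Proof. by move=> p u w; have := poly_act_linear p 1 u w; rewrite !scale1r. Qed.

Lemma poly_act0r p : poly_act p 0 = 0.
Proof. by apply: (@addIr _ (poly_act p 0)); rewrite -poly_actDr !add0r. Qed.

Lemma poly_actA p q w : poly_act p (poly_act q w) = poly_act (p * q) w.
Proof.
elim/mpolyind: p => [|c m p _ _ IHp]; first by rewrite mul0r !poly_act0l.
rewrite mulrDl !poly_actDl {}IHp; congr (_ + _).
elim/mpolyind: q => [|d m' q _ _ IHq].
  by rewrite mulr0 !poly_act0l poly_act0r.
rewrite mulrDr !poly_actDl poly_actDr IHq; congr (_ + _).
rewrite -scalerAl -scalerAr -mpolyXD scalerA !poly_actMX mon_actD.
have := mon_act_linear m d (mon_act m' w) 0.
have m0: mon_act m 0 = 0.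
  by have := mon_act_linear m (-1) 0 0; rewrite scaler0 scaleN1r addr0 addNr.
by rewrite m0 !addr0 => ->; rewrite scalerA.
Qed.

Lemma poly_act1 : left_id 1 poly_act.
Proof.
move=> w; rewrite -mpolyX0 -[X in poly_act X]scale1r poly_actMX scale1r.
by rewrite /mon_act; elim: (enum _) => //= i s ->; rewrite mnm0E.
Qed.

Lemma poly_actX c i w : poly_act (c *: 'X_i) w = c *: T i w.
Proof.
rewrite poly_actMX /mon_act; congr (_ *: _).
have -> : T i w = if i \in enum 'I_N then T i w else w by rewrite mem_enum.
elim: (enum _) (enum_uniq 'I_N) => //= j s IHs /andP[js /IHs->].
rewrite mnm1E inE; case: eqVneq js => [<-|] //=.
by move=> /negbTE->.
Qed.

Lemma poly_actDl_morph w : {morph poly_act^~ w : p q / p + q}.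
Proof. by move=> p q; rewrite poly_actDl. Qed.

End PolynomialModule.

Section SpecialLinear.
Variables (F : fieldType) (n : nat).

Definition sl_space : {vspace 'M[F]_n.+1} := lker (linfun (mxtrace : 'M[F]_n.+1 -> F^o)).
Definition sl := subvs_of sl_space.
HB.instance Definition _ := Vector.on sl.

Definition sl_bracket (x y : sl) : sl :=
  vsproj sl_space (vsval x *m vsval y - vsval y *m vsval x).

Definition mx_part (P : rel 'I_n.+1) (x : sl) : 'M[F]_n.+1 :=
  \matrix_(i, j) if P i j then vsval x i j else 0.

Fact mx_part_is_linear P : linear (mx_part P).
Proof.
move=> a x y; apply/matrixP => i j; rewrite !mxE /=.
by case: ifP => // _; rewrite mulr0 addr0.
Qed.
HB.instance Definition _ P :=
  GRing.isLinear.Build F sl 'M[F]_n.+1 _ (mx_part P) (mx_part_is_linear P).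

(* Trace-zero matrices that are strictly lower triangular, diagonal, strictly
   upper triangular, each cut out by the vanishing of the other entries. *)
Definition nminus : {vspace sl} := lker (linfun (mx_part (fun i j => i <= j)%N)).
Definition cartan : {vspace sl} := lker (linfun (mx_part (fun i j => i != j))).
Definition nplus : {vspace sl} := lker (linfun (mx_part (fun i j => j <= i)%N)).

Lemma mem_sl (A : 'M[F]_n.+1) : (A \in sl_space) = (\tr A == 0).
Proof. by rewrite memv_ker lfunE. Qed.

Lemma mem_mx_part (P : rel 'I_n.+1) (x : sl) :
  reflect (forall i j, P i j -> vsval x i j = 0) (x \in lker (linfun (mx_part P))).
Proof.
rewrite memv_ker lfunE /=; apply: (iffP eqP) => [/matrixP x0 i j Pij|x0].
  by have := x0 i j; rewrite !mxE Pij.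
by apply/matrixP => i j; rewrite !mxE; case: ifP => // /x0.
Qed.

Lemma mem_nminus (x : sl) :
  reflect (forall i j : 'I_n.+1, (i <= j)%N -> vsval x i j = 0) (x \in nminus).
Proof. exact: mem_mx_part. Qed.

Lemma mem_cartan (x : sl) :
  reflect (forall i j : 'I_n.+1, i != j -> vsval x i j = 0) (x \in cartan).
Proof. exact: mem_mx_part. Qed.

Lemma mem_nplus (x : sl) :
  reflect (forall i j : 'I_n.+1, (j <= i)%N -> vsval x i j = 0) (x \in nplus).
Proof. exact: mem_mx_part. Qed.

Lemma capv_triangular : (nminus :&: (cartan + nplus) = 0)%VS.
Proof.
apply/eqP; rewrite -subv0; apply/subvP => x /memv_capP[/mem_nminus x0].
case/memv_addP=> h /mem_cartan h0 [e /mem_nplus e0 def_x].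
rewrite memv0; apply/eqP/val_inj/matrixP => i j; rewrite mxE.
have [/x0 // | lt_ji] := leqP i j.
by rewrite def_x /= mxE h0 ?e0 ?addr0 // -?val_eqE ?gtn_eqF // ltnW.
Qed.

Lemma addv_triangular : (nminus + (cartan + nplus) = fullv)%VS.
Proof.
apply/eqP; rewrite eqEsubv subvf; apply/subvP => x _.
pose y := vsproj sl_space (mx_part (fun i j => j < i)%N x).
have val_y : vsval y = mx_part (fun i j => j < i)%N x.
  by rewrite vsprojK // mem_sl /mxtrace big1 // => i _; rewrite mxE ltnn.
pose z := vsproj sl_space (mx_part (fun i j => i < j)%N x).
have val_z : vsval z = mx_part (fun i j => i < j)%N x.
  by rewrite vsprojK // mem_sl /mxtrace big1 // => i _; rewrite mxE ltnn.
have -> : x = y + ((x - y - z) + z) by rewrite subrK addrC subrK.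
apply: memv_add; last apply: memv_add.
- by apply/mem_nminus => i j le_ij; rewrite val_y mxE ltnNge le_ij.
- apply/mem_cartan => i j ne_ij; rewrite /= val_y val_z !mxE.
  by case: ltngtP ne_ij => // [_|_|/val_inj->]; rewrite ?eqxx ?subr0 ?subrr.
- by apply/mem_nplus => i j le_ji; rewrite val_z mxE ltnNge le_ji.
Qed.

Lemma val_sl_bracket (x y : sl) :
  vsval (sl_bracket x y) = vsval x *m vsval y - vsval y *m vsval x.
Proof. by rewrite vsprojK // mem_sl raddfB /= mxtrace_mulC subrr. Qed.

Lemma sl_bracket_nminus (x y : sl) :
  x \in nminus -> y \in nminus -> sl_bracket x y \in nminus.
Proof.
move=> /mem_nminus x0 /mem_nminus y0; apply/mem_nminus => i j le_ij.
rewrite val_sl_bracket !mxE !big1 ?subrr // => k _.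
  have [le_ik|lt_ki] := leqP i k; first by rewrite y0 // mul0r.
  by rewrite x0 ?mulr0 // ltnW // (leq_trans lt_ki).
have [le_ik|lt_ki] := leqP i k; first by rewrite x0 // mul0r.
by rewrite y0 ?mulr0 // ltnW // (leq_trans lt_ki).
Qed.

(* The positive root alpha_(p,q) is the pair (p, q), with indices counted from
   0: (p, q) stands for alpha_(p+1) + ... + alpha_(q+1). *)
Definition posroot := {a : 'I_n * 'I_n | (a.1 <= a.2)%N}.

Definition simple_root (i : 'I_n) (h : sl) : F :=
  vsval h (widen_ord (leqnSn n) i) (widen_ord (leqnSn n) i)
  - vsval h (lift ord0 i) (lift ord0 i).

Definition root_of (a : posroot) (h : sl) : F :=
  \sum_(i < n | ((val a).1 <= i <= (val a).2)%N) simple_root i h.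

Definition fund_weight (i : 'I_n) (h : sl) : F :=
  \sum_(j < n.+1 | (j <= i)%N) vsval h j j.

(* A dominant integral weight is given by its coordinates m in the basis of
   fundamental weights. *)
Definition weight_of (m : 'I_n -> nat) (h : sl) : F :=
  \sum_(i < n) (m i)%:R * fund_weight i h.

Definition weight_root (m : 'I_n -> nat) (a : posroot) : nat :=
  \sum_(i < n | ((val a).1 <= i <= (val a).2)%N) m i.

Definition root_vector (a : posroot) (x : subvs_of nminus) : Prop :=
  x != 0 /\
  forall h : sl, h \in cartan -> sl_bracket h (vsval x) = - root_of a h *: vsval x.

(* The projection of S(g) onto S(g) / S(n^-) S_+(h + n^+), the latter identified
   with S(n^-) : the algebra morphism induced by the projection of g onto n^-
   along h + n^+. *)
Definition sym_proj : Sym sl -> Sym (subvs_of nminus) :=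
  sym_map (fun x => vsproj nminus (daddv_pi nminus (cartan + nplus) x)).

Definition circ (e : subvs_of nplus) (p : Sym (subvs_of nminus)) :
    Sym (subvs_of nminus) :=
  sym_proj (sym_der (sl_bracket (vsval e)) (sym_map vsval p)).

(* The U(n^+)-submodule of S(n^-) generated by G; U(n^+) is spanned by the
   products of elements of n^+. *)
Definition Unplus_span (G : Sym (subvs_of nminus) -> Prop) :
    Sym (subvs_of nminus) -> Prop :=
  lspan (fun q => exists es g, G g /\ q = foldr circ g es).

Record sl_rep (V : lmodType F) := SlRep {
  sl_act :> sl -> V -> V;
  sl_act_linear : forall x, linear (sl_act x);
  sl_act_linearl : forall v, linear (sl_act^~ v);
  sl_act_bracket : forall x y v,
    sl_act (sl_bracket x y) v = sl_act x (sl_act y v) - sl_act y (sl_act x v)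
}.

Definition irreducible (V : lmodType F) (rho : sl_rep V) : Prop :=
  (exists v : V, v != 0) /\
  forall P : V -> Prop,
    P 0 -> (forall a u w, P u -> P w -> P (a *: u + w)) ->
    (forall x w, P w -> P (rho x w)) ->
    (forall w, P w -> w = 0) \/ (forall w, P w).

Definition highest_weight_vector (V : lmodType F) (rho : sl_rep V)
    (m : 'I_n -> nat) (v : V) : Prop :=
  [/\ v != 0,
      forall e, e \in nplus -> rho e v = 0
    & forall h, h \in cartan -> rho h v = weight_of m h *: v].

End SpecialLinear.

Section AssociatedGraded.
Variables (F : fieldType) (n : nat) (V : lmodType F) (rho : sl_rep n V) (v : V).
Local Notation nm := (subvs_of (nminus F n)).

(* V_s = U(n^-)_s v *)
Definition pbw (s : nat) : V -> Prop :=
  lspan (fun w => exists2 xs : seq nm,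
    (size xs <= s)%N & w = foldr (fun x => rho (vsval x)) v xs).

(* V_(s-1), with V_(-1) = 0 *)
Definition pbw_pred (s : nat) : V -> Prop :=
  if s is t.+1 then pbw t else fun w => w = 0.

Lemma sl_act0 x : rho x 0 = 0.
Proof.
by have := sl_act_linear rho x (-1) 0 0; rewrite scaler0 addr0 scaleN1r addNr.
Qed.

Lemma pbw_linear s a u w : pbw s u -> pbw s w -> pbw s (a *: u + w).
Proof. by move=> Pu Pw; apply/lspanD => //; apply: lspanZ. Qed.

Lemma pbw_step s x w : pbw s w -> pbw s.+1 (rho (vsval (x : nm)) w).
Proof.
move: w; apply: lspan_ind => [|a u w Pu Pw|_ [xs le_s ->]].
- by rewrite sl_act0; apply: lspan0.
- by rewrite sl_act_linear; apply: pbw_linear.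
- by apply: lspan_gen; exists (x :: xs).
Qed.

Lemma pbw_predS s x w : pbw_pred s w -> pbw_pred s.+1 (rho (vsval (x : nm)) w).
Proof.
case: s => [->|s] /=; last exact: pbw_step.
by rewrite sl_act0; apply: lspan0.
Qed.

Lemma pbw_pred_linear s a u w :
  pbw_pred s u -> pbw_pred s w -> pbw_pred s (a *: u + w).
Proof.
case: s => [-> ->|s /= Pu Pw] /=; first by rewrite scaler0 addr0.
exact: pbw_linear.
Qed.

Lemma pbw_pred0 s : pbw_pred s 0.
Proof. by case: s => //= s; apply: lspan0. Qed.

(* The direct sum of the V_s : finitely supported families (w_s) with
   w_s \in V_s. *)
Definition pbw_sum_pred : {pred nat -> V} := fun w =>
  `[< (forall s, pbw s (w s)) /\
      exists N, forall s, (N <= s)%N -> w s = 0 >].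

Fact pbw_sum_submod : submod_closed pbw_sum_pred.
Proof.
split=> [|a u w /asboolP[Pu [N uN]] /asboolP[Pw [M wM]]].
  by apply/asboolP; split; [move=> s; apply: lspan0 | exists 0%N].
apply/asboolP; split=> [s|]; first exact: pbw_linear.
exists (maxn N M) => s; rewrite geq_max => /andP[/uN us /wM ws].
by rewrite -[LHS]/(a *: u s + w s) us ws scaler0 addr0.
Qed.
HB.instance Definition _ :=
  GRing.isSubmodClosed.Build F (nat -> V) pbw_sum_pred pbw_sum_submod.

Record pbw_sum := PbwSum {
  pbw_val :> nat -> V; pbw_valP : pbw_val \in pbw_sum_pred
}.
HB.instance Definition _ := [isSub for pbw_val].
HB.instance Definition _ := [Choice of pbw_sum by <:].
HB.instance Definition _ := [SubChoice_isSubLmodule of pbw_sum by <:].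

(* The direct sum of the V_(s-1), as a subspace of the direct sum of the V_s. *)
Definition pbw_low : {pred pbw_sum} := fun w => `[< forall s, pbw_pred s (w s) >].

Fact pbw_low_submod : submod_closed pbw_low.
Proof.
split=> [|a u w /asboolP Pu /asboolP Pw]; apply/asboolP => s.
  exact: pbw_pred0.
exact: pbw_pred_linear.
Qed.
HB.instance Definition _ :=
  GRing.isSubmodClosed.Build F pbw_sum pbw_low pbw_low_submod.

(* The vector space underlying gr V : the direct sum of the V_s / V_(s-1). *)
Definition gr_space : Type := Quotient.quot pbw_low.
HB.instance Definition _ := GRing.Zmodule.on gr_space.

Definition gr_class (w : pbw_sum) : gr_space :=
  (\pi_(Quotient.quot pbw_low) w)%qT.

Lemma gr_classP u w : gr_class u = gr_class w <-> forall s, pbw_pred s (u s - w s).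
Proof.
rewrite /gr_class; split=> [/eqP|Puw].
  by rewrite -Quotient.idealrBE => /asboolP.
by apply/eqP; rewrite -Quotient.idealrBE; apply/asboolP.
Qed.

Lemma gr_classB : zmod_morphism gr_class.
Proof. by move=> u w; rewrite /gr_class raddfB. Qed.
HB.instance Definition _ :=
  GRing.isZmodMorphism.Build pbw_sum gr_space gr_class gr_classB.

Lemma gr_class_repr (g : gr_space) : gr_class (repr g) = g.
Proof. exact: reprK. Qed.

Definition gr_scale (a : F) (g : gr_space) : gr_space := gr_class (a *: repr g).

Lemma gr_class_scale a w : gr_scale a (gr_class w) = gr_class (a *: w).
Proof.
apply/gr_classP => s.
have /gr_classP/(_ s) P := gr_class_repr (gr_class w).
have := pbw_pred_linear a P (pbw_pred0 s).
by rewrite addr0 scalerBr.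
Qed.

Fact gr_scaleA a b g : gr_scale a (gr_scale b g) = gr_scale (a * b) g.
Proof.
by rewrite -[g]gr_class_repr !gr_class_scale scalerA.
Qed.
Fact gr_scale1 : left_id 1 gr_scale.
Proof. by move=> g; rewrite -[g]gr_class_repr gr_class_scale scale1r. Qed.
Fact gr_scaleDr : right_distributive gr_scale +%R.
Proof.
move=> a g h; rewrite -[g]gr_class_repr -[h]gr_class_repr.
by rewrite -raddfD !gr_class_scale scalerDr raddfD.
Qed.
Fact gr_scaleDl g : {morph gr_scale^~ g : a b / a + b}.
Proof.
by move=> a b; rewrite -[g]gr_class_repr !gr_class_scale scalerDl raddfD.
Qed.
HB.instance Definition _ := GRing.Zmodule_isLmodule.Build F gr_space
  gr_scaleA gr_scale1 gr_scaleDr gr_scaleDl.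

Lemma gr_class_linear : linear gr_class.
Proof. by move=> a u w; rewrite raddfD; congr (_ + _); exact/esym/gr_class_scale. Qed.

(* x in n^- maps V_s into V_(s+1). *)
Definition pbw_shift_fun (x : nm) (w : nat -> V) (s : nat) : V :=
  if s is t.+1 then rho (vsval x) (w t) else 0.

Fact pbw_shift_subproof x (w : pbw_sum) : pbw_shift_fun x w \in pbw_sum_pred.
Proof.
have /asboolP[Pw [N wN]] := pbw_valP w; apply/asboolP; split=> [[|s]|] /=.
- exact: lspan0.
- exact: pbw_step.
exists N.+1 => -[|s] //=; rewrite ltnS => /wN ->; exact: sl_act0.
Qed.

Definition pbw_shift x (w : pbw_sum) : pbw_sum :=
  PbwSum (pbw_shift_subproof x w).

Definition gr_shift (x : nm) (g : gr_space) : gr_space :=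
  gr_class (pbw_shift x (repr g)).

Lemma pbw_shift_linear x : linear (pbw_shift x).
Proof.
move=> a u w; apply/val_inj/funext => -[|s] /=.
  by rewrite -[RHS]/(a *: 0 + 0) scaler0 addr0.
exact: sl_act_linear.
Qed.

Lemma gr_class_shift x w : gr_shift x (gr_class w) = gr_class (pbw_shift x w).
Proof.
have /gr_classP P := gr_class_repr (gr_class w).
apply/gr_classP => -[|s] /=; first exact: subrr.
have := sl_act_linear rho (vsval x) (-1) (w s) (repr (gr_class w) s).
rewrite !scaleN1r ![- _ + _]addrC => <-; exact/pbw_predS/P.
Qed.

Lemma gr_shift_linear x : linear (gr_shift x).
Proof.
move=> a g h; rewrite -[g]gr_class_repr -[h]gr_class_repr.
by rewrite -gr_class_linear !gr_class_shift pbw_shift_linear gr_class_linear.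
Qed.

Lemma gr_shift_comm x y g : gr_shift x (gr_shift y g) = gr_shift y (gr_shift x g).
Proof.
rewrite -[g]gr_class_repr; set w := repr g; rewrite !gr_class_shift.
apply/gr_classP => -[|[|s]] /=; rewrite ?sl_act0 ?subrr //; try exact: lspan0.
rewrite -sl_act_bracket.
have xy : sl_bracket (vsval x) (vsval y) \in nminus F n.
  by apply: sl_bracket_nminus; apply: subvsP.
rewrite -(vsprojK xy); apply: pbw_step.
by have /asboolP[] := pbw_valP w.
Qed.

(* gr V, as a module over S(n^-) : x in n^- sends the class of w in
   V_s / V_(s-1) to the class of x w in V_(s+1) / V_s. *)
Definition gr : Type := gr_space.
HB.instance Definition _ := GRing.Zmodule.on gr.

Definition gr_act : Sym nm -> gr -> gr :=
  @poly_act F _ gr_space (fun i => gr_shift (vbasis {:nm})`_i).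

Let T_linear (i : 'I_(\dim {:nm})) := gr_shift_linear (vbasis {:nm})`_i.
Let T_comm (i j : 'I_(\dim {:nm})) w :=
  gr_shift_comm (vbasis {:nm})`_i (vbasis {:nm})`_j w.

HB.instance Definition _ := GRing.Zmodule_isLmodule.Build (Sym nm) gr
  (poly_actA T_linear T_comm) (@poly_act1 _ _ _ _)
  (poly_actDr T_linear) (@poly_actDl_morph _ _ _ _).

Lemma gr_shift_sum (I : Type) (r : seq I) (c : I -> F) (x : I -> nm) (g : gr_space) :
  gr_shift (\sum_(i <- r) c i *: x i) g = \sum_(i <- r) c i *: gr_shift (x i) g.
Proof.
rewrite /gr_shift; set w := repr g.
have lin a y z : pbw_shift (a *: y + z) w = a *: pbw_shift y w + pbw_shift z w.
  apply/val_inj/funext => -[|s] /=.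
    by rewrite -[RHS]/(a *: 0 + 0) scaler0 addr0.
  exact: (sl_act_linearl rho).
elim: r => [|i r IHr]; last by rewrite !big_cons lin gr_class_linear IHr.
rewrite !big_nil; have := lin (-1) 0 0.
by rewrite scaler0 addr0 scaleN1r addNr => ->; rewrite raddf0.
Qed.

Lemma sym_in_gr_class (x : nm) (w : pbw_sum) :
  sym_in x *: (gr_class w : gr) = gr_class (pbw_shift x w).
Proof.
rewrite -gr_class_shift [in RHS](vbasis_coord x) gr_shift_sum.
rewrite /sym_in scaler_suml; apply: eq_bigr => i _.
exact: poly_actX.
Qed.
End AssociatedGraded.

(* Main.v *)
From HB Require Import structures.
Require Import Defs.
From mathcomp Require fingroup perm.
From mathcomp Require Import all_boot all_order all_algebra.
From mathcomp Require Import boolp functions.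
From mathcomp Require Import reals complex ssrcomplements mpoly zify ring.

(* Upper bound.  Write f_(p,q) for the root vector of alpha_(p,q) and give a
   monomial f^s the weight  sum_(p,q) s_(p,q) p q.  If s is supported on a chain
   of roots inside the interval [a,b], and its degree exceeds (lambda,alpha_(a,b)),
   then applying root vectors of n^+ to a power of f_(a,b) produces a combination,
   with natural coefficients, of monomials whose exponents have the same row and
   column sums as s, in which f^s occurs.  By the north-west corner rule f^s has
   the largest weight among them, so modulo the ideal it reduces to monomials of
   smaller weight.  Hence the monomials f^s with s in the polytope P(lambda) cut
   out by all chain inequalities span the quotient.

   Lower bound.  V(lambda) is realised on polynomials in matrix entries, generated
   by a product of principal minors.  Each s in P(lambda) is a sum of indicators
   of antichains, one for each minor.  Evaluate the product of the exponentials of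
   the t_a f_a, applied to that product of minors, at the 0/1 matrix determined by
   these antichains: the result is a polynomial in t whose only term of least
   weight is t^s.  So the vectors f^s v, s in P(lambda), are linearly independent,
   and comparing degrees gives the equality of the two ideals.

   The model is compared with V inside the submodule generated by (v, v') in the
   product, with the positive definite contravariant Fischer form on polynomials
   playing the role of complete reducibility. *)

Set Implicit Arguments.
Unset Strict Implicit.
Unset Printing Implicit Defensive.

Import GRing.Theory Num.Theory.
Local Open Scope ring_scope.

(** * The polytope *)

Section Polytope.
Local Open Scope nat_scope.

(** The weight of a root counts the quadrants of the index square that contain it, so the weight of
    an exponent adds up all quadrant counts. One statistic serves both bounds with opposite leading
    terms: the largest weight leads in the straightening, the least in the evaluation. The obstacle
    is that a relation in gr V is only a relation in V modulo a smaller step of the filtration, so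
    independence in V does not pass to gr V by itself. Straightening is therefore used a second
    time, on words: it shows that V_k is spanned by the f^s v with s in the polytope and of degree
    at most k. The generators lie in the annihilator because h + n^+ preserves every V_s: n^+ then
    acts on gr V compatibly with its action on S(n^-) and kills the class of v, so the annihilator
    is stable under that action. V is known only through irreducibility and its highest weight
    vector, hence the detour through a concrete module; positivity of the form on it is what brings
    in complex conjugation. *)

Lemma leq_bool (b c : bool) : (b -> c) -> b <= c.
Proof. by case: b; case: c => // ->. Qed.

Variable n : nat.
Local Notation root := (posroot n).
Local Notation expo := {ffun root -> nat}.
Implicit Types (a b g : root) (s t : expo) (A : {set root}).

Definition rlo a : 'I_n := (val a).1.
Definition rhi a : 'I_n := (val a).2.

Lemma rlo_le_hi a : rlo a <= rhi a. Proof. exact: (valP a). Qed.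

Lemma root_eq a b : rlo a = rlo b :> nat -> rhi a = rhi b :> nat -> a = b.
Proof.
move=> /val_inj lo /val_inj hi; apply: val_inj.
by rewrite [val a]surjective_pairing [val b]surjective_pairing; congr pair.
Qed.

Definition mkroot (i j : 'I_n) (le_ij : i <= j) : root := exist _ (i, j) le_ij.

Lemma rlo_mkroot (i j : 'I_n) (le_ij : i <= j) : rlo (mkroot le_ij) = i. Proof. by []. Qed.
Lemma rhi_mkroot (i j : 'I_n) (le_ij : i <= j) : rhi (mkroot le_ij) = j. Proof. by []. Qed.

Definition rle a b := (rlo a <= rlo b) && (rhi a <= rhi b).
Definition in_tri a b := (rlo a <= rlo b) && (rhi b <= rhi a).

Definition chain A := [forall a in A, forall b in A, rle a b || rle b a].

Lemma chainP A : reflect {in A &, forall a b, rle a b || rle b a} (chain A).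
Proof.
apply: (iffP forall_inP) => [H a b Aa Ab|H a Aa]; first exact: (forall_inP (H a Aa)).
by apply/forall_inP => b Ab; apply: H.
Qed.

Definition rows s (i : 'I_n) := \sum_(a | rlo a == i) s a.
Definition cols s (i : 'I_n) := \sum_(a | rhi a == i) s a.
Definition wgt s := \sum_a s a * ((rlo a).+1 * (rhi a).+1).
Definition same_margins s t := rows s =1 rows t /\ cols s =1 cols t.
Definition tail s (i j : nat) := \sum_a s a * ((i <= rlo a) && (j <= rhi a)).

(** The factor [k.+1] is the number of indices [i <= k], so the product in [wgt] counts the pairs
    [(i, j)] whose quadrant contains the root. *)
Lemma wgt_tail s : wgt s = \sum_(i < n) \sum_(j < n) tail s i j.
Proof.
have cnt (k : 'I_n) : k.+1 = \sum_(i < n) (i <= k).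
  by rewrite -[LHS]card_ord -sum1_card (big_ord_widen n (fun=> 1) (ltn_ord k)) big_mkcond.
rewrite /wgt /tail.
under eq_bigr => a _.
  rewrite {1}(cnt (rlo a)) {1}(cnt (rhi a)) big_distrlr /= big_distrr /=.
  under eq_bigr => i _.
    rewrite big_distrr /=.
    under eq_bigr => j _ do rewrite mulnb.
    over.
  over.
rewrite exchange_big /=; apply: eq_bigr => i _.
by rewrite exchange_big.
Qed.

Lemma sum_rows s (P : pred nat) :
  \sum_(a | P (rlo a)) s a = \sum_(i < n | P i) rows s i.
Proof.
rewrite (partition_big rlo (fun i : 'I_n => P i)) //=.
apply: eq_bigr => i Pi; apply: eq_bigl => a.
by case: eqP => [->|]; rewrite ?Pi ?andbF.
Qed.

Lemma sum_cols s (P : pred nat) :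
  \sum_(a | P (rhi a)) s a = \sum_(i < n | P i) cols s i.
Proof.
rewrite (partition_big rhi (fun i : 'I_n => P i)) //=.
apply: eq_bigr => i Pi; apply: eq_bigl => a.
by case: eqP => [->|]; rewrite ?Pi ?andbF.
Qed.

Lemma tail_cond s i j : tail s i j = \sum_(a | (i <= rlo a) && (j <= rhi a)) s a.
Proof.
rewrite /tail [RHS]big_mkcond; apply: eq_bigr => a _.
by case: ifP; rewrite (muln1, muln0).
Qed.

(* The north-west corner rule: among tables with given margins, the one
   supported on a chain has the largest tails. *)
Lemma chain_tail s t A i j :
    chain A -> (forall a, s a != 0 -> a \in A) -> same_margins s t ->
  tail t i j <= tail s i j.
Proof.
move=> /chainP chA sA [row col].
have le_row : tail t i j <= \sum_(a | i <= rlo a) t a.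
  by rewrite tail_cond [leqRHS](bigID (fun a => j <= rhi a)) /= leq_addr.
have le_col : tail t i j <= \sum_(a | j <= rhi a) t a.
  rewrite tail_cond [leqRHS](bigID (fun a => i <= rlo a)) /=.
  by under [X in X + _]eq_bigl do rewrite andbC; rewrite leq_addr.
(* If the support of [s] has a point [x] below row [i] but before column [j], comparability with [x]
   forces every support point past column [j] to be past row [i], and the tail is a full sum of
   columns. If there is no such point, the tail is a full sum of rows. *)
have [/existsP[x /and3P[Ax ix xj]]|/existsPn nox] :=
    boolP [exists x, [&& s x != 0, i <= rlo x & rhi x < j]].
  apply: leq_trans le_col _.
  rewrite (sum_cols t (fun k => j <= k)) -(eq_bigr _ (fun k _ => col k)).
  rewrite -(sum_cols s (fun k => j <= k)).
  rewrite tail_cond [leqLHS](bigID (fun a => i <= rlo a)) /= [X in _ + X]big1 ?addn0.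
    by under [leqLHS]eq_bigl do rewrite andbC.
  move=> y /andP[jy yi]; apply/eqP; apply: contraTT isT => Ay.
  have := chA _ _ (sA _ Ax) (sA _ Ay); rewrite /rle; lia.
apply: leq_trans le_row _.
rewrite (sum_rows t (fun k => i <= k)) -(eq_bigr _ (fun k _ => row k)).
rewrite -(sum_rows s (fun k => i <= k)).
rewrite tail_cond [leqLHS](bigID (fun a => j <= rhi a)) /= [X in _ + X]big1 ?addn0 //.
move=> y /andP[iy yj]; apply/eqP; apply: contraTT isT => Ay.
have := nox y; rewrite Ay iy /= -ltnNge; lia.
Qed.

(** Inclusion-exclusion over four neighbouring quadrants recovers [s a]; it is written additively
    because subtraction on [nat] truncates. *)
Lemma tail_inj s t : (forall i j, tail s i j = tail t i j) -> s = t.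
Proof.
move=> eq_st; apply/ffunP => a.
have eq_a (u : expo) : u a + (tail u (rlo a).+1 (rhi a) + tail u (rlo a) (rhi a).+1) =
    tail u (rlo a) (rhi a) + tail u (rlo a).+1 (rhi a).+1.
  have {1}-> : u a = \sum_b u b * (b == a).
    rewrite (bigD1 a) //= eqxx muln1 big1 ?addn0 // => b /negbTE->.
    by rewrite muln0.
  rewrite /tail -!big_split; apply: eq_bigr => b _ /=.
  rewrite -!mulnDr; congr (_ * _).
  have : (b == a) = (rlo b == rlo a :> nat) && (rhi b == rhi a :> nat).
    by apply/eqP/andP => [->|[/eqP ? /eqP ?]]; rewrite ?eqxx //; apply: root_eq.
  move=> ->; lia.
by apply/eqP; rewrite -(eqn_add2r (tail t (rlo a).+1 (rhi a) + tail t (rlo a) (rhi a).+1))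
  eq_a -!eq_st eq_a.
Qed.

(** The tails of [t] are bounded by those of [s] one by one, so equal sums force equal tails, and
    tails determine the table. *)
Lemma chain_wgt s t A :
    chain A -> (forall a, s a != 0 -> a \in A) -> same_margins s t ->
  t != s -> wgt t < wgt s.
Proof.
move=> chA sA st; apply: contraR; rewrite -leqNgt => le_st; apply/eqP/tail_inj => i j.
have le_ts i' j' := chain_tail i' j' chA sA st.
have tail_big (u : expo) i' j' : (n <= i') || (n <= j') -> tail u i' j' = 0.
  move=> nij; apply: big1 => a _; have := ltn_ord (rlo a); have := ltn_ord (rhi a).
  by case: andP => [|_]; rewrite ?muln0 //; lia.
have [lt_in|?] := ltnP i n; last by rewrite !tail_big //; lia.
have [lt_jn|?] := ltnP j n; last by rewrite !tail_big //; lia.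
apply/eqP; rewrite eqn_leq le_ts; move: le_st; rewrite !wgt_tail.
rewrite (bigD1 (Ordinal lt_in)) //= [in leqRHS](bigD1 (Ordinal lt_in)) //=.
rewrite (bigD1 (Ordinal lt_jn)) //= [in leqRHS](bigD1 (Ordinal lt_jn)) //=.
set x1 := (\sum_(_ < n | _) tail s _ _); set x2 := (\sum_(_ < n | _) tail t _ _).
set y1 := (\sum_(_ < n | _) \sum_(_ < n) _).
set y2 := (\sum_(_ < n | _) \sum_(_ < n) _).
have : x2 <= x1 by apply: leq_sum => ? _.
have : y2 <= y1 by apply: leq_sum => ? _; apply: leq_sum => ? _.
lia.
Qed.


Implicit Type lam : 'I_n -> nat.

(** Lattice points of the Feigin-Fourier-Littelmann-Vinberg polytope. Its Dyck paths from one simple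
    root to another are the maximal chains of a triangle, so bounding all chains gives the same
    inequalities. *)
Definition polytope lam s := [forall a, forall A : {set root},
  chain A && [forall b in A, in_tri a b] ==>
    (\sum_(b in A) s b <= weight_root lam a)].

Lemma polytopeP lam s :
  reflect (forall a A, chain A -> (forall b, b \in A -> in_tri a b) ->
             \sum_(b in A) s b <= weight_root lam a)
          (polytope lam s).
Proof.
apply: (iffP forallP) => [H a A chA triA|H a].
  by have /forallP/(_ A)/implyP := H a; apply; rewrite chA; apply/forall_inP.
by apply/forallP => A; apply/implyP => /andP[chA /forall_inP triA]; apply: H.
Qed.

Lemma weight_rootE lam a :
  weight_root lam a = \sum_(i < n) (rlo a <= i <= rhi a) * lam i.
Proof.
by rewrite /weight_root big_mkcond; apply: eq_bigr => i _; rewrite /rlo /rhi; case: ifP => _; rewrite (mul1n, mul0n).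
Qed.

Lemma chain1 a : chain [set a].
Proof. by apply/chainP => b c /set1P-> /set1P->; rewrite /rle !leqnn. Qed.

Lemma polytope1 lam s a : polytope lam s -> s a <= weight_root lam a.
Proof.
move=> /polytopeP/(_ a [set a]); rewrite big_set1; apply; first exact: chain1.
by move=> b /set1P->; rewrite /in_tri !leqnn.
Qed.

Definition in_rect (i : 'I_n) a := rlo a <= i <= rhi a.
Definition antichain A := forall a b, a \in A -> b \in A -> rle a b -> a = b.

(** [T] is the set of minimal roots among those of the support that contain [i]. Consider a chain in
    a triangle containing [i], whose bound drops by 1. If the chain meets [T], its sum drops too.
    Otherwise its bound was not sharp: if the chain has a support element starting at or before [i],
    the least such element lies strictly above another support root, which can be adjoined; if not,
    its support lies in the triangle starting at [i + 1], whose bound is smaller by at least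
    [lam i]. *)
Lemma polytope_step lam s (i : 'I_n) :
    polytope lam s -> 0 < lam i -> (forall j : 'I_n, 0 < lam j -> i <= j) ->
  exists T : {set root}, [/\ antichain T, forall a, a \in T -> in_rect i a /\ 0 < s a
    & polytope (fun j => lam j - (j == i)) [ffun a => s a - (a \in T)]].
Proof.
move=> /[dup] Ps /polytopeP P lam_i min_i.
pose S := [pred a | (s a != 0) && in_rect i a].
pose T := [set a | S a && [forall b, S b ==> rle b a ==> (b == a)]].
have TP a b : a \in T -> S b -> rle b a -> b = a.
  by rewrite inE => /andP[_ /forallP/(_ b)] /implyP H /H /implyP{}H /H /eqP.
exists T; split.
- move=> a b Ta Tb ab; apply: TP Tb _ ab.
  by move: Ta; rewrite inE => /andP[].
- by move=> a; rewrite inE => /andP[/andP[sa ->] _]; rewrite lt0n.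
(* A root ending before [i] meets only zero coefficients of [lam], so its own bound is 0. *)
have hi_ge x : s x != 0 -> i <= rhi x.
  move=> sx; rewrite leqNgt; apply: contra sx => lt_xi.
  rewrite -leqn0 (leq_trans (polytope1 x Ps)) // weight_rootE leqn0 sum_nat_eq0.
  apply/forall_inP => j _; case: (posnP (lam j)) => [->|/min_i le_ij]; rewrite ?muln0 //.
  by rewrite muln_eq0 eqb0; apply/orP; left; move: le_ij lt_xi; clear; lia.
apply/polytopeP => a A chA triA.
have le_s : \sum_(b in A) [ffun a => s a - (a \in T)] b <= \sum_(b in A) s b.
  by apply: leq_sum => b _; rewrite ffunE leq_subr.
have [Ria|Nia] := boolP (in_rect i a); last first.
  apply: leq_trans le_s _; apply: leq_trans (P a A chA triA) _; rewrite !weight_rootE.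
  apply: leq_sum => j _; have [->|_] := eqVneq j i; last by rewrite subn0.
  by move: Nia; rewrite /in_rect => /negbTE->.
have -> : weight_root (fun j => lam j - (j == i)) a = (weight_root lam a).-1.
  rewrite !weight_rootE (bigD1 i) //= [in RHS](bigD1 i) //=.
  move: Ria; rewrite /in_rect => ->; rewrite eqxx !mul1n.
  under eq_bigr => j /negbTE-> do rewrite subn0.
  by rewrite subn1 -[in RHS](prednK lam_i).
have [/existsP[x /andP[Ax Tx]]|/existsPn nox] := boolP [exists x, (x \in A) && (x \in T)].
  have := P a A chA triA; rewrite (bigD1 x) //= [X in _ -> X <= _](bigD1 x) //= ffunE Tx.
  have: 0 < s x by move: Tx; rewrite inE lt0n => /andP[/andP[]].
  have: \sum_(b in A | b != x) [ffun a => s a - (a \in T)] b <= \sum_(b in A | b != x) s b.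
    by apply: leq_sum => b _; rewrite ffunE leq_subr.
  move: (\sum_(_ in A | _) _) (\sum_(_ in A | _) _) (weight_root lam a) (s x) => u w k l.
  by rewrite subn1; clear; lia.
apply: leq_trans le_s _.
pose A' := [set b in A | s b != 0].
have A'P b : b \in A' = (b \in A) && (s b != 0) by rewrite inE.
have -> : \sum_(b in A) s b = \sum_(b in A') s b.
  rewrite big_mkcond [RHS]big_mkcond; apply: eq_bigr => b _; rewrite A'P.
  by case: (b \in A) => //=; case: eqVneq => //= ->.
have chA' : chain A'.
  by apply/chainP => b c; rewrite !A'P => /andP[+ _] /andP[+ _]; move/chainP: chA; apply.
have triA' b : b \in A' -> in_tri a b by rewrite A'P => /andP[/triA].
have [/existsP[x0 Ax0]|/existsPn nolo] := boolP [exists x, (x \in A') && (rlo x <= i)].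
  case: (@arg_minnP _ x0 (fun x => (x \in A') && (rlo x <= i))
    (fun x => rlo x + rhi x) Ax0) => x /andP[Ax lo_x] min_x.
  have sx : s x != 0 by move: Ax; rewrite A'P => /andP[].
  have Sx : S x by rewrite inE sx /in_rect lo_x hi_ge.
  have /forallPn[y] : ~~ [forall b, S b ==> rle b x ==> (b == x)].
    apply: contra (nox x) => H; move: Ax; rewrite A'P => /andP[-> _] /=.
    by rewrite inE Sx.
  rewrite !negb_imply => /and3P[/andP[sy Ry] yx ne_yx].
  have Ay : y \notin A'.
    apply/negP => Ay; case/negP: ne_yx; apply/eqP.
    have := min_x y; rewrite Ay; move: Ry yx; rewrite /in_rect /rle => H1 H2 H3.
    by apply: root_eq; move: H1 H2 H3 lo_x; clear; lia.
  have le_yb b : b \in A' -> rle y b.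
    move=> Ab; have := chainP _ chA' _ _ Ax Ab; have := min_x b; rewrite Ab.
    move: yx lo_x; rewrite /rle; clear; lia.
  have le_ya : rlo y <= rhi a.
    by have := triA' _ Ax; have := rlo_le_hi x; move: yx; rewrite /rle /in_tri; clear; lia.
  have chY : chain (y |: A').
    apply/chainP => b c /setU1P[->|Ab] /setU1P[->|Ac].
    - by rewrite /rle !leqnn.
    - by rewrite le_yb.
    - by rewrite le_yb // orbT.
    - by move/chainP: chA'; apply.
  have triY b : b \in y |: A' -> in_tri (mkroot le_ya) b.
    rewrite /in_tri => /setU1P[->|Ab].
      by have := triA' _ Ax; move: yx; rewrite /in_tri /rle ?rlo_mkroot ?rhi_mkroot; clear; lia.
    by have := triA' _ Ab; have := le_yb _ Ab; rewrite /in_tri /rle ?rlo_mkroot ?rhi_mkroot; clear; lia.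
  have := P _ _ chY triY; rewrite big_setU1 //=.
  (* The new triangle may extend to the left of [a], but only by indices below [i], where [lam]
     vanishes. *)
  have : weight_root lam (mkroot le_ya) <= weight_root lam a.
    rewrite !weight_rootE; apply: leq_sum => j _; rewrite rlo_mkroot rhi_mkroot.
    case: (posnP (lam j)) => [->|/min_i le_ij]; first by rewrite !muln0.
    rewrite leq_mul2r; apply/orP; right; move: Ria; rewrite /in_rect.
    by move: le_ij; clear => H1 H2; apply: leq_bool; lia.
  move: sy; clear; lia.
have lo_gt b : b \in A' -> i < rlo b by move=> Ab; have := nolo b; rewrite Ab -ltnNge.
have [->|[b0 Ab0]] := set_0Vmem A'; first by rewrite big_set0.
have lt_ia : i.+1 < n by apply: leq_ltn_trans (lo_gt _ Ab0) _.
have le_ia : Ordinal lt_ia <= rhi a.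
  by have := triA' _ Ab0; have := lo_gt _ Ab0; have := rlo_le_hi b0; rewrite /in_tri /=; clear; lia.
have triB b : b \in A' -> in_tri (mkroot le_ia) b.
  by move=> Ab; have := triA' _ Ab; have := lo_gt _ Ab; rewrite /in_tri ?rlo_mkroot ?rhi_mkroot /=; clear; lia.
have := P _ _ chA' triB.
have : weight_root lam (mkroot le_ia) + lam i <= weight_root lam a.
  rewrite !weight_rootE rlo_mkroot rhi_mkroot [leqRHS](bigD1 i) //= (bigD1 i isT) /=.
  have -> : (rlo a <= i <= rhi a) = true by [].
  rewrite ltnn mul0n mul1n addnC leq_add2l; apply: leq_sum => j ne_ji.
  rewrite leq_mul2r; apply/orP; right; move: Ria; rewrite /in_rect.
  by clear => H; apply: leq_bool; lia.
move: lam_i; clear; lia.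
Qed.

Lemma polytope_decomp lam s : polytope lam s ->
  exists A : 'I_n -> nat -> {set root},
    (forall i k, k < lam i -> antichain (A i k) /\
                              forall a, a \in A i k -> in_rect i a) /\
    forall a, s a = \sum_i \sum_(k < lam i) (a \in A i k).
Proof.
have [N] := ubnP (\sum_i lam i); elim: N lam s => // N IHN lam s leN Ps.
have [/existsP[i0 lam_i0]|/existsPn lam0] := boolP [exists i, 0 < lam i]; last first.
  have {}lam0 i : lam i = 0 by have := lam0 i; lia.
  exists (fun _ _ => set0); split=> [i k|a]; first by rewrite lam0.
  apply/eqP; rewrite big1 => [|i _]; last by rewrite lam0 big_ord0.
  rewrite -leqn0 (leq_trans (polytope1 a Ps)) // weight_rootE.
  by rewrite big1 // => i _; rewrite lam0 muln0.
case: (@arg_minnP _ i0 (fun i => 0 < lam i) (fun i : 'I_n => i : nat) lam_i0) => i lam_i min_i.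
have [T [antiT TP PT]] := polytope_step Ps lam_i min_i.
have [|A [A_anti A_sum]] := IHN _ _ _ PT.
  rewrite -ltnS; apply: leq_trans leN; rewrite ltnS (bigD1 i) //= [ltnRHS](bigD1 i) //= eqxx.
  under eq_bigr => j /negbTE-> do rewrite subn0.
  by rewrite ltn_add2r; move: lam_i; lia.
(* The new antichain takes the last slot of index [i]; the earlier slots are exactly those of the
   smaller weight. *)
exists (fun j k => if (j == i) && (k == (lam i).-1) then T else A j k); split.
  move=> j k lt_k; case: ifP => [/andP[/eqP-> _]|neq].
    by split=> // a /TP[].
  apply: A_anti; move: neq lt_k; case: (eqVneq j i) => [->|_] /=; lia.
move=> a; have Ta : (a \in T) <= s a by case: (boolP (a \in T)) => // /TP[].
rewrite -(subnKC Ta) -[s a - _](ffunE (fun a => s a - (a \in T))) A_sum.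
rewrite (bigD1 i) //= [RHS](bigD1 i) //= eqxx addnA; congr (_ + _).
  rewrite subn1; case: (lam i) lam_i => // m _; rewrite big_ord_recr /= eqxx addnC.
  by congr (_ + _); apply: eq_bigr => k _; rewrite (ltn_eqF (ltn_ord k)).
by apply: eq_bigr => j /negbTE->; rewrite subn0.
Qed.

End Polytope.

(** * Straightening *)

Definition derivation (B : comNzRingType) (D : B -> B) :=
  {morph D : p q / p + q} /\ forall p q, D (p * q) = D p * q + p * D q.

Section Derivation.
Variables (B : comNzRingType) (D : B -> B).
Hypothesis derD : derivation D.

Lemma der0 : D 0 = 0.
Proof. by have [DD _] := derD; apply: (addrI (D 0)); rewrite -DD !addr0. Qed.

Lemma der1 : D 1 = 0.
Proof.
have [_ DM] := derD; apply: (addrI (D 1)); rewrite addr0.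
by have := DM 1 1; rewrite !mulr1 mul1r => /esym.
Qed.

Lemma der_sum (I : Type) (r : seq I) (P : pred I) (E : I -> B) :
  D (\sum_(i <- r | P i) E i) = \sum_(i <- r | P i) D (E i).
Proof. exact: (big_morph D derD.1 der0). Qed.

Lemma derN p : D (- p) = - D p.
Proof. by apply: (addrI (D p)); rewrite -derD.1 !subrr der0. Qed.

Lemma derX p k : D (p ^+ k) = (p ^+ k.-1 * D p) *+ k.
Proof.
elim: k => [|[|k] IHk] /=; first by rewrite expr0 der1 mulr0n.
  by rewrite expr1 expr0 mul1r.
rewrite exprS derD.2 IHk /= [in RHS]mulrS [D p * _]mulrC; congr (_ + _).
by rewrite -mulrnAr mulrA -exprS -mulrnAr.
Qed.

Lemma der_prod (I : finType) (E : I -> B) :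
  D (\prod_i E i) = \sum_i (\prod_(j | j != i) E j) * D (E i).
Proof.
suff H (r : seq I) : uniq r ->
    D (\prod_(i <- r) E i) = \sum_(i <- r) (\prod_(j <- r | j != i) E j) * D (E i).
  by rewrite H ?index_enum_uniq.
elim: r => [|i r IHr] /=; first by rewrite !big_nil der1.
case/andP=> nri Ur; rewrite !big_cons eqxx /= derD.2 IHr // mulrC; congr (_ * _ + _).
  rewrite [LHS]big_seq [RHS]big_seq_cond; apply: eq_bigl => j.
  by case: eqP => [->|_]; rewrite ?andbT ?(negbTE nri).
rewrite mulr_sumr [LHS]big_seq [RHS]big_seq; apply: eq_bigr => j rj.
rewrite big_cons ifT ?mulrA //; by apply: contraNneq nri => ->.
Qed.

End Derivation.

Section Moves.
Variable n : nat.
Local Notation root := (posroot n).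
Local Notation expo := {ffun root -> nat}.
Implicit Types (a b g : root) (s t u : expo).

Definition mv s a b : expo := [ffun c => (s c - (c == a) + (c == b))%N].

Lemma sum_mv (P : pred root) s a b : (0 < s a)%N ->
  (\sum_(c | P c) mv s a b c + P a = \sum_(c | P c) s c + P b)%N.
Proof.
move=> sa; have dirac x : (P x : nat) = (\sum_(c | P c) (c == x))%N.
  rewrite big_mkcond (bigD1 x) //= eqxx big1 ?addn0 => [|c /negbTE->]; first by case: (P x).
  by case: (P c).
rewrite !dirac -!big_split; apply: eq_bigr => c _; rewrite ffunE /=.
by case: eqP => [->|_] /=; case: eqP; move: sa; clear; lia.
Qed.

Lemma mvK s a b : (0 < s a)%N -> a != b -> mv (mv s a b) b a = s.
Proof.
move=> sa ab; apply/ffunP => c; rewrite !ffunE.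
have [->|ca] := eqVneq c a; last by rewrite subn0 addn0 addnK.
by rewrite (negbTE ab) addn0 subn0 subnK.
Qed.

(** All moves allowed by [mu] change the margins in the same way, so tables with equal margins are
    sent to tables with equal margins. *)
Definition compat (mu : root -> option root) := forall a b a' b',
  mu a = Some b -> mu a' = Some b' ->
  (forall i, (rlo b == i) + (rlo a' == i) = (rlo b' == i) + (rlo a == i))%N /\
  (forall i, (rhi b == i) + (rhi a' == i) = (rhi b' == i) + (rhi a == i))%N.

Lemma same_margins_mv mu s t a b a' b' :
    compat mu -> mu a = Some b -> mu a' = Some b' -> (0 < s a)%N -> (0 < t a')%N ->
  same_margins s t -> same_margins (mv s a b) (mv t a' b').
Proof.
move=> cmp ab ab' sa ta [r c]; have [lo hi] := cmp _ _ _ _ ab ab'.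
split=> i.
  have := r i; have := sum_mv (fun x => rlo x == i) b sa.
  have := sum_mv (fun x => rlo x == i) b' ta; have := lo i.
  rewrite -/(rows _ i) -/(rows s i) -/(rows t i) -/(rows (mv t a' b') i) -/(rows (mv s a b) i).
  by clear; lia.
have := c i; have := sum_mv (fun x => rhi x == i) b sa.
have := sum_mv (fun x => rhi x == i) b' ta; have := hi i.
rewrite -/(cols _ i) -/(cols s i) -/(cols t i) -/(cols (mv t a' b') i) -/(cols (mv s a b) i).
by clear; lia.
Qed.

(** [None] stands for a matrix unit on or above the diagonal, which becomes zero in S(n^-). *)
Definition oroot (i j : 'I_n) : option root :=
  if @idP (i <= j)%N is ReflectT le_ij then Some (mkroot le_ij) else None.

Lemma orootP i j b : oroot i j = Some b -> rlo b = i /\ rhi b = j.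
Proof. by rewrite /oroot; case: {-}_ / idP => // le_ij [<-]. Qed.

Lemma oroot_root a : oroot (rlo a) (rhi a) = Some a.
Proof.
rewrite /oroot; case: {-}_ / idP => [le|]; last by rewrite rlo_le_hi.
by congr Some; apply: root_eq.
Qed.

Definition row_mu (i0 i : 'I_n) a : option root :=
  if rlo a == i0 then oroot i (rhi a) else None.
Definition col_mu (j0 j : 'I_n) a : option root :=
  if rhi a == j0 then oroot (rlo a) j else None.

Lemma row_muP i0 i a b : row_mu i0 i a = Some b -> [/\ rlo a = i0, rlo b = i & rhi b = rhi a].
Proof.
rewrite /row_mu; by case: eqP => // -> /orootP[].
Qed.

Lemma col_muP j0 j a b : col_mu j0 j a = Some b -> [/\ rhi a = j0, rhi b = j & rlo b = rlo a].
Proof.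
rewrite /col_mu; by case: eqP => // -> /orootP[].
Qed.

Lemma row_mu_compat i0 i : compat (row_mu i0 i).
Proof.
move=> a b a' b' /row_muP[lo lo' hi] /row_muP[lo1 lo1' hi1].
by split=> k; rewrite ?lo ?lo' ?lo1 ?lo1' ?hi ?hi1 // addnC.
Qed.

Lemma col_mu_compat i0 i : compat (col_mu i0 i).
Proof.
move=> a b a' b' /col_muP[lo lo' hi] /col_muP[lo1 lo1' hi1].
by split=> k; rewrite ?lo ?lo' ?lo1 ?lo1' ?hi ?hi1 // addnC.
Qed.

End Moves.

Section Straightening.
Variables (F : numFieldType) (B : comAlgType F) (n : nat).
Local Notation root := (posroot n).
Local Notation expo := {ffun root -> nat}.
Implicit Types (a b r : root) (s t u : expo) (L : seq expo).
Variables (y : root -> B) (I : B -> Prop) (lam : 'I_n -> nat).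
Hypothesis I0 : I 0.
Hypothesis ID : forall p q, I p -> I q -> I (p + q).
Hypothesis IM : forall p q, I p -> I (q * p).
Hypothesis I_row : forall r (i : 'I_n), (rlo r < i)%N -> exists D, [/\ derivation D,
  forall p, I p -> I (D p)
  & forall a, in_tri r a -> D (y a) = oapp y 0 (row_mu (rlo r) i a)].
Hypothesis I_col : forall r (j : 'I_n), (j < rhi r)%N -> exists D, [/\ derivation D,
  forall p, I p -> I (D p)
  & forall a, in_tri r a -> D (y a) = oapp y 0 (col_mu (rhi r) j a)].
Hypothesis I_pow : forall r, I (y r ^+ (weight_root lam r).+1).

Definition mon s : B := \prod_a y a ^+ s a.

Lemma monD s t : mon [ffun a => s a + t a]%N = mon s * mon t.
Proof. by rewrite /mon -big_split; apply: eq_bigr => a _; rewrite ffunE exprD. Qed.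

Lemma mon_der D s : derivation D ->
  D (mon s) = \sum_a (mon [ffun c => s c - (c == a)]%N * D (y a)) *+ s a.
Proof.
move=> derD; rewrite der_prod //; apply: eq_bigr => a _.
rewrite derX // mulrnAr mulrA; congr (_ * _ *+ _).
rewrite [RHS](bigD1 a) //= ffunE eqxx subn1 mulrC; congr (_ * _).
by apply: eq_bigr => c /negbTE ne; rewrite ffunE ne subn0.
Qed.

Lemma mon_mv s a b : mon (mv s a b) = mon [ffun c => s c - (c == a)]%N * y b.
Proof.
rewrite -[y b](_ : mon [ffun c => (c == b) : nat] = _); last first.
  rewrite /mon (bigD1 b) //= ffunE eqxx expr1 big1 ?mulr1 // => c /negbTE ne.
  by rewrite ffunE ne expr0.
by rewrite -monD; congr mon; apply/ffunP => c; rewrite !ffunE.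
Qed.

(* Every term of the expansion has coefficient 1, with repetitions allowed, so
   that the coefficient of a listed monomial is visibly nonzero. *)
Definition expands r (p : B) s := exists L,
  [/\ p = \sum_(t <- L) mon t, s \in L
    & forall t, t \in L -> (forall a, t a != 0%N -> in_tri r a) /\ same_margins s t].

(** The Leibniz rule replaces one factor [y c] by its image in [t c] ways; listing the new monomial
    that many times keeps every coefficient equal to 1, so nothing cancels. *)
Lemma expands_move r p s mu D a b :
    derivation D -> compat mu ->
    (forall c, in_tri r c -> D (y c) = oapp y 0 (mu c)) ->
    (forall c d, in_tri r c -> mu c = Some d -> in_tri r d) ->
    expands r p s -> (0 < s a)%N -> mu a = Some b ->
  expands r (D p) (mv s a b).
Proof.
move=> derD cmp Dy mu_tri [L [-> Ls LP]] sa ab.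
pose f t c := if mu c is Some d then nseq (t c) (mv t c d) else [::].
exists (flatten [seq flatten [seq f t c | c <- index_enum root] | t <- L]); split.
- rewrite der_sum // big_flatten big_map; rewrite big_seq [RHS]big_seq; apply: eq_bigr => t Lt.
  rewrite mon_der // big_flatten big_map; apply: eq_bigr => c _.
  have [tc|tc] := eqVneq (t c) 0%N.
    by rewrite /f tc; case: (mu c) => [d|]; rewrite ?big_nil.
  have [tri_t _] := LP _ Lt; rewrite Dy ?tri_t // /f; case: (mu c) => [d|] /=.
    by rewrite big_nseq iter_addr addr0 mon_mv.
  by rewrite mulr0 mul0rn big_nil.
- apply/flattenP; eexists; first by apply: (map_f _ Ls).
  apply/flattenP; exists (f s a); first by apply: map_f; rewrite mem_index_enum.
  by rewrite /f ab mem_nseq sa eqxx.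
move=> t' /flattenP[_ /mapP[t Lt ->]] /flattenP[_ /mapP[c _ ->]].
rewrite /f; case cd: (mu c) => [d|] //; rewrite mem_nseq => /andP[tc /eqP->].
have [tri_t mar] := LP _ Lt; split; last exact: (same_margins_mv cmp).
move=> e; rewrite ffunE; have [->|_] := eqVneq e d => [_|].
  by apply: mu_tri cd; apply: tri_t; rewrite -lt0n.
by rewrite addn0 => ne0; apply: tri_t; move: ne0; clear; lia.
Qed.

(** Induction on the total distance of [s] from [r], run backwards: a unit at a root starting too
    late is moved back to start at [rlo r], and a derivation moves it forward again. Once all roots
    start at [rlo r], a unit ending too early is moved back to [r] itself. When nothing is left to
    move, the monomial is the given power of [y r]. *)
Lemma expands_exists r N s : I (y r ^+ N) ->
    (forall a, s a != 0%N -> in_tri r a) -> (\sum_a s a = N)%N ->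
  exists2 p, I p & expands r p s.
Proof.
move=> IN.
have [m] := ubnP (\sum_a s a * ((rlo a - rlo r) + (rhi r - rhi a)))%N.
elim: m s => // m IHm s lt_m tri_s sum_s.
have step a b mu D : derivation D -> compat mu -> (forall p, I p -> I (D p)) ->
    (forall c, in_tri r c -> D (y c) = oapp y 0 (mu c)) ->
    (forall c d, in_tri r c -> mu c = Some d -> in_tri r d) ->
    mu b = Some a -> (0 < s a)%N -> a != b -> in_tri r b ->
    ((rlo b - rlo r) + (rhi r - rhi b) < (rlo a - rlo r) + (rhi r - rhi a))%N ->
    exists2 p, I p & expands r p s.
  move=> derD cmp DI Dy mu_tri ba sa ab tri_b lt_ba.
  have sb : (0 < mv s a b b)%N by rewrite ffunE eqxx addn1.
  have [|c||p Ip exp] := IHm (mv s a b).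
  - pose w (c : root) := ((rlo c - rlo r) + (rhi r - rhi c))%N.
    rewrite -ltnS; apply: leq_trans lt_m; rewrite !ltnS.
    have E : (\sum_c mv s a b c * w c + w a = \sum_c s c * w c + w b)%N.
      rewrite (bigD1 a) //= [in RHS](bigD1 a) //= (bigD1 b) 1?eq_sym //=.
      rewrite [in RHS](bigD1 b) 1?eq_sym //= !ffunE !eqxx (negbTE ab) eq_sym (negbTE ab).
      set S1 := (\sum_(_ | _) _)%N; set S2 := (\sum_(_ | _) _)%N.
      have -> : S1 = S2.
        by apply: eq_bigr => c /andP[/negbTE ca /negbTE cb]; rewrite ffunE ca cb subn0 addn0.
      move: sa; case: (s a) => // k _; rewrite subn1 addn0 subn0 /= addn1 !mulSn.
      by clear; lia.
    move: E lt_ba; rewrite -/(w a) -/(w b).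
    by move: (\sum_c s c * w c)%N (\sum_c mv s a b c * w c)%N => S1 S2; clear; lia.
  - rewrite ffunE; have [-> _|_] := eqVneq c b; first exact: tri_b.
    by rewrite addn0 => ne0; apply: tri_s; move: ne0; clear; lia.
  - exact: etrans (addIn (sum_mv predT b sa)) sum_s.
  exists (D p); first exact: DI.
  rewrite -(mvK sa ab); exact: (expands_move derD cmp).
have [/existsP[a /andP[sa lo_a]]|/existsPn nolo] :=
    boolP [exists a, (0 < s a)%N && (rlo r < rlo a)%N].
  have le_rh : (rlo r <= rhi a)%N by apply: leq_trans (ltnW lo_a) (rlo_le_hi a).
  have [D [derD DI Dy]] := I_row lo_a.
  have tri_a : in_tri r a by apply: tri_s; rewrite -lt0n.
  apply: (step a (mkroot le_rh) _ D derD (@row_mu_compat _ _ _) DI Dy) => //.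
  - move=> c d tri_c /row_muP[_ lo_d hi_d]; move: tri_c; rewrite /in_tri lo_d hi_d.
    by case/andP=> _ ->; rewrite ltnW.
  - by rewrite /row_mu rlo_mkroot eqxx rhi_mkroot oroot_root.
  - by apply: contraTneq lo_a => ->; rewrite rlo_mkroot ltnn.
  - by move: tri_a; rewrite /in_tri rlo_mkroot rhi_mkroot leqnn => /andP[].
  - by rewrite rlo_mkroot rhi_mkroot; move: lo_a; clear; lia.
have eq_lo a : s a != 0%N -> rlo a = rlo r.
  move=> sa; apply: val_inj; apply/eqP; rewrite eq_sym eqn_leq.
  by have /andP[-> _] := tri_s _ sa; have := nolo a; rewrite lt0n sa /= -leqNgt.
have [/existsP[a /andP[sa hi_a]]|/existsPn nohi] :=
    boolP [exists a, (0 < s a)%N && (rhi a < rhi r)%N].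
  have [D [derD DI Dy]] := I_col hi_a.
  have lo_a : rlo a = rlo r by apply: eq_lo; rewrite -lt0n.
  apply: (step a r _ D derD (@col_mu_compat _ _ _) DI Dy) => //.
  - move=> c d tri_c /col_muP[_ lo_d hi_d]; move: tri_c; rewrite /in_tri lo_d hi_d.
    by case/andP=> -> _; rewrite ltnW.
  - by rewrite /col_mu eqxx -lo_a oroot_root.
  - by apply: contraTneq hi_a => ->; rewrite ltnn.
  - by rewrite /in_tri !leqnn.
  - by move: hi_a; rewrite lo_a; clear; lia.
have eq_r a : s a != 0%N -> a = r.
  move=> sa; apply: root_eq; first by rewrite eq_lo.
  apply/eqP; rewrite eqn_leq.
  by have /andP[_ ->] := tri_s _ sa; have := nohi a; rewrite lt0n sa /= -leqNgt.
exists (y r ^+ N) => //; exists [:: s]; split; rewrite ?inE //.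
  rewrite big_seq1 /mon (bigD1 r) //= big1 ?mulr1 => [|a ne_ar].
    by rewrite -sum_s (bigD1 r) //= big1 ?addn0 // => a; apply: contraNeq => /eq_r->.
  by rewrite (_ : s a = 0%N) ?expr0 //; apply: contraNeq ne_ar => /eq_r->.
by move=> t /predU1P[->|//]; split.
Qed.

Definition reducible (p : B) := exists2 q, I q &
  lspan (fun w => exists2 s, polytope lam s & w = mon s) (p - q).

Lemma reducibleD p q : reducible p -> reducible q -> reducible (p + q).
Proof.
move=> [p' Ip Sp] [q' Iq Sq]; exists (p' + q'); first exact: ID.
by rewrite opprD addrACA; apply: lspanD.
Qed.

Lemma reducibleZ k p : reducible p -> reducible (k *: p).
Proof.
move=> [p' Ip Sp]; exists (k *: p'); last by rewrite -scalerBr; apply: lspanZ.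
by rewrite -[p']mul1r scalerAl; apply: IM.
Qed.

Lemma reducible_sum (J : Type) (l : seq J) (P : pred J) (E : J -> B) :
  (forall j, P j -> reducible (E j)) -> reducible (\sum_(j <- l | P j) E j).
Proof.
move=> red; apply: big_ind => //; last exact: reducibleD.
by exists 0 => //; rewrite subrr; apply: lspan0.
Qed.

Lemma mon_reducible s : reducible (mon s).
Proof.
have [N] := ubnP (wgt s); elim: N s => // N IHN s lt_N.
have [Ps|] := boolP (polytope lam s).
  by exists 0 => //; rewrite subr0; apply: lspan_gen; exists s.
rewrite negb_forall => /existsP[a]; rewrite negb_forall => /existsP[A].
rewrite negb_imply -ltnNge => /andP[/andP[chA /forall_inP triA] lt_w].
pose u : expo := [ffun b => if b \in A then s b else 0%N].
have uA b : u b != 0%N -> b \in A by rewrite ffunE; case: ifP.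
have sum_u : (\sum_b u b = \sum_(b in A) s b)%N.
  by rewrite [RHS]big_mkcond; apply: eq_bigr => b _; rewrite ffunE.
have I_u : I (y a ^+ (\sum_(b in A) s b)).
  by rewrite -(subnK lt_w) exprD; apply: IM; apply: I_pow.
have [|p Ip [L [defp Lu LP]]] := expands_exists I_u _ sum_u.
  by move=> b /uA; apply: triA.
pose v : expo := [ffun b => s b - u b]%N.
have def_s : s = [ffun b => u b + v b]%N.
  by apply/ffunP => b; rewrite !ffunE; case: ifP => _; rewrite ?subnn ?addn0 ?subn0.
(* The multiplicity of [u] is a positive integer, invertible in characteristic zero; dividing by it
   isolates [mon s] from terms of smaller weight. *)
pose k := count_mem u L.
have k_gt0 : (0 < k)%N by rewrite -has_count has_pred1.
have -> : mon s = k%:R^-1 *: (mon v * p) +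
    (- k%:R^-1) *: \sum_(t <- L | t != u) mon v * mon t.
  have E : mon v * p = mon s *+ k + \sum_(t <- L | t != u) mon v * mon t.
    rewrite defp mulr_sumr (bigID (pred1 u)) /=; congr (_ + _).
    rewrite (eq_bigr (fun=> mon s)) => [|t /eqP->]; last by rewrite [in RHS]def_s monD mulrC.
    by rewrite big_const_seq iter_addr_0.
  rewrite E scalerDr scaleNr addrK -scaler_nat scalerA mulVf ?scale1r //.
  by rewrite pnatr_eq0 -lt0n.
apply: reducibleD; apply: reducibleZ.
  by exists (mon v * p); rewrite ?subrr; [apply: IM | apply: lspan0].
rewrite big_seq_cond; apply: reducible_sum => t /andP[Lt ne_tu].
rewrite mulrC -monD; apply: IHN; rewrite -ltnS; apply: leq_trans lt_N; rewrite !ltnS.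
have [_ mar] := LP _ Lt.
have := chain_wgt chA uA mar ne_tu; rewrite {1}def_s.
have wD (x z : expo) : wgt ([ffun b => x b + z b]%N : expo) = (wgt x + wgt z)%N.
  by rewrite /wgt -big_split; apply: eq_bigr => b _; rewrite ffunE mulnDl.
by rewrite !wD ltn_add2r.
Qed.

End Straightening.

(** * The action of n^+ on S(n^-) *)

Lemma mpoly_gen_ind (R : nzRingType) k (P : {mpoly R[k]} -> Prop) :
    (forall c, P c%:MP) -> (forall i, P 'X_i) ->
    (forall p q, P p -> P q -> P (p + q)) -> (forall p q, P p -> P q -> P (p * q)) ->
  forall p, P p.
Proof.
move=> PC PX PD PM p; elim/mpolyind: p => [|c m p _ _ IHp]; first by rewrite -mpolyC0.
apply: PD => //; rewrite -mul_mpolyC; apply: (PM) => //.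
rewrite mpolyXE_id; apply: (big_ind P) => [||i _]; [by rewrite -mpolyC1 | exact: PM |].
by elim: (m i) => [|d IHd]; rewrite ?expr0 -?mpolyC1 // exprS; apply: PM.
Qed.

Section Circ.
Variables (F : numFieldType) (n : nat).
Local Notation M := 'M[F]_n.+1.
Local Notation sl := (sl F n).
Local Notation nm := (subvs_of (nminus F n)).
Local Notation np := (subvs_of (nplus F n)).
Local Notation root := (posroot n).
Implicit Types (a b r : root) (A : M).

Definition mx_of (x : nm) : M := vsval (vsval x).
(** With indices from 0, the root [(p, q)] is the difference of the diagonal coordinates [p] and
    [q + 1], so its negative root vector is the matrix unit in row [q + 1] and column [p]. *)
Definition rrow a : 'I_n.+1 := lift ord0 (rhi a).
Definition rcol a : 'I_n.+1 := widen_ord (leqnSn n) (rlo a).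

Lemma mx_of_inj : injective mx_of.
Proof. by move=> x y /val_inj/val_inj. Qed.

Lemma mx_of_linear : linear mx_of.
Proof. by move=> k x y. Qed.
HB.instance Definition _ := GRing.isLinear.Build F nm M _ mx_of mx_of_linear.

Definition low_mx A : M := \matrix_(i, j) if (j < i)%N then A i j else 0.

Lemma low_mx_linear : linear low_mx.
Proof.
move=> k A B; apply/matrixP => i j; rewrite !mxE; case: ifP => // _.
by rewrite mulr0 addr0.
Qed.
HB.instance Definition _ := GRing.isLinear.Build F M M _ low_mx low_mx_linear.

Definition nm_of A : nm := vsproj (nminus F n) (vsproj (sl_space F n) (low_mx A)).

Lemma nm_of_linear : linear nm_of.
Proof. by move=> k A B; rewrite /nm_of !linearP. Qed.
HB.instance Definition _ := GRing.isLinear.Build F M nm _ nm_of nm_of_linear.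

Lemma mx_of_nm A : mx_of (nm_of A) = low_mx A.
Proof.
have trA : low_mx A \in sl_space F n.
  by rewrite mem_sl /mxtrace big1 // => i _; rewrite mxE ltnn.
rewrite /mx_of /nm_of vsprojK ?vsprojK //; apply/mem_nminus => i j le_ij.
by rewrite vsprojK // mxE ltnNge le_ij.
Qed.

Lemma mx_of_low (x : nm) (i j : 'I_n.+1) : (i <= j)%N -> mx_of x i j = 0.
Proof. by have /mem_nminus := subvsP x; apply. Qed.

Lemma nm_of_mx (x : nm) : nm_of (mx_of x) = x.
Proof.
apply: mx_of_inj; rewrite mx_of_nm; apply/matrixP => i j; rewrite mxE.
by case: ltnP => // /mx_of_low->.
Qed.

Lemma nm_of_delta_up (i j : 'I_n.+1) : (i <= j)%N -> nm_of (delta_mx i j) = 0.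
Proof.
move=> le_ij; apply: mx_of_inj; rewrite mx_of_nm raddf0; apply/matrixP => k l.
rewrite !mxE; case: ifP => // lt_lk; case: eqP => [ek|] //=; case: eqP => [el|] //=.
by move: lt_lk; rewrite ek el ltnNge le_ij.
Qed.

Definition froot a : nm := nm_of (delta_mx (rrow a) (rcol a)).

Lemma rrow_val a : rrow a = (rhi a).+1 :> nat. Proof. by []. Qed.
Lemma rcol_val a : rcol a = rlo a :> nat. Proof. by []. Qed.

Lemma rcol_lt_row a : (rcol a < rrow a)%N.
Proof. exact: rlo_le_hi. Qed.

Lemma mx_of_froot a : mx_of (froot a) = delta_mx (rrow a) (rcol a).
Proof.
rewrite mx_of_nm; apply/matrixP => i j; rewrite !mxE; case: ltnP => // le_ij.
case: eqP => [ei|] //=; case: eqP => [ej|] //=.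
by move: le_ij; rewrite ei ej leqNgt rcol_lt_row.
Qed.

Lemma root_of_pos (i j : 'I_n.+1) : (j < i)%N -> exists a, i = rrow a /\ j = rcol a.
Proof.
move=> lt_ji; have i_gt0 : (0 < i)%N by apply: leq_trans lt_ji.
have lt_jn : (j < n)%N by rewrite -ltnS (leq_trans _ (ltn_ord i)).
have lt_in : (i.-1 < n)%N by have := ltn_ord i; rewrite -{1}(prednK i_gt0) ltnS.
have le_ji : (Ordinal lt_jn <= Ordinal lt_in)%N by rewrite /= -ltnS prednK.
exists (mkroot le_ji); split; apply: val_inj => //=.
by rewrite /bump leq0n add1n prednK.
Qed.

Lemma rrow_inj a b : rrow a = rrow b -> rcol a = rcol b -> a = b.
Proof.
by move=> /(congr1 val) /= [H1] /(congr1 val) /= H2; apply: root_eq.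
Qed.

Lemma nm_decomp (x : nm) : x = \sum_a mx_of x (rrow a) (rcol a) *: froot a.
Proof.
apply: mx_of_inj; rewrite linear_sum; apply/matrixP => i j; rewrite summxE.
have [le_ij|lt_ji] := leqP i j.
  rewrite mx_of_low // big1 // => a _; rewrite linearZ /= mx_of_froot !mxE.
  case: eqP => [ei|] /=; last by rewrite mulr0.
  case: eqP => [ej|] /=; last by rewrite mulr0.
  by move: le_ij; rewrite ei ej leqNgt rcol_lt_row.
have [a [-> ->]] := root_of_pos lt_ji.
rewrite (bigD1 a) //= linearZ /= mx_of_froot !mxE !eqxx mulr1 big1 ?addr0 // => b ne_ba.
rewrite linearZ /= mx_of_froot !mxE.
case: eqP => [er|] /=; last by rewrite mulr0.
case: eqP => [ec|] /=; last by rewrite mulr0.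
by case/eqP: ne_ba; apply: rrow_inj.
Qed.

(** Turns the direct-sum projection inside [sym_proj] into truncation of matrices, which makes
    [circ] computable on matrix units. *)
Lemma nminus_proj (x : sl) :
  vsproj (nminus F n) (daddv_pi (nminus F n) (cartan F n + nplus F n) x) = nm_of (vsval x).
Proof.
have [u un [w wcp ->]] : exists2 u, u \in nminus F n &
    exists2 w, w \in (cartan F n + nplus F n)%VS & x = u + w.
  by apply/memv_addP; rewrite addv_triangular memvf.
have cap := @capv_triangular F n.
have w0 : daddv_pi (nminus F n) (cartan F n + nplus F n) w = 0.
  have := daddv_pi_add cap (subvP (addvSr _ _) _ wcp).
  rewrite (daddv_pi_id (U := (cartan F n + nplus F n)%VS)) //; last by rewrite capvC.
  by move=> /(canRL (addrK _)) ->; rewrite subrr.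
rewrite raddfD /= w0 addr0 daddv_pi_id //; apply: mx_of_inj; rewrite mx_of_nm /mx_of vsprojK //.
apply/matrixP => i j; rewrite !mxE.
move/memv_addP: wcp => [h /mem_cartan h0 [e /mem_nplus e0 ->]].
case: ltnP => [lt_ji|le_ij]; last by move/mem_nminus: un => ->.
by rewrite /= !mxE h0 ?e0 ?addr0 // ?(ltnW lt_ji) // -val_eqE /= gtn_eqF.
Qed.

Lemma sl_bracket_linear (x : sl) : linear (sl_bracket x).
Proof.
move=> k y z; apply: val_inj; rewrite /= -!/(vsval _) val_sl_bracket /= !val_sl_bracket /=.
rewrite mulmxDl mulmxDr -scalemxAl -scalemxAr scalerBr !opprD.
by rewrite !addrA; congr (_ + _); rewrite addrAC.
Qed.
HB.instance Definition _ (x : sl) :=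
  GRing.isLinear.Build F sl sl _ (sl_bracket x) (sl_bracket_linear x).

Lemma sym_mapD (U W : vectType F) (f : U -> W) p q :
  sym_map f (p + q) = sym_map f p + sym_map f q.
Proof. exact: rmorphD. Qed.

Lemma sym_mapC (U W : vectType F) (f : U -> W) c : sym_map f c%:MP = c%:MP.
Proof. exact: mmapC. Qed.

Lemma sym_derD (U : vectType F) (f : U -> U) p q :
  sym_der f (p + q) = sym_der f p + sym_der f q.
Proof.
by rewrite /sym_der -big_split; apply: eq_bigr => i _; rewrite mderivD mulrDr.
Qed.

Lemma sym_derC (U : vectType F) (f : U -> U) c : sym_der f c%:MP = 0.
Proof. by rewrite /sym_der big1 // => i _; rewrite mderivC mulr0. Qed.

Lemma sym_in_vbasis (U : vectType F) (i : 'I_(\dim {:U})) :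
  sym_in (vbasis {:U})`_i = 'X_i.
Proof.
rewrite /sym_in (bigD1 i) //= coord_free ?eqxx ?scale1r ?(basis_free (vbasisP _)) //.
rewrite big1 ?addr0 // => j ne_ji; rewrite coord_free ?(basis_free (vbasisP _)) //.
by rewrite eq_sym (negbTE ne_ji) scale0r.
Qed.

Lemma Sym_ind (U : vectType F) (P : Sym U -> Prop) :
    (forall c, P c%:MP) -> (forall u, P (sym_in u)) ->
    (forall p q, P p -> P q -> P (p + q)) -> (forall p q, P p -> P q -> P (p * q)) ->
  forall p, P p.
Proof.
by move=> PC PS PD PM; apply: mpoly_gen_ind => // i; rewrite -sym_in_vbasis.
Qed.

Lemma sym_proj_in (x : sl) : sym_proj (sym_in x) = sym_in (nm_of (vsval x)).
Proof.
rewrite -nminus_proj.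
exact: (sym_map_in (vsproj (nminus F n) \o daddv_pi (nminus F n) (cartan F n + nplus F n))).
Qed.

Lemma sym_projD p q : @sym_proj F n (p + q) = sym_proj p + sym_proj q.
Proof. exact: sym_mapD. Qed.

Lemma sym_projM p q : @sym_proj F n (p * q) = sym_proj p * sym_proj q.
Proof. exact: sym_mapM. Qed.

Lemma sym_projK (p : Sym nm) : sym_proj (sym_map vsval p) = p.
Proof.
elim/Sym_ind: p => [c|x|p q IHp IHq|p q IHp IHq].
- by rewrite /sym_proj !sym_mapC.
- by rewrite sym_map_in sym_proj_in nm_of_mx.
- by rewrite sym_mapD sym_projD IHp IHq.
- by rewrite sym_mapM sym_projM IHp IHq.
Qed.

(** [sym_proj] is a ring morphism that retracts the inclusion of S(n^-), so the undifferentiated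
    factor of each Leibniz term comes back unchanged. *)
Lemma circ_derivation (e : np) : derivation (circ e).
Proof.
split=> [p q|p q]; rewrite /circ; first by rewrite sym_mapD sym_derD sym_projD.
by rewrite sym_mapM sym_derM sym_projD !sym_projM !sym_projK.
Qed.

Lemma circC (e : np) c : circ e c%:MP = 0.
Proof. by rewrite /circ sym_mapC sym_derC /sym_proj /sym_map mmap0. Qed.

Lemma circZ (e : np) c p : circ e (c *: p) = c *: circ e p.
Proof. by rewrite -!mul_mpolyC (circ_derivation e).2 circC mul0r add0r. Qed.

Lemma circ_in (e : np) (x : nm) :
  circ e (sym_in x) = sym_in (nm_of (vsval (vsval e) *m mx_of x - mx_of x *m vsval (vsval e))).
Proof. by rewrite /circ sym_map_in sym_der_in sym_proj_in val_sl_bracket. Qed.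

Lemma np_delta (i j : 'I_n.+1) : (i < j)%N -> exists e : np, vsval (vsval e) = delta_mx i j.
Proof.
move=> lt_ij; pose d := vsproj (sl_space F n) (delta_mx i j).
have vd : vsval d = delta_mx i j.
  rewrite vsprojK // mem_sl /mxtrace big1 // => k _; rewrite mxE.
  by case: eqP => [->|] //=; case: eqP => [eij|] //=; rewrite eij ltnn in lt_ij.
exists (vsproj (nplus F n) d); rewrite vsprojK //; apply/mem_nplus => k l le_lk.
rewrite vd mxE; case: eqP => [ek|] //=; case: eqP => [el|] //=.
by move: le_lk; rewrite ek el leqNgt lt_ij.
Qed.

Definition yroot a : Sym nm := sym_in (froot a).

(** The commutator of a matrix unit of n^+ with [f_a] has two terms. For [a] in the triangle of [r]
    the product with [f_a] on the right lands on or above the diagonal and dies; the surviving term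
    carries the sign removed here. In [circ_col] the roles of the two terms are exchanged. *)
Lemma circ_row r (i : 'I_n) : (rlo r < i)%N -> exists e : np, forall a, in_tri r a ->
  - circ e (yroot a) = oapp yroot 0 (row_mu (rlo r) i a).
Proof.
move=> lt_ri; pose wi := widen_ord (leqnSn n).
have [e ve] := @np_delta (wi (rlo r)) (wi i) lt_ri.
exists e => a /andP[lo_a hi_a]; rewrite circ_in ve mx_of_froot !mul_delta_mx_cond.
rewrite raddfB raddfMn /= nm_of_delta_up ?mul0rn ?sub0r //.
rewrite raddfN opprK raddfMn /= /row_mu -val_eqE /=.
case: (rlo a =P rlo r) => [e_lo|ne_lo]; last first.
  case: eqP => [e_lo|_]; last by rewrite mulr0n raddf0.
  by case: ne_lo; apply: val_inj.
rewrite e_lo eqxx mulr1n /oroot; case: {-}_ / idP => [le_i|/negP] /=; last first.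
  by rewrite -ltnNge => lt_ai; rewrite nm_of_delta_up ?raddf0.
by congr (sym_in (nm_of (delta_mx _ _))); apply: val_inj.
Qed.

Lemma circ_col r (j : 'I_n) : (j < rhi r)%N -> exists e : np, forall a, in_tri r a ->
  circ e (yroot a) = oapp yroot 0 (col_mu (rhi r) j a).
Proof.
move=> lt_jr; have lt_lift : (lift ord0 j < lift ord0 (rhi r))%N by [].
have [e ve] := @np_delta _ _ lt_lift.
exists e => a /andP[lo_a hi_a]; rewrite circ_in ve mx_of_froot !mul_delta_mx_cond.
rewrite raddfB !raddfMn /= [nm_of (delta_mx (rrow a) _)]nm_of_delta_up ?oppr0 ?mul0rn ?addr0 //.
rewrite /col_mu (inj_eq lift_inj) eq_sym.
case: (rhi a =P rhi r) => [e_hi|ne_hi]; last by rewrite mulr0n raddf0.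
rewrite mulr1n /oroot; case: {-}_ / idP => [le_i|/negP] /=; last first.
  by rewrite -ltnNge => lt_ai; rewrite nm_of_delta_up ?raddf0.
by congr (sym_in (nm_of (delta_mx _ _))); apply: val_inj.
Qed.

Lemma root_of_telescope (a : root) (h : sl) :
  root_of a h = vsval h (rcol a) (rcol a) - vsval h (rrow a) (rrow a).
Proof.
pose d k := vsval h (inord k) (inord k).
have -> : root_of a h = \sum_(rlo a <= i < (rhi a).+1) (d i - d i.+1).
  rewrite /root_of big_geq_mkord /= (big_ord_widen_cond n
    (fun i => rlo a <= i)%N (fun i => d i - d i.+1) (ltn_ord (rhi a))).
  apply: eq_big => [i|i _]; first by rewrite ltnS.
  rewrite /simple_root /d; congr (vsval h _ _ - vsval h _ _); apply: val_inj => /=;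
    by rewrite inordK // ltnS ?(ltnW (ltn_ord i)).
rewrite -[LHS]opprK -sumrN; under eq_bigr do rewrite opprB.
rewrite telescope_sumr ?leqW ?rlo_le_hi // opprB /d.
by congr (vsval h _ _ - vsval h _ _); apply: val_inj; rewrite /= inordK // ltnS ?(ltnW (ltn_ord _)).
Qed.

(** Subtracting the mean makes the trace zero and leaves all differences of diagonal entries
    unchanged, so roots can be tested on an arbitrary [d]. *)
Definition diag_sl (d : 'I_n.+1 -> F) : sl :=
  vsproj (sl_space F n) (diag_mx (\row_i (d i - n.+1%:R^-1 * \sum_j d j))).

Lemma val_diag_sl d : vsval (diag_sl d) = diag_mx (\row_i (d i - n.+1%:R^-1 * \sum_j d j)).
Proof.
rewrite vsprojK // mem_sl mxtrace_diag; under eq_bigr do rewrite mxE.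
rewrite sumrB sumr_const card_ord -[X in _ - X]mulr_natl mulrA.
by rewrite mulfV ?pnatr_eq0 // mul1r subrr.
Qed.

Lemma diag_sl_cartan d : diag_sl d \in cartan F n.
Proof. by apply/mem_cartan => i j ne_ij; rewrite val_diag_sl !mxE (negbTE ne_ij) mulr0n. Qed.

Lemma diag_sl_diff d i j :
  vsval (diag_sl d) i i - vsval (diag_sl d) j j = d i - d j.
Proof. by rewrite val_diag_sl !mxE !eqxx !mulr1n opprB addrA subrK. Qed.

Lemma bracket_diag_entry d (x : sl) i j :
  vsval (sl_bracket (diag_sl d) x) i j = (d i - d j) * vsval x i j.
Proof.
rewrite val_sl_bracket -(diag_sl_diff d) mulrBl val_diag_sl mul_diag_mx mul_mx_diag !mxE.
by rewrite !eqxx !mulr1n [X in _ - X]mulrC.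
Qed.

(** Root spaces are lines: diagonal matrices built from indicator functions kill all entries of [x]
    but one. When the row of the entry is [rcol a], it is killed by the factor 2. *)
Lemma root_vectorE a (x : nm) : root_vector a x -> exists2 c, c != 0 & x = c *: froot a.
Proof.
move=> [x0 xP].
have xd d i j : (d i - d j) * mx_of x i j = (d (rrow a) - d (rcol a)) * mx_of x i j.
  have /(congr1 (fun z : sl => vsval z i j)) := xP _ (diag_sl_cartan d).
  by rewrite bracket_diag_entry /= !mxE root_of_telescope diag_sl_diff opprB.
have x_ij i j : (i != rrow a) || (j != rcol a) -> mx_of x i j = 0.
  have [le_ij _|lt_ji] := leqP i j; first exact: mx_of_low.
  have ne_ij : (i == j) = false by apply/eqP => e; rewrite e ltnn in lt_ji.
  have [ei /= ne_j|ne_i _] := eqVneq i (rrow a).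
    have := xd (fun k => (k == j)%:R) i j; rewrite eqxx ne_ij -ei ne_ij.
    rewrite [rcol a == j]eq_sym (negbTE ne_j) sub0r subr0 mul0r mulN1r.
    by move/eqP; rewrite oppr_eq0 => /eqP.
  have := xd (fun k => (k == i)%:R) i j; rewrite eqxx [j == i]eq_sym ne_ij subr0 mul1r.
  rewrite [rrow a == i]eq_sym (negbTE ne_i) sub0r => /eqP.
  rewrite -subr_eq0 -[X in X - _]mul1r -mulrBl mulf_eq0 opprK => /orP[|/eqP//].
  by rewrite -(natrD _ 1) pnatr_eq0.
have def_x : x = mx_of x (rrow a) (rcol a) *: froot a.
  apply: mx_of_inj; rewrite linearZ /= mx_of_froot; apply/matrixP => i j; rewrite !mxE.
  case: eqVneq => [->|ne] /=; last by rewrite mulr0 x_ij ?ne.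
  case: eqVneq => [->|ne'] /=; last by rewrite mulr0 x_ij ?ne' ?orbT.
  by rewrite mulr1.
exists (mx_of x (rrow a) (rcol a)) => //.
by apply: contraNneq x0 => c0; rewrite def_x c0 scale0r.
Qed.

Section Ideal.
Variable G : Sym nm -> Prop.

Definition circ_ideal : Sym nm -> Prop := ideal_gen (Unplus_span G).

Lemma circ_ideal0 : circ_ideal 0. Proof. exact: lspan0. Qed.

Lemma circ_idealD p q : circ_ideal p -> circ_ideal q -> circ_ideal (p + q).
Proof. exact: lspanD. Qed.

Lemma circ_idealM p q : circ_ideal p -> circ_ideal (q * p).
Proof. exact: (@lspanZ _ (Sym nm)^o). Qed.

Lemma circ_ideal_gen p : G p -> circ_ideal p.
Proof. by move=> Gp; apply/lspan_gen/lspan_gen; exists [::], p. Qed.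

(** A derivation preserving the generating submodule preserves the ideal it generates; the Leibniz
    rule needs membership of the element itself, hence the conjunction in the induction. *)
Lemma circ_ideal_circ (e : np) p : circ_ideal p -> circ_ideal (circ e p).
Proof.
have derE := circ_derivation e; have [eD eM] := derE.
move=> Ip; suff [] : circ_ideal p /\ circ_ideal (circ e p) by [].
move: p Ip; apply: (@lspan_ind _ (Sym nm)^o).
- by rewrite (der0 derE); split; apply: circ_ideal0.
- move=> k u w [Iu Ieu] [Iw Iew]; rewrite -[k *: u]/(k * u); split.
    by apply: circ_idealD => //; apply: circ_idealM.
  rewrite eD eM; apply: circ_idealD => //.
  by apply: circ_idealD; apply: circ_idealM.
move=> u Uu; split; first exact: lspan_gen.
apply: lspan_gen; move: u Uu.
apply: (@lspan_ind F (Sym nm) _ (fun u => Unplus_span G (circ e u))).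
- have e0 : circ e 0 = 0 := der0 derE.
  rewrite e0; exact: lspan0.
- move=> k u w Uu Uw; rewrite eD circZ. exact: (lspanD (lspanZ k Uu) Uw).
by move=> _ [es [g [Gg ->]]]; apply: lspan_gen; exists (e :: es), g.
Qed.

End Ideal.

End Circ.

(** * A model of V(lambda) on polynomials in matrix entries *)

Section PolyDerivation.
Variables (F : fieldType) (I : finType).
Local Notation P := {mpoly F[#|I|]}.

Definition pvar (i : I) : P := 'X_(enum_rank i).

Definition pder (g : I -> P) (p : P) : P := \sum_i g i * mderiv (enum_rank i) p.

Lemma pder_derivation g : derivation (pder g).
Proof.
split=> p q; rewrite /pder.
  by rewrite -big_split; apply: eq_bigr => i _; rewrite mderivD mulrDr.
rewrite mulr_suml mulr_sumr -big_split; apply: eq_bigr => i _ /=.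
by rewrite mderivM mulrDr !mulrA [p * _]mulrC.
Qed.

Lemma pderC g c : pder g c%:MP = 0.
Proof. by rewrite /pder big1 // => i _; rewrite mderivC mulr0. Qed.

Lemma pderZ g c p : pder g (c *: p) = c *: pder g p.
Proof. by rewrite -!mul_mpolyC (pder_derivation g).2 pderC mul0r add0r. Qed.

Lemma mderivXU k (i j : 'I_k) : ('X_j : {mpoly F[k]})^`M(i) = (i == j)%:R.
Proof.
rewrite mderivX mnm1E eq_sym; case: eqVneq => [->|]; last by rewrite scale0r.
by rewrite scale1r -[X in (X - _)%MM]add0m addmK mpolyX0.
Qed.

Lemma pder_var g i : pder g (pvar i) = g i.
Proof.
rewrite /pder (bigD1 i) //= mderivXU eqxx mulr1 big1 ?addr0 // => j ne_ji.
by rewrite mderivXU (inj_eq enum_rank_inj) (negbTE ne_ji) mulr0.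
Qed.

Lemma pvar_ind (Q : P -> Prop) :
    (forall c, Q c%:MP) -> (forall i, Q (pvar i)) ->
    (forall p q, Q p -> Q q -> Q (p + q)) -> (forall p q, Q p -> Q q -> Q (p * q)) ->
  forall p, Q p.
Proof.
move=> QC QV QD QM; apply: mpoly_gen_ind => // i.
by rewrite -(enum_valK i); apply: QV.
Qed.

End PolyDerivation.

Section Nilpotent.
Variables (B : comNzRingType) (D : B -> B).
Hypothesis derD : derivation D.

Lemma iter_der0 m : iter m D 0 = 0.
Proof. by elim: m => //= m ->; apply: der0. Qed.

Lemma iter_derD m p q : iter m D (p + q) = iter m D p + iter m D q.
Proof. by elim: m => //= m ->; rewrite derD.1. Qed.

Lemma iter_derM a b m p q : (a + b <= m.+1)%N ->
  iter a D p = 0 -> iter b D q = 0 -> iter m D (p * q) = 0.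
Proof.
elim: m a b p q => [|m IHm] [|a] [|b] p q le_m.
- by move=> /= ->; rewrite mul0r.
- by move=> /= ->; rewrite mul0r.
- by move=> _ /= ->; rewrite mulr0.
- by move: le_m; rewrite addnS addSn.
- by move=> p0 _; rewrite (p0 : p = 0) mul0r iter_der0.
- by move=> p0 _; rewrite (p0 : p = 0) mul0r iter_der0.
- by move=> _ q0; rewrite (q0 : q = 0) mulr0 iter_der0.
move=> Dp Dq; rewrite iterSr derD.2 iter_derD.
rewrite (IHm a b.+1) ?(IHm a.+1 b) ?addr0 // -?iterSr //.
by move: le_m; rewrite addnS ltnS.
Qed.

Lemma iter_der_prod (I : finType) (E : I -> B) (d : I -> nat) :
  (forall i, iter (d i).+1 D (E i) = 0) -> iter (\sum_i d i).+1 D (\prod_i E i) = 0.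
Proof.
move=> Ed; apply: (big_ind2 (fun k p => iter k.+1 D p = 0)) => [|a p b q Dp Dq|i _].
- exact: der1.
- by apply: (@iter_derM a.+1 b.+1 (a + b).+1) => //; rewrite addSn addnS.
exact: Ed.
Qed.

End Nilpotent.

Section Model.
Variables (F : numFieldType) (n : nat) (lam : 'I_n -> nat).
Local Notation M := 'M[F]_n.+1.
Local Notation root := (posroot n).

(* Every factor of the highest weight vector has its own variables, so that one
   evaluation point can extract independent coefficients from all of them. *)
Definition block : finType := {i : 'I_n & 'I_(lam i)}.
Definition cell : finType := ('I_n.+1 * (block * 'I_n.+1))%type.
Local Notation model := {mpoly F[#|cell|]}.
Implicit Types (X Y : M) (p q : model) (k : block) (a b c : 'I_n.+1).

Definition xvar a k c : model := pvar F ((a, (k, c)) : cell).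

(** For fixed [(k, c)] the variables span a copy of the standard representation, and [X] acts by the
    derivation extending its action there. *)
Definition mact X : model -> model :=
  pder (fun t : cell => \sum_a X a t.1 *: xvar a t.2.1 t.2.2).

Lemma mact_derivation X : derivation (mact X). Proof. exact: pder_derivation. Qed.

Lemma mact_var X a k c : mact X (xvar a k c) = \sum_b X b a *: xvar b k c.
Proof. exact: pder_var. Qed.

Lemma mactC X (c : F) : mact X c%:MP = 0. Proof. exact: pderC. Qed.

Lemma mactZ X (c : F) p : mact X (c *: p) = c *: mact X p. Proof. exact: pderZ. Qed.

Lemma mact0 X : mact X 0 = 0. Proof. exact: der0 (mact_derivation X). Qed.

Lemma mactD X p q : mact X (p + q) = mact X p + mact X q.
Proof. exact: (mact_derivation X).1. Qed.

Lemma mactM X p q : mact X (p * q) = mact X p * q + p * mact X q.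
Proof. exact: (mact_derivation X).2. Qed.

Lemma mact_linear X : linear (mact X).
Proof. by move=> c p q; rewrite mactD mactZ. Qed.

Lemma mact_linearl p : linear (mact^~ p).
Proof.
move=> c X Y; rewrite /mact /pder scaler_sumr -big_split; apply: eq_bigr => t _ /=.
rewrite scalerAl -mulrDl; congr (_ * _); rewrite scaler_sumr -big_split.
by apply: eq_bigr => a _; rewrite !mxE scalerDl scalerA.
Qed.

Lemma mact_bracket X Y p : mact (X *m Y - Y *m X) p = mact X (mact Y p) - mact Y (mact X p).
Proof.
elim/pvar_ind: p => [c|[b [k c]]|p q IHp IHq|p q IHp IHq].
- by rewrite !mactC ?mact0 subrr.
- rewrite -/(xvar b k c) !mact_var.
  transitivity (\sum_a (X *m Y) a b *: xvar a k c - \sum_a (Y *m X) a b *: xvar a k c).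
    by rewrite -sumrB; apply: eq_bigr => a _; rewrite !mxE scalerBl.
  have H (Z T : M) : \sum_a (Z *m T) a b *: xvar a k c = mact Z (\sum_a T a b *: xvar a k c).
    rewrite (der_sum (mact_derivation Z)).
    under [RHS]eq_bigr => a _ do rewrite mactZ mact_var scaler_sumr.
    rewrite exchange_big; apply: eq_bigr => a _ /=; rewrite mxE scaler_suml.
    by apply: eq_bigr => d _; rewrite scalerA mulrC.
  by rewrite !H.
- by rewrite !mactD IHp IHq opprD addrACA.
by rewrite !mactM IHp IHq !mactD !mactM; ring.
Qed.

Definition model_rep : sl_rep n model := @SlRep F n model
  (fun x => mact (vsval x)) (fun x => mact_linear (vsval x))
  (fun p d x y => mact_linearl p d (vsval x) (vsval y))
  (fun x y p => etrans (congr1 (mact^~ p) (val_sl_bracket x y)) (mact_bracket (vsval x) (vsval y) p)).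

(** The leading principal minor of order [i + 1], [i = tag k]: a highest weight vector of the
    exterior power of that degree, of weight [fund_weight i]. *)
Definition minor k : model :=
  \det (\matrix_(b < (tag k).+1, c < (tag k).+1) xvar (inord b) k (inord c)).

Definition hw_vec : model := \prod_k minor k.

Lemma mact_delta a b b' k c :
  mact (delta_mx a b) (xvar b' k c) = if b == b' then xvar a k c else 0.
Proof.
rewrite mact_var (bigD1 a) //= big1 ?addr0 => [|a' ne]; last first.
  by rewrite mxE (negbTE ne) scale0r.
by rewrite mxE eqxx eq_sym /=; case: eqP; rewrite ?scale1r ?scale0r.
Qed.

Lemma mact_matrix X p : mact X p = \sum_a \sum_b X a b *: mact (delta_mx a b) p.
Proof.
have m0 : mact 0 p = 0.
  by have := mact_linearl p (-1) 0 0; rewrite scaler0 addr0 scaleN1r addNr.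
have add (I : Type) (r : seq I) (E : I -> M) : mact (\sum_(i <- r) E i) p = \sum_(i <- r) mact (E i) p.
  elim: r => [|i r IHr]; rewrite ?big_cons ?big_nil //.
  by have := mact_linearl p 1 (E i) (\sum_(j <- r) E j); rewrite !scale1r IHr.
rewrite {1}[X]matrix_sum_delta add; apply: eq_bigr => a _; rewrite add.
apply: eq_bigr => b _.
by have := mact_linearl p (X a b) (delta_mx a b) 0; rewrite m0 !addr0.
Qed.

Lemma der_sign (D : model -> model) (s : bool) : derivation D -> D ((-1) ^+ s) = 0.
Proof.
by move=> derD; case: s; rewrite ?expr1 ?expr0 ?(derN derD) (der1 derD) ?oppr0.
Qed.

Lemma der_det (D : model -> model) m (N : 'M[model]_m) : derivation D ->
  (forall i j, D (N i j) = 0) -> D (\det N) = 0.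
Proof.
move=> derD N0; rewrite /determinant (der_sum derD) big1 // => s _.
rewrite derD.2 der_sign // mul0r add0r (_ : D _ = 0) ?mulr0 //.
by rewrite (der_prod derD) (eq_bigr (fun=> 0)) ?big1 // => i _; rewrite N0 mulr0.
Qed.

Lemma inord_lt k (i : 'I_(tag k).+1) : (i < n.+1)%N.
Proof. by rewrite (leq_trans (ltn_ord i)) // ltnS ltnW. Qed.

(** Each permutation product has exactly one factor from row [b], so the Leibniz sum has a single
    nonzero term and the result is again a determinant, with row [b] overwritten by row [a]. *)
Lemma mact_minor a b k : (b <= tag k)%N -> mact (delta_mx a b) (minor k) =
  \det (\matrix_(b' < (tag k).+1, c < (tag k).+1)
          xvar (if b == inord b' then a else inord b') k (inord c)).
Proof.
move=> le_b; have derD := mact_derivation (delta_mx a b).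
rewrite /minor /determinant (der_sum derD); apply: eq_bigr => s _.
rewrite mactM der_sign // mul0r add0r.
congr (_ * _); rewrite (der_prod derD).
have le_bk : (b < (tag k).+1)%N by [].
pose b0 := Ordinal le_bk; have ib0 : inord b0 = b by apply: val_inj; rewrite /= inordK.
have ib (i : 'I_(tag k).+1) : (b == inord i) = (i == b0).
  by rewrite eq_sym -!val_eqE /= inordK // inord_lt.
rewrite (bigD1 b0) //= [RHS](bigD1 b0) //= [X in _ + X = _]big1 ?addr0 => [|i ne_i]; last first.
  by rewrite mxE mact_delta ib (negbTE ne_i) mulr0.
rewrite !mxE mact_delta !ib0 eqxx mulrC; congr (_ * _).
by apply: eq_bigr => i ne_i; rewrite !mxE ib (negbTE ne_i).
Qed.

Lemma mact_minor_out a b k : (tag k < b)%N -> mact (delta_mx a b) (minor k) = 0.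
Proof.
move=> lt_kb; apply: der_det (mact_derivation _) _ => i j; rewrite mxE mact_delta.
case: eqP => // eb; move: lt_kb; rewrite eb inordK ?inord_lt //.
by rewrite ltnNge -ltnS ltn_ord.
Qed.

Lemma mact_minor_in a b k : (a <= tag k)%N -> a != b -> mact (delta_mx a b) (minor k) = 0.
Proof.
move=> le_a ne_ab; have [le_b|/mact_minor_out//] := leqP b (tag k); rewrite mact_minor //.
have le_ak : (a < (tag k).+1)%N by [].
have le_bk : (b < (tag k).+1)%N by [].
have ia : inord (Ordinal le_ak) = a by apply: val_inj; rewrite /= inordK.
have ib : inord (Ordinal le_bk) = b by apply: val_inj; rewrite /= inordK.
apply: (@determinant_alternate _ _ _ (Ordinal le_ak) (Ordinal le_bk)) => [|c].
  by rewrite -val_eqE.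
by rewrite !mxE ia ib eqxx eq_sym (negbTE ne_ab).
Qed.

Lemma mact_minor_diag a k :
  mact (delta_mx a a) (minor k) = if (a <= tag k)%N then minor k else 0.
Proof.
case: leqP => [le_a|/mact_minor_out//]; rewrite mact_minor //; congr (\det _).
by apply/matrixP => i j; rewrite !mxE; case: eqP => [->|].
Qed.

Lemma hw_vec_nplus e : e \in nplus F n -> model_rep e hw_vec = 0.
Proof.
move/mem_nplus => e0; rewrite /= (der_prod (mact_derivation _)); apply: big1 => k _.
apply/eqP; rewrite mulf_eq0; apply/orP; right; apply/eqP; rewrite mact_matrix.
apply: big1 => a _; apply: big1 => b _.
have [le_ba|lt_ab] := leqP b a; first by rewrite e0 // scale0r.
have [le_bk|lt_kb] := leqP b (tag k); last by rewrite mact_minor_out // scaler0.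
by rewrite mact_minor_in ?scaler0 ?neq_ltn ?lt_ab // ltnW // (leq_trans lt_ab).
Qed.

Lemma block_sum (g : 'I_n -> F) : \sum_(k : block) g (tag k) = \sum_i (lam i)%:R * g i.
Proof.
rewrite -(@sig_big_dep _ _ _ _ (fun i => 'I_(lam i)) predT (fun _ => predT) (fun i _ => g i)) /=.
by apply: eq_bigr => i _; rewrite sumr_const card_ord mulr_natl.
Qed.

Lemma hw_vec_cartan h : h \in cartan F n -> model_rep h hw_vec = weight_of lam h *: hw_vec.
Proof.
move/mem_cartan => h0; rewrite /= (der_prod (mact_derivation _)).
rewrite /weight_of -(block_sum (fun i => fund_weight i h)) scaler_suml.
apply: eq_bigr => k _; rewrite [in RHS]/hw_vec [in RHS](bigD1 k) //= scalerAl mulrC; congr (_ * _).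
rewrite mact_matrix /fund_weight scaler_suml [RHS]big_mkcond.
apply: eq_bigr => a _; rewrite (bigD1 a) //= big1 ?addr0 => [|b ne]; last first.
  by rewrite h0 ?scale0r // eq_sym.
by rewrite mact_minor_diag; case: ifP; rewrite ?scaler0.
Qed.

(** A root vector kills [minor k] unless [rlo a <= tag k <= rhi a], and then its square does,
    because row [rcol a] no longer occurs after one application. There are as many such minors as
    the pairing of the weight with the root, and orders of nilpotency add up over a product. *)
Lemma froot_nilpotent (a : root) :
  iter (weight_root lam a).+1 (mact (delta_mx (rrow a) (rcol a))) hw_vec = 0.
Proof.
have derD := mact_derivation (delta_mx (rrow a) (rcol a)).
have -> : weight_root lam a = (\sum_(k : block) (rlo a <= tag k <= rhi a)%N)%N.
  rewrite weight_rootE.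
  rewrite -(@sig_big_dep _ _ _ _ (fun i => 'I_(lam i)) predT (fun _ => predT)
    (fun i _ => (rlo a <= i <= rhi a)%N : nat)) /=.
  by apply: eq_bigr => i _; rewrite sum_nat_const card_ord mulnC.
apply: (iter_der_prod derD) => k.
have [/andP[lo hi]|] := boolP (rlo a <= tag k <= rhi a)%N; last first.
  rewrite negb_and -!ltnNge => /orP[lt|lt] /=; first exact: mact_minor_out.
  by rewrite mact_minor_in // neq_ltn rcol_lt_row orbT.
rewrite /= mact_minor //; apply: (der_det derD) => i j; rewrite mxE mact_delta.
case: (rcol a =P inord i) => [_|/eqP/negbTE->] //.
by case: eqP => // e; have := rcol_lt_row a; rewrite e ltnn.
Qed.

End Model.

(** * Words in root vectors and their exponential generating function *)

Section Words.
Variable n : nat.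
Local Notation root := (posroot n).
Local Notation expo := {ffun root -> nat}.

(* The order matters: read from right to left, a word moves the index b to
   rrow a only after all the factors that could act on rrow a. *)
Definition root_seq : seq root := sort (fun a b => rlo a <= rlo b)%N (index_enum root).

Definition word_of (l : seq root) (s : expo) : seq root :=
  flatten [seq nseq (s a) a | a <- l].
Definition word := word_of root_seq.

Lemma root_seq_uniq : uniq root_seq.
Proof. by rewrite sort_uniq index_enum_uniq. Qed.

Lemma mem_root_seq a : a \in root_seq.
Proof. by rewrite mem_sort mem_index_enum. Qed.

Lemma root_seq_sorted : pairwise (fun a b => rlo a <= rlo b)%N root_seq.
Proof.
rewrite -sorted_pairwise; last by move=> a b c; apply: leq_trans.
by apply: sort_sorted => a b; apply: leq_total.
Qed.

Lemma perm_root_seq : perm_eq root_seq (index_enum root).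
Proof. exact/permEl/perm_sort. Qed.

Lemma prod_word (B : comNzRingType) (y : root -> B) s :
  \prod_(a <- word s) y a = \prod_a y a ^+ s a.
Proof.
rewrite big_flatten big_map -(perm_big _ perm_root_seq) /=.
by apply: eq_bigr => a _; rewrite big_nseq -Monoid.iteropE.
Qed.

End Words.

Section Theta.
Variables (F : numFieldType) (n : nat) (lam : 'I_n -> nat).
Local Notation root := (posroot n).
Local Notation expo := {ffun root -> nat}.
Local Notation block := (block lam).
Local Notation cell := (cell lam).
Local Notation model := {mpoly F[#|cell|]}.
Local Notation tpoly := {mpoly F[#|{: root}|]}.
Implicit Types (a : root) (s : expo) (l : seq root) (p q : model).

Definition tvar a : tpoly := pvar F a.

Definition mnm_of s : 'X_{1..#|{: root}|} := [multinom s (enum_val i) | i < #|{: root}|].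

(** The product of the matrix exponentials exp(t_a f_a) along [l]. If the column indices increase
    weakly, as in [root_seq], the product of any two of these matrix units in that order vanishes,
    which leaves the identity plus the linear terms. *)
Definition gmx l (i j : 'I_n.+1) : tpoly :=
  (i == j)%:R + \sum_(a <- l | (rrow a == i) && (rcol a == j)) tvar a.

Definition froot_act a : model -> model := mact (delta_mx (rrow a) (rcol a)).

(* Evaluating at the 0/1 matrix with ones in the cells (rr k c, c) extracts the
   coefficient of one basis vector from each minor. *)
Variable rr : block -> 'I_n.+1 -> 'I_n.+1.

(** For sorted [l]: the product of the exp(t_a f_a) is applied to a polynomial and the result is
    evaluated at [point], giving a polynomial in t. *)
Definition theta l : model -> tpoly :=
  mmap (@mpolyC _ F) (fun i => let t : cell := enum_val i in gmx l (rr t.2.1 t.2.2) t.1).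

Definition point : model -> F :=
  meval (fun i => let t : cell := enum_val i in (rr t.2.1 t.2.2 == t.1)%:R).

Lemma thetaC l c : theta l c%:MP = c%:MP. Proof. exact: mmapC. Qed.
Lemma thetaD l p q : theta l (p + q) = theta l p + theta l q. Proof. exact: mmapD. Qed.
Lemma thetaM l p q : theta l (p * q) = theta l p * theta l q. Proof. exact: rmorphM. Qed.
Lemma theta_var l (i : 'I_n.+1) k c : theta l (xvar F i k c) = gmx l (rr k c) i.
Proof. by rewrite /theta mmapX mmap1U enum_rankK. Qed.
Lemma theta0 l : theta l 0 = 0. Proof. exact: mmap0. Qed.

Lemma pointC c : point c%:MP = c. Proof. exact: mevalC. Qed.
Lemma pointD p q : point (p + q) = point p + point q. Proof. exact: mevalD. Qed.
Lemma pointM p q : point (p * q) = point p * point q. Proof. exact: rmorphM. Qed.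
Lemma pointZ c p : point (c *: p) = c * point p. Proof. exact: mevalZ. Qed.
Lemma point_var (i : 'I_n.+1) k c : point (xvar F i k c) = (rr k c == i)%:R.
Proof. by rewrite /point mevalXU enum_rankK. Qed.

Lemma theta_nil p : theta [::] p = (point p)%:MP.
Proof.
elim/pvar_ind: p => [c|[b [k c]]|p q IHp IHq|p q IHp IHq].
- by rewrite thetaC pointC.
- by rewrite -/(xvar F b k c) theta_var point_var /gmx big_nil addr0 mpolyC_nat.
- by rewrite thetaD pointD IHp IHq mpolyCD.
- by rewrite thetaM pointM IHp IHq mpolyCM.
Qed.

Lemma theta_rcons_mod l a p : exists q : tpoly, theta (rcons l a) p = theta l p + tvar a * q.
Proof.
elim/pvar_ind: p => [c|[b [k c]]|p q [p' IHp] [q' IHq]|p q [p' IHp] [q' IHq]].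
- by exists 0; rewrite !thetaC mulr0 addr0.
- rewrite -/(xvar F b k c) !theta_var /gmx -cats1 big_cat big_cons big_nil addrA /=.
  by case: ifP => _; [exists 1; rewrite addr0 mulr1 | exists 0; rewrite mulr0].
- by exists (p' + q'); rewrite !thetaD IHp IHq mulrDr addrACA.
exists (theta l p * q' + p' * theta l q + p' * tvar a * q').
by rewrite !thetaM IHp IHq; ring.
Qed.

(** The factor exp(t_a f_a) of the last root acts innermost, so differentiating in t_a inserts
    [f_a]. On variables this requires column [rrow a] of the matrix to be that of the identity: the
    roots of [l] have column indices at most [rcol a], hence below [rrow a]. *)
Lemma mderiv_theta l a p :
    uniq (rcons l a) -> pairwise (fun a b => rlo a <= rlo b)%N (rcons l a) ->
  mderiv (enum_rank a) (theta (rcons l a) p) = theta (rcons l a) (froot_act a p).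
Proof.
rewrite -cats1 cat_uniq pairwise_cat /= orbF andbT => /andP[Ul al].
rewrite allrel1r andbT => /andP[lo_l _].
elim/pvar_ind: p => [c|[b [k c]]|p q IHp IHq|p q IHp IHq].
- by rewrite thetaC mderivC /froot_act mactC theta0.
- rewrite -/(xvar F b k c) theta_var /froot_act mact_delta /gmx.
  rewrite mderivD [X in X + _](_ : _ = 0) ?add0r; last by rewrite -mpolyC_nat mderivC.
  rewrite linear_sum big_cat /= big1_seq ?add0r; last first.
    move=> d /andP[_ ld]; rewrite mderivXU (inj_eq enum_rank_inj).
    by case: eqP => // ad; rewrite ad ld in al.
  rewrite big_cons big_nil; case: (rcol a =P b) => [_|_]; last first.
    by rewrite andbF theta0.
  rewrite theta_var andbT /gmx big_cat /= big1_seq ?add0r; last first.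
    move=> d /andP[/andP[_ /eqP ed] ld].
    have := allP lo_l d ld; have := rcol_lt_row a; rewrite -ed !rcol_val; lia.
  rewrite big_cons big_nil [rcol a == _](_ : _ = false) ?andbF ?addr0; last first.
    by rewrite -val_eqE /= ltn_eqF // rcol_lt_row.
  by rewrite eq_sym; case: eqP => // _; rewrite mderivXU eqxx.
- by rewrite /froot_act mactD !thetaD mderivD IHp IHq.
by rewrite /froot_act mactM thetaD !thetaM mderivM IHp IHq.
Qed.

Lemma mcoeff_tvar_mul a (q : tpoly) (m : 'X_{1..#|{: root}|}) :
  m (enum_rank a) = 0%N -> (tvar a * q)@_m = 0.
Proof.
move=> m0; apply: memN_msupp_eq0; rewrite mulrC (perm_mem (msuppMX _ _)).
apply/negP => /mapP[m' _ def_m]; move: m0; rewrite def_m mnmDE mnm1E eqxx.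
by rewrite add1n.
Qed.

Definition fact_prod s : nat := (\prod_a (s a)`!)%N.

(** Taylor expansion at t = 0 with factorials cleared. The list is consumed from the right, and
    inside that the exponent of its last root: exponent 0 drops the variable by [theta_rcons_mod], a
    positive one is lowered by one derivative. *)
Lemma theta_coeff l s p :
    uniq l -> pairwise (fun a b => rlo a <= rlo b)%N l ->
    (forall a, s a != 0%N -> a \in l) ->
  (theta l p)@_(mnm_of s) * (fact_prod s)%:R = point (foldr froot_act p (word_of l s)).
Proof.
elim/last_ind: l s p => [|l a IHl] s p Ul pl sl.
  have s0 b : s b = 0%N by apply/eqP/negPn/negP => /sl.
  have -> : mnm_of s = 0%MM by apply/mnmP => i; rewrite mnmE mnm0E.
  have -> : fact_prod s = 1%N by apply: big1 => b _; rewrite s0.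
  by rewrite theta_nil mcoeffC eqxx !mulr1.
have [Ul' al] : uniq l /\ a \notin l by move: Ul; rewrite rcons_uniq => /andP[].
have pl' : pairwise (fun a b => rlo a <= rlo b)%N l.
  by move: pl; rewrite -cats1 pairwise_cat => /and3P[].
have [k] : exists k, s a = k by exists (s a).
elim: k s p sl => [|k IHk] s p sl sa.
  have [q ->] := theta_rcons_mod l a p.
  rewrite mcoeffD mcoeff_tvar_mul ?addr0; last by rewrite mnmE enum_rankK.
  rewrite IHl //; last first.
    move=> b sb; have := sl _ sb; rewrite mem_rcons inE => /predU1P[eb|//].
    by rewrite eb sa in sb.
  by rewrite /word_of map_rcons flatten_rcons sa cats0.
pose s' : expo := [ffun b => s b - (b == a)]%N.
have s'a : s' a = k by rewrite ffunE eqxx sa subn1.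
have sE : mnm_of s = (mnm_of s' + U_(enum_rank a))%MM.
  apply/mnmP => i; rewrite mnmDE !mnmE ffunE; case: (eqVneq (enum_rank a) i) => [<-|ne].
    by rewrite enum_rankK eqxx sa subn1 addn1.
  rewrite (_ : _ == a = false) ?subn0 ?addn0 //; apply: contraNF ne => /eqP <-.
  by rewrite enum_valK.
have wl (b : root) : b \in l -> s' b = s b.
  by move=> lb; rewrite ffunE (_ : b == a = false) ?subn0 //; apply: contraNF al => /eqP <-.
have -> : foldr froot_act p (word_of (rcons l a) s) =
    foldr froot_act (froot_act a p) (word_of (rcons l a) s').
  rewrite /word_of !map_rcons !flatten_rcons s'a sa !foldr_cat.
  have -> : [seq nseq (s b) b | b <- l] = [seq nseq (s' b) b | b <- l].
    by apply/eq_in_map => b lb; rewrite wl.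
  by congr foldr; elim: (k) => //= j ->.
rewrite -IHk //; last first.
  by move=> b; rewrite ffunE => ne0; apply: sl; apply: contraNneq ne0 => ->.
rewrite -mderiv_theta // mcoeff_deriv -sE mnmE enum_rankK s'a.
rewrite mulrnAl -mulrnAr -mulrnA mulnC; congr (_ * _%:R).
rewrite /fact_prod (bigD1 a) //= [in RHS](bigD1 a) //= s'a sa factS mulnA; congr (_ * _)%N.
by apply: eq_bigr => b /negbTE ne; rewrite ffunE ne subn0.
Qed.

Definition theta_full := theta (@root_seq n).

Lemma theta_fullE s p :
  (theta_full p)@_(mnm_of s) * (fact_prod s)%:R = point (foldr froot_act p (word s)).
Proof.
apply: theta_coeff (root_seq_uniq n) (root_seq_sorted n) _ => a _; exact: mem_root_seq.
Qed.

End Theta.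

(** * Leading monomials of minors *)

Section MinWeight.
Variables (F : numFieldType) (n : nat).
Local Notation root := (posroot n).
Local Notation expo := {ffun root -> nat}.
Local Notation tpoly := {mpoly F[#|{: root}|]}.
Implicit Types (a : root) (s t : expo) (p q : tpoly).

Definition mnm_wgt (m : 'X_{1..#|{: root}|}) := wgt [ffun a : root => m (enum_rank a)].

Lemma mnm_wgtD m1 m2 : mnm_wgt (m1 + m2)%MM = (mnm_wgt m1 + mnm_wgt m2)%N.
Proof.
rewrite /mnm_wgt /wgt -big_split; apply: eq_bigr => a _.
by rewrite !ffunE mnmDE mulnDl.
Qed.

Lemma mnm_wgt_of s : mnm_wgt (mnm_of s) = wgt s.
Proof. by congr wgt; apply/ffunP => a; rewrite ffunE mnmE enum_rankK. Qed.

Lemma mnm_ofK s : [ffun a => mnm_of s (enum_rank a)] = s.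
Proof. by apply/ffunP => a; rewrite ffunE mnmE enum_rankK. Qed.

Definition minw (k : nat) p := forall m, m \in msupp p -> (k <= mnm_wgt m)%N.

Lemma minw_le k l p : (k <= l)%N -> minw l p -> minw k p.
Proof. by move=> kl lp m /lp; apply: leq_trans. Qed.

Lemma minw0 k : minw k 0.
Proof. by move=> m; rewrite msupp0. Qed.

Lemma minwC c : minw 0 c%:MP. Proof. by []. Qed.

Lemma minwD k p q : minw k p -> minw k q -> minw k (p + q).
Proof.
by move=> kp kq m /msuppD_le; rewrite mem_cat => /orP[/kp|/kq].
Qed.

Lemma minw_sum k (I : Type) (r : seq I) (P : pred I) (E : I -> tpoly) :
  (forall i, P i -> minw k (E i)) -> minw k (\sum_(i <- r | P i) E i).
Proof.
by move=> kE; apply: (big_ind (minw k)) => //; [apply: minw0 | apply: minwD].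
Qed.

Lemma minwM k l p q : minw k p -> minw l q -> minw (k + l) (p * q).
Proof.
move=> kp lq m /msuppM_le /allpairsP[[m1 m2] /= [/kp k1 /lq k2 ->]].
by rewrite mnm_wgtD leq_add.
Qed.

Lemma minw_prod (I : finType) (k : I -> nat) (E : I -> tpoly) :
  (forall i, minw (k i) (E i)) -> minw (\sum_i k i) (\prod_i E i).
Proof.
by move=> kE; apply: (big_ind2 minw) => // a p b q; apply: minwM.
Qed.

Lemma minwX m : minw (mnm_wgt m) 'X_[m].
Proof. by move=> m'; rewrite msuppX inE => /eqP->. Qed.

Definition lead p s := exists2 q, p = 'X_[mnm_of s] + q & minw (wgt s).+1 q.

Lemma leadM p q s t : lead p s -> lead q t -> lead (p * q) [ffun a => s a + t a]%N.
Proof.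
move=> [p' -> wp] [q' -> wq].
have wst : wgt [ffun a => s a + t a]%N = (wgt s + wgt t)%N.
  by rewrite /wgt -big_split; apply: eq_bigr => a _; rewrite ffunE mulnDl.
rewrite /lead; have -> : mnm_of [ffun a => s a + t a]%N = (mnm_of s + mnm_of t)%MM.
  by apply/mnmP => i; rewrite mnmDE !mnmE ffunE.
exists ('X_[mnm_of s] * q' + p' * ('X_[mnm_of t] + q')).
  by rewrite mpolyXD mulrDl mulrDr !addrA.
have ws := @minwX (mnm_of s); have wt := @minwX (mnm_of t).
rewrite !mnm_wgt_of in ws wt; rewrite wst.
apply: minwD; first by rewrite -addnS; apply: minwM.
rewrite -addSn; apply: minwM => //; apply: minwD => //.
by apply: minw_le wq.
Qed.

Lemma lead1 : lead 1 [ffun=> 0%N].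
Proof.
exists 0; last exact: minw0; rewrite addr0 (_ : mnm_of _ = 0%MM) ?mpolyX0 //.
by apply/mnmP => i; rewrite mnmE ffunE mnm0E.
Qed.

Lemma lead_prod (I : finType) (E : I -> tpoly) (s : I -> expo) :
  (forall i, lead (E i) (s i)) -> lead (\prod_i E i) [ffun a => \sum_i s i a]%N.
Proof.
move=> Es; pose add (u v : expo) : expo := [ffun a => u a + v a]%N.
have -> : [ffun a => \sum_i s i a]%N = \big[add/[ffun=> 0%N]]_i s i.
  apply/ffunP => a; rewrite ffunE.
  by apply: (big_ind2 (fun k (u : expo) => k = u a)) => [|k u l v -> ->|//]; rewrite ffunE.
by apply: (big_ind2 lead) => // [|p u q v]; [apply: lead1 | apply: leadM].
Qed.

Lemma lead_coeff p s : lead p s -> p@_(mnm_of s) = 1.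
Proof.
move=> [q -> wq]; rewrite mcoeffD mcoeffX eqxx memN_msupp_eq0 ?addr0 //.
by apply/negP => /wq; rewrite mnm_wgt_of ltnn.
Qed.

Lemma lead_coeff0 p s t : lead p s -> (wgt t <= wgt s)%N -> t != s -> p@_(mnm_of t) = 0.
Proof.
move=> [q -> wq] le_ts ne_ts; rewrite mcoeffD mcoeffX memN_msupp_eq0 ?addr0; last first.
  by apply/negP => /wq; rewrite mnm_wgt_of ltnNge le_ts.
case: eqP => // /(congr1 (fun m : 'X_{1..#|{: root}|} => [ffun a : root => m (enum_rank a)])).
by rewrite !mnm_ofK => st; rewrite st eqxx in ne_ts.
Qed.

End MinWeight.

Section Antichain.
Import fingroup.fingroup perm.
Variables (F : numFieldType) (n : nat).
Local Notation root := (posroot n).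
Local Notation G := (gmx F (root_seq n)).

Lemma gmx_diag i : G i i = 1.
Proof.
rewrite /gmx eqxx big1 ?addr0 // => a /andP[/eqP ri /eqP ci].
by have := rcol_lt_row a; rewrite ri ci ltnn.
Qed.

Lemma gmx_up (i j : 'I_n.+1) : (i < j)%N -> G i j = 0.
Proof.
move=> lt_ij; rewrite /gmx (_ : i == j = false) ?add0r; last by rewrite -val_eqE /= ltn_eqF.
rewrite big1 // => a /andP[/eqP ri /eqP ci].
by have := rcol_lt_row a; rewrite ri ci ltnNge ltnW.
Qed.

Lemma gmx_root (a : root) : G (rrow a) (rcol a) = tvar F a.
Proof.
rewrite /gmx [rrow a == rcol a](_ : _ = false) ?add0r; last first.
  by rewrite -val_eqE gtn_eqF // rcol_lt_row.
rewrite (perm_big _ (perm_root_seq n)) (bigD1 a) ?eqxx //= big1 ?addr0 //.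
by move=> b /andP[/andP[/eqP r /eqP c]] /eqP[]; apply: rrow_inj.
Qed.

(** Below the diagonal the entry is the variable of the root [(j, i - 1)], whose weight is
    [j.+1 * i]; above it the entry is zero and every bound holds. *)
Lemma minw_gmx (i j : 'I_n.+1) : minw (if i == j then 0%N else j.+1 * i)%N (G i j).
Proof.
case: eqVneq => [->|ne_ij]; first by rewrite gmx_diag -mpolyC1; apply: minwC.
have [lt_ij|le_ji] := ltnP i j; first by rewrite gmx_up //; apply: minw0.
have lt_ji : (j < i)%N by rewrite ltn_neqAle eq_sym ne_ij.
have [a [-> ->]] := root_of_pos lt_ji; rewrite gmx_root.
move=> m; rewrite msuppX inE => /eqP->.
rewrite /mnm_wgt /wgt (bigD1 a) //= ffunE mnm1E eqxx mul1n.
exact: leq_addr.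
Qed.

Variables (i : 'I_n) (A : {set root}).
Hypothesis A_anti : antichain A.
Hypothesis A_rect : forall a, a \in A -> in_rect i a.

(** Chosen so that in the resulting minor the identity permutation contributes exactly the product
    of the variables of [A]. *)
Definition row_pick (c : 'I_n.+1) : 'I_n.+1 :=
  if [pick a in A | rcol a == c] is Some a then rrow a else c.

Lemma anti_eq a b : a \in A -> b \in A -> rcol a = rcol b -> a = b.
Proof.
move=> Aa Ab /(congr1 val) /= e_lo.
have [le|lt] := leqP (rhi a) (rhi b); first by apply: A_anti => //; rewrite /rle e_lo leqnn.
by apply/esym; apply: A_anti => //; rewrite /rle e_lo leqnn ltnW.
Qed.

Lemma anti_lt a b : a \in A -> b \in A -> (rcol a < rcol b)%N -> (rrow b < rrow a)%N.
Proof.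
move=> Aa Ab lt_ab; rewrite ltnNge; apply/negP => le_ab.
have eab : a = b by apply: A_anti => //; rewrite /rle (ltnW lt_ab).
by rewrite eab ltnn in lt_ab.
Qed.

Lemma row_pickP c : (exists2 a, a \in A & c = rcol a /\ row_pick c = rrow a) \/
  ((forall a, a \in A -> rcol a != c) /\ row_pick c = c).
Proof.
rewrite /row_pick; case: pickP => [a /andP[Aa /eqP <-]|nop]; [left; by exists a|right].
by split=> // a Aa; have := nop a; rewrite Aa /= => ->.
Qed.

Lemma big_antichain (R : Type) (idx : R) (op : Monoid.com_law idx) (f : root -> R) :
  \big[op/idx]_(a in A) f a =
  \big[op/idx]_(c < i.+1) (if [pick a in A | rcol a == inord c] is Some a then f a else idx).
Proof.
have lt_i (c : 'I_i.+1) : (c < n.+1)%N by rewrite (leq_trans (ltn_ord c)) // ltnS ltnW.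
rewrite (partition_big (fun a => inord (rlo a) : 'I_i.+1) predT) //=.
apply: eq_bigr => c _; case: pickP => [a /andP[Aa /eqP ra]|nop].
  have vra : rlo a = c :> nat by have /(congr1 val) := ra; rewrite /= inordK.
  rewrite (bigD1 a) ?Aa /=; last by apply/eqP/val_inj; rewrite /= inordK vra.
  rewrite big1 ?Monoid.mulm1 // => b /andP[/andP[Ab /eqP rb]] /eqP[].
  apply: anti_eq => //; rewrite ra; apply: val_inj; rewrite /= inordK // -rb inordK //.
  by have /andP[] := A_rect Ab; rewrite ltnS.
rewrite big1 // => a /andP[Aa /eqP ra]; have := nop a; rewrite Aa /= -val_eqE /= inordK //.
by rewrite -ra inordK ?eqxx //; have /andP[] := A_rect Aa; rewrite ltnS.
Qed.

(* Dual potentials certifying that the identity is the unique cheapest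
   permutation; weights are doubled to leave room for strict inequalities
   between consecutive values of rrow on A. *)
Definition slope (j : nat) : nat :=
  (2 * n.+1 - \max_(a in A | rcol a <= j) (2 * n.+1 - (2 * rrow a).-1))%N.
Definition potential (b : nat) : nat := (\sum_(0 <= j < b) slope j)%N.

(** [slope j] is the minimum of [2 * n.+1] and of the numbers [2 * rrow a - 1] over the roots of [A]
    with [rcol a <= j], written through the maximum of the complements. *)
Lemma slope_le a j : a \in A -> (rcol a <= j)%N -> (slope j <= (2 * rrow a).-1)%N.
Proof.
move=> Aa le_aj; rewrite /slope.
have := @leq_bigmax_cond _ (fun a => (a \in A) && (rcol a <= j)%N)
  (fun a => 2 * n.+1 - (2 * rrow a).-1)%N a.
rewrite Aa le_aj => /(_ isT).
have := ltn_ord (rrow a); move: (nat_of_ord (rrow a)) (\max_(_ | _) _)%N; clear; lia.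
Qed.

(** Along an antichain the rows strictly decrease as the columns increase, so doubled rows differ by
    at least 2 and the slope stays above [2 * rrow a] until column [rcol a] is reached. *)
Lemma slope_ge a j : a \in A -> (j < rcol a)%N -> ((2 * rrow a).+1 <= slope j)%N.
Proof.
move=> Aa lt_ja; rewrite /slope.
suff : (\max_(b in A | rcol b <= j) (2 * n.+1 - (2 * rrow b).-1) <= 2 * n.+1 - (2 * rrow a).+1)%N.
  have := ltn_ord (rrow a); move: (nat_of_ord (rrow a)) (\max_(_ | _) _)%N; clear; lia.
apply/bigmax_leqP => b /andP[Ab le_bj].
have := anti_lt Ab Aa (leq_ltn_trans le_bj lt_ja).
have := ltn_ord (rrow a); have := ltn_ord (rrow b).
move: (nat_of_ord (rrow a)) (nat_of_ord (rrow b)); clear; lia.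
Qed.

Lemma slope_gt0 j : (0 < slope j)%N.
Proof.
rewrite /slope.
suff : (\max_(b in A | rcol b <= j) (2 * n.+1 - (2 * rrow b).-1) <= (2 * n.+1).-1)%N.
  by move: (\max_(_ | _) _)%N; clear; lia.
apply/bigmax_leqP => b _; have := rrow_val b; move: (nat_of_ord (rrow b)); clear; lia.
Qed.

Lemma potential_cat b c : (b <= c)%N ->
  potential c = (potential b + \sum_(b <= j < c) slope j)%N.
Proof. by move=> le_bc; rewrite /potential (big_cat_nat (leq0n b) le_bc). Qed.

Definition cost (b c : 'I_n.+1) : nat :=
  if row_pick c == b then 0%N else (b.+1 * row_pick c)%N.

(** In a column [c = rcol a] the number [2 * rrow a] lies strictly between the slopes before and
    after [c], so leaving the diagonal in either direction costs more than the potential returns.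
    The last hypothesis leaves out the entries that are zero. *)
Lemma cost_potential (b c : 'I_n.+1) :
    (b <= i)%N -> (c <= i)%N -> (b <= row_pick c)%N ->
  (2 * cost c c + potential b + (b != c) <= 2 * cost b c + potential c)%N.
Proof.
move=> le_bi le_ci le_bp; case: (eqVneq b c) => [->|ne_bc]; first by rewrite addn0.
case: (row_pickP c) => [[a Aa [ca pa]]|[noA pc]]; rewrite /cost; last first.
  rewrite pc eqxx; have lt_bc : (b < c)%N by rewrite ltn_neqAle ne_bc; move: le_bp; rewrite pc.
  rewrite (potential_cat (ltnW lt_bc)) muln0 add0n big_ltn //.
  by have := slope_gt0 b; clear; lia.
have lt_ir : (i < rrow a)%N by have /andP[_] := A_rect Aa; rewrite rrow_val ltnS.
rewrite pa !ifN; last 2 first.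
- by rewrite -val_eqE /= gtn_eqF // (leq_ltn_trans le_bi).
- by rewrite -val_eqE /= gtn_eqF // (leq_ltn_trans le_ci).
have [lt_bc|le_cb] := ltnP b c.
  rewrite (potential_cat (ltnW lt_bc)).
  have : ((c - b) * (2 * rrow a).+1 <= \sum_(b <= j < c) slope j)%N.
    rewrite -sum_nat_const_nat big_nat_cond [leqRHS]big_nat_cond; apply: leq_sum => j.
    by rewrite andbT => /andP[_ jc]; apply: slope_ge Aa _; rewrite -ca.
  move: (\sum_(b <= j < c) slope j)%N (potential b) => S P; rewrite addn1.
  move: lt_bc; rewrite !mulSn; move: (nat_of_ord b) (nat_of_ord c) (nat_of_ord (rrow a)).
  clear; nia.
have lt_cb : (c < b)%N by rewrite ltn_neqAle eq_sym ne_bc.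
rewrite (potential_cat le_cb).
have : (\sum_(c <= j < b) slope j <= (b - c) * (2 * rrow a).-1)%N.
  rewrite -sum_nat_const_nat big_nat_cond [leqRHS]big_nat_cond; apply: leq_sum => j.
  by rewrite andbT => /andP[cj _]; apply: slope_le Aa _; rewrite -ca.
move: (\sum_(c <= j < b) slope j)%N (potential c) => S P; rewrite addn1.
have : (0 < rrow a)%N by rewrite rrow_val.
move: lt_cb; rewrite !mulSn; move: (nat_of_ord b) (nat_of_ord c) (nat_of_ord (rrow a)).
clear => x y z; case: z => // z lt_yx _; rewrite (_ : (2 * z.+1).-1 = (2 * z).+1)%N; last by lia.
nia.
Qed.

Definition expo_set : {ffun root -> nat} := [ffun a => (a \in A) : nat].

Lemma wgt_expo_set : wgt expo_set = (\sum_(c < i.+1) cost (inord c) (inord c))%N.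
Proof.
rewrite /wgt (_ : (\sum_a _)%N = \sum_(a in A) ((rlo a).+1 * (rhi a).+1))%N; last first.
  by rewrite [RHS]big_mkcond; apply: eq_bigr => a _; rewrite ffunE; case: ifP => _; rewrite ?mul1n ?mul0n.
rewrite big_antichain; apply: eq_bigr => c _; rewrite /cost /row_pick.
case: pickP => [a /andP[Aa /eqP <-]|_]; last by rewrite eqxx.
by rewrite ifN // -val_eqE gtn_eqF // rcol_lt_row.
Qed.

(** A permutation other than the identity either meets a zero entry above the diagonal, or
    [cost_potential] can be summed along it: the potentials cancel and at least one moved index
    makes the inequality strict. *)
Lemma lead_minor :
  lead (\det (\matrix_(b < i.+1, c < i.+1) G (row_pick (inord c)) (inord b))) expo_set.
Proof.
have lt_i (c : 'I_i.+1) : (c < n.+1)%N by rewrite (leq_trans (ltn_ord c)) // ltnS ltnW.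
rewrite /determinant (bigD1 (1%g : 'S_i.+1)) //= odd_perm1 expr0 mul1r.
eexists; first congr (_ + _).
  rewrite (eq_bigr (fun c : 'I_i.+1 =>
    if [pick a in A | rcol a == inord c] is Some a then tvar F a else 1)).
    rewrite -big_antichain.
    rewrite (eq_bigr (fun a : root => 'X_[U_(enum_rank a)])) // mprodXE; congr 'X_[_].
    apply/mnmP => j; rewrite mnm_sumE mnmE ffunE big_mkcond (bigD1 (enum_val j)) //=.
    rewrite big1 ?addn0 => [|a ne]; first by rewrite mnm1E enum_valK eqxx; case: ifP.
    case: ifP => // _; rewrite mnm1E; case: eqP => // e.
    by case/eqP: ne; rewrite -e enum_rankK.
  move=> c _; rewrite mxE perm1 /row_pick.
  by case: pickP => [a /andP[_ /eqP <-]|_]; rewrite ?gmx_root ?gmx_diag.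
apply: minw_sum => s ne_s.
rewrite -[(wgt _).+1]add0n; apply: minwM.
  rewrite (_ : (-1) ^+ s = ((-1) ^+ s)%:MP); first exact: minwC.
  by rewrite rmorphXn /= mpolyCN mpolyC1.
have [/existsP[b lt_b]|/existsPn le_b] :=
    boolP [exists b : 'I_i.+1, (row_pick (inord (s b)) < (inord b : 'I_n.+1))%N].
  by rewrite (bigD1 b) //= mxE gmx_up // mul0r; apply: minw0.
apply: (@minw_le _ _ _ (\sum_(b < i.+1) cost (inord b) (inord (s b)))); last first.
  by apply: minw_prod => b; rewrite mxE /cost; apply: minw_gmx.
have inord_i (c : 'I_i.+1) : (inord c : 'I_n.+1) = c :> nat by rewrite inordK.
have ne_inord (b c : 'I_i.+1) : ((inord b : 'I_n.+1) != inord c) = (b != c).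
  congr (~~ _); apply/eqP/eqP => [e|-> //]; apply: val_inj.
  by rewrite -[LHS]inord_i e inord_i.
have H (b : 'I_i.+1) : (2 * cost (inord (s b)) (inord (s b)) + potential b + (b != s b)
    <= 2 * cost (inord b) (inord (s b)) + potential (s b))%N.
  have := @cost_potential (inord b) (inord (s b)); rewrite ne_inord 2!inord_i.
  apply; [by rewrite -ltnS ltn_ord | by rewrite -ltnS ltn_ord |].
  by have := le_b b; rewrite -leqNgt inord_i; apply.
have : (\sum_(b < i.+1) (2 * cost (inord (s b)) (inord (s b)) + potential b + (b != s b))
    <= \sum_(b < i.+1) (2 * cost (inord b) (inord (s b)) + potential (s b)))%N.
  by apply: leq_sum => b _.
rewrite !big_split /= !big1_eq !addn0.
have reidx (f : 'I_i.+1 -> nat) : (\sum_b f (s b) = \sum_b f b)%N.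
  by rewrite [RHS](reindex_inj (@perm_inj _ s)).
rewrite (reidx (fun c => cost (inord c) (inord c))) (reidx potential).
rewrite wgt_expo_set.
have : (0 < \sum_(b < i.+1) (b != s b))%N.
  rewrite lt0n sum_nat_eq0; apply: contra ne_s => /forall_inP s1.
  by apply/eqP/permP => b; rewrite perm1; have := s1 b isT; rewrite eqb0 negbK => /eqP.
move: (\sum_(b < i.+1) cost (inord b) (inord (s b)))%N.
move: (\sum_(b < i.+1) cost (inord b) (inord b))%N (\sum_(b < i.+1) potential b)%N.
move: (\sum_(b < i.+1) (b != s b))%N; clear; lia.
Qed.

End Antichain.

(** * Linear independence in the model *)

Section Independence.
Variables (F : numFieldType) (n : nat) (lam : 'I_n -> nat).
Local Notation root := (posroot n).
Local Notation expo := {ffun root -> nat}.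
Local Notation block := (block lam).

Lemma theta_minor (rr : block -> 'I_n.+1 -> 'I_n.+1) k :
  theta_full rr (minor F k) = \det (\matrix_(b < (tag k).+1, c < (tag k).+1)
    gmx F (root_seq n) (rr k (inord c)) (inord b)).
Proof.
rewrite /minor /theta_full /theta -det_map_mx; congr (\det _).
by apply/matrixP => b c; rewrite !mxE; apply: theta_var.
Qed.

Lemma hw_vec_lead (A : block -> {set root}) :
    (forall k, antichain (A k) /\ forall a, a \in A k -> in_rect (tag k) a) ->
  lead (theta_full (fun k => row_pick (A k)) (hw_vec F lam))
       [ffun a => \sum_k (a \in A k)]%N.
Proof.
move=> AP; rewrite /theta_full /theta /hw_vec rmorph_prod /=.
rewrite (_ : [ffun a => _] = [ffun a => \sum_k expo_set (A k) a]%N); last first.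
  by apply/ffunP => a; rewrite !ffunE; apply: eq_bigr => k _; rewrite ffunE.
apply: lead_prod => k; have [anti rect] := AP k.
have := theta_minor (fun k => row_pick (A k)) k; rewrite /theta_full /theta => ->.
exact: lead_minor.
Qed.

Lemma polytope_lead s : polytope lam s ->
  exists rr : block -> 'I_n.+1 -> 'I_n.+1, lead (theta_full rr (hw_vec F lam)) s.
Proof.
move=> /polytope_decomp[A [AP As]].
pose B (k : block) := A (tag k) (tagged k).
have BP (k : block) : antichain (B k) /\ forall a, a \in B k -> in_rect (tag k) a.
  exact: AP (ltn_ord (tagged k)).
exists (fun k => row_pick (B k)).
rewrite (_ : s = [ffun a => \sum_k (a \in B k)]%N); first exact: hw_vec_lead.
apply/ffunP => a; rewrite ffunE As.
rewrite (@sig_big_dep _ _ _ _ (fun i => 'I_(lam i)) predT (fun _ => predT)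
  (fun i j => (a \in A i j) : nat)) /=.
by apply: eq_bigr => -[i j] _.
Qed.

(** The case of the zero exponent: some evaluation has constant coefficient 1. *)
Lemma hw_vec_neq0 : hw_vec F lam != 0.
Proof.
have P0 : polytope lam [ffun=> 0%N].
  by apply/polytopeP => a A _ _; rewrite big1 // => b _; rewrite ffunE.
have [rr /lead_coeff] := polytope_lead P0.
apply: contra_eq_neq => ->.
by rewrite /theta_full theta0 mcoeff0 eq_sym oner_neq0.
Qed.

Lemma point_sum (rr : block -> 'I_n.+1 -> 'I_n.+1) (J : eqType) (L : seq J)
    (d : J -> F) (E : J -> _) :
  point rr (\sum_(s <- L) d s *: E s) = \sum_(s <- L) d s * point rr (E s).
Proof.
elim: L => [|s L IHL]; rewrite ?big_nil ?big_cons; first by rewrite -mpolyC0 pointC.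
by rewrite pointD pointZ IHL.
Qed.

(** Triangularity: let [s1] have the largest weight among the exponents with nonzero coefficient. At
    the evaluation point attached to [s1], the other exponents of the relation contribute 0, while
    [s1] contributes [d s1] times a product of factorials. *)
Lemma model_independent (L : seq expo) (d : expo -> F) :
    uniq L -> (forall s, s \in L -> polytope lam s) ->
    \sum_(s <- L) d s *: foldr (@froot_act F n lam) (hw_vec F lam) (word s) = 0 ->
  forall s, s \in L -> d s = 0.
Proof.
move=> UL PL sum0; have [//|/allPn[s0 L0 d0]] := boolP (all (fun s => d s == 0) L).
  by move=> /allP all0 s /all0 /eqP.
pose Q := [pred j : 'I_(size L) | d (nth s0 L j) != 0].
have lt_j0 : (index s0 L < size L)%N by rewrite index_mem.
have Q0 : Q (Ordinal lt_j0) by rewrite /= nth_index.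
case: (@arg_maxnP _ (Ordinal lt_j0) Q (fun j => wgt (nth s0 L j)) Q0) => j /= dj max_j.
set s1 := nth s0 L j in dj max_j; have L1 : s1 \in L by apply: mem_nth.
have [rr ld] := polytope_lead (PL _ L1).
have /(congr1 (point rr)) := sum0; rewrite -[X in _ = point _ X]mpolyC0 pointC point_sum.
rewrite (bigD1_seq s1) //= -theta_fullE lead_coeff // mul1r big1_seq => [|s /andP[ne Ls]].
  move/eqP; rewrite addr0 mulf_eq0 (negbTE dj) pnatr_eq0 /fact_prod.
  by rewrite eqn0Ngt prodn_gt0 // => a; apply: fact_gt0.
have [->|ds] := eqVneq (d s) 0; first by rewrite mul0r.
rewrite -theta_fullE (lead_coeff0 ld) ?mul0r ?mulr0 //.
have lt_s : (index s L < size L)%N by rewrite index_mem.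
by have := max_j (Ordinal lt_s); rewrite /= nth_index //; apply.
Qed.

End Independence.

(** * The contravariant Hermitian form on the model *)

Section FischerForm.
Variables (C : numClosedFieldType) (N : nat).
Local Notation P := {mpoly C[N]}.
Implicit Types (p q r : P).

Definition mnm_fact (m : 'X_{1..N}) : nat := (\prod_i (m i)`!)%N.

(** Monomials are orthogonal with square norm [m!], the normalisation that makes multiplication by a
    variable adjoint to differentiation. The form is conjugate-linear in [q]. *)
Definition fform p q : C := \sum_(m <- msupp p) p@_m * (q@_m)^* * (mnm_fact m)%:R.

Lemma fformE k p q : (msize p <= k)%N ->
  fform p q = \sum_(m : 'X_{1..N < k}) p@_m * (q@_m)^* * (mnm_fact m)%:R.
Proof.
move=> le_pk; rewrite /fform (big_mksub 'X_{1..N < k}) ?msupp_uniq //=.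
  by rewrite big_rmcond //= => i /memN_msupp_eq0 ->; rewrite !mul0r.
by move=> m /msize_mdeg_lt /leq_trans; apply.
Qed.

Lemma fformC p q : fform p q = (fform q p)^*.
Proof.
rewrite (fformE _ (leq_maxl (msize p) (msize q))) (fformE _ (leq_maxr (msize p) (msize q))).
rewrite rmorph_sum; apply: eq_bigr => m _ /=.
by rewrite !rmorphM /= conjCK rmorph_nat [p@_m * _]mulrC.
Qed.

Lemma fformDr p q r : fform p (q + r) = fform p q + fform p r.
Proof.
rewrite /fform -big_split; apply: eq_bigr => m _ /=.
by rewrite mcoeffD rmorphD /= mulrDr mulrDl.
Qed.

Lemma fformZr c p q : fform p (c *: q) = c^* * fform p q.
Proof.
rewrite /fform mulr_sumr; apply: eq_bigr => m _ /=.
by rewrite mcoeffZ rmorphM /= -!mulrA mulrCA.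
Qed.

Lemma fform0r p : fform p 0 = 0.
Proof. by rewrite /fform big1 // => m _; rewrite mcoeff0 rmorph0 mulr0 mul0r. Qed.

Lemma fformDl p q r : fform (p + q) r = fform p r + fform q r.
Proof. by rewrite fformC fformDr rmorphD /= -!fformC. Qed.

Lemma fformZl c p q : fform (c *: p) q = c * fform p q.
Proof. by rewrite fformC fformZr rmorphM /= conjCK -fformC. Qed.

Lemma fform0l q : fform 0 q = 0.
Proof. by rewrite fformC fform0r rmorph0. Qed.

Lemma fform_eq0 p : fform p p = 0 -> p = 0.
Proof.
have ge0 m : 0 <= p@_m * (p@_m)^* * (mnm_fact m)%:R.
  by rewrite mulr_ge0 ?mul_conjC_ge0 ?ler0n.
move/eqP; rewrite /fform psumr_eq0 => [/allP all0|m _]; last exact: ge0.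
apply/mpolyP => m; rewrite mcoeff0; apply/eqP; apply: contraT => pm.
have := all0 m; rewrite mcoeff_msupp pm => /(_ isT) /=.
rewrite !mulf_eq0 conjC_eq0 (negbTE pm) /= pnatr_eq0 /mnm_fact.
by rewrite eqn0Ngt prodn_gt0 // => i; apply: fact_gt0.
Qed.

Lemma fformX m q : fform 'X_[m] q = (q@_m)^* * (mnm_fact m)%:R.
Proof. by rewrite /fform msuppX big_seq1 mcoeffX eqxx mul1r. Qed.

Lemma fform_mulX i p q : fform ('X_i * p) q = fform p (mderiv i q).
Proof.
elim/mpolyind: p => [|c m p _ _ IHp]; first by rewrite mulr0 !fform0l.
rewrite mulrDr !fformDl IHp -scalerAr !fformZl; congr (_ * _ + _).
rewrite -mpolyXD !fformX mcoeff_deriv addmC rmorphMn /= mulrnAl -mulrnAr -mulrnA.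
congr (_ * _%:R); rewrite /mnm_fact (bigD1 i) //= [in RHS](bigD1 i) //=.
rewrite mnmDE mnm1E eqxx addn1 factS [RHS]mulnC mulnA.
congr (_ * _)%N; apply: eq_bigr => j /negbTE ne.
by rewrite mnmDE mnm1E eq_sym ne addn0.
Qed.

Lemma fform_mulXr i p q : fform p ('X_i * q) = fform (mderiv i p) q.
Proof. by rewrite fformC fform_mulX -fformC. Qed.

Lemma fform_suml (I : Type) (r : seq I) (E : I -> P) q :
  fform (\sum_(i <- r) E i) q = \sum_(i <- r) fform (E i) q.
Proof. by elim: r => [|i r IHr]; rewrite ?big_nil ?fform0l // !big_cons fformDl IHr. Qed.

Lemma fform_sumr (I : Type) (r : seq I) (E : I -> P) p :
  fform p (\sum_(i <- r) E i) = \sum_(i <- r) fform p (E i).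
Proof. by elim: r => [|i r IHr]; rewrite ?big_nil ?fform0r // !big_cons fformDr IHr. Qed.

End FischerForm.

Section Contravariant.
Variables (C : numClosedFieldType) (n : nat) (lam : 'I_n -> nat).
Local Notation M := 'M[C]_n.+1.
Local Notation cell := (cell lam).
Local Notation model := {mpoly C[#|cell|]}.
Implicit Types (p q : model) (X : M).

Definition adj_mx X : M := \matrix_(i, j) (X j i)^*.

(** A matrix unit acts by a sum of operators x_a d/dx_b, whose adjoints are x_b d/dx_a; hence the
    conjugate transpose. *)
Lemma fform_mact X p q : fform (mact X p) q = fform p (mact (adj_mx X) q).
Proof.
pose d (a : 'I_n.+1) (s : block lam * 'I_n.+1) r : model := mderiv (enum_rank ((a, s) : cell)) r.
pose H a b s := X a b * fform (d b s p) (d a s q).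
transitivity (\sum_b \sum_s \sum_a H a b s).
  rewrite pair_bigA /mact /pder fform_suml; apply: eq_bigr => -[b s] _ /=.
  rewrite mulr_suml fform_suml; apply: eq_bigr => a _.
  by rewrite -scalerAl fformZl /xvar /pvar -surjective_pairing fform_mulX.
transitivity (\sum_a \sum_s \sum_b H a b s).
  under eq_bigr => b _ do rewrite exchange_big /=.
  by rewrite exchange_big /=; apply: eq_bigr => a _; rewrite exchange_big.
rewrite pair_bigA /mact /pder fform_sumr; apply: eq_bigr => -[a s] _ /=.
rewrite mulr_suml fform_sumr; apply: eq_bigr => b _.
by rewrite -scalerAl fformZr /xvar /pvar -surjective_pairing fform_mulXr mxE conjCK.
Qed.

Definition sl_adj (x : sl C n) : sl C n := vsproj (sl_space C n) (adj_mx (vsval x)).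

Lemma val_sl_adj x : vsval (sl_adj x) = adj_mx (vsval x).
Proof.
rewrite vsprojK // mem_sl /mxtrace; under eq_bigr do rewrite mxE.
by rewrite -rmorph_sum; have := subvsP x; rewrite mem_sl /mxtrace => /eqP ->; rewrite rmorph0.
Qed.

End Contravariant.

(** * Transfer from the model to V *)

Lemma triangular_decomp (F : numFieldType) n (x : sl F n) : exists h e,
  [/\ h \in cartan F n, e \in nplus F n & x = vsval (nm_of (vsval x)) + (h + e)].
Proof.
have [u un [w wcp def_x]] : exists2 u, u \in nminus F n &
    exists2 w, w \in (cartan F n + nplus F n)%VS & x = u + w.
  by apply/memv_addP; rewrite addv_triangular memvf.
move/memv_addP: wcp => [h ch [e pe def_w]]; exists h, e; split=> //.
rewrite {1}def_x def_w; congr (_ + _); apply: val_inj; rewrite /= -/(mx_of _) mx_of_nm.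
apply/matrixP => i j; rewrite mxE def_x def_w /=.
move: ch pe un => /mem_cartan h0 /mem_nplus e0 /mem_nminus u0.
case: ltnP => [lt_ji|/u0//].
by rewrite !mxE h0 ?e0 ?addr0 // ?(ltnW lt_ji) // -val_eqE /= gtn_eqF.
Qed.

Section HighestWeight.
Variables (F : numFieldType) (n : nat) (lam : 'I_n -> nat).
Variables (V : lmodType F) (rho : sl_rep n V) (v : V).
Hypothesis v_nplus : forall e, e \in nplus F n -> rho e v = 0.
Hypothesis v_cartan : forall h, h \in cartan F n -> rho h v = weight_of lam h *: v.
Local Notation nm := (subvs_of (nminus F n)).
Implicit Types (s t : nat) (w : V) (x y : sl F n).

Local Notation nm_word := (foldr (fun x0 : nm => rho (vsval x0)) v).

Lemma rhoD x w1 w2 : rho x (w1 + w2) = rho x w1 + rho x w2.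
Proof. by have := sl_act_linear rho x 1 w1 w2; rewrite !scale1r. Qed.

Lemma rhoZ x c w : rho x (c *: w) = c *: rho x w.
Proof. by have := sl_act_linear rho x c w 0; rewrite sl_act0 !addr0. Qed.

Lemma rhoB x w1 w2 : rho x (w1 - w2) = rho x w1 - rho x w2.
Proof. by rewrite -[- w2]scaleN1r rhoD rhoZ scaleN1r. Qed.

Lemma rhoDl x y w : rho (x + y) w = rho x w + rho y w.
Proof. by have := sl_act_linearl rho w 1 x y; rewrite !scale1r. Qed.

Lemma rho0l w : rho 0 w = 0.
Proof. by have := sl_act_linearl rho w (-1) 0 0; rewrite scaler0 addr0 scaleN1r addNr. Qed.

Lemma rhoZl c x w : rho (c *: x) w = c *: rho x w.
Proof. by have := sl_act_linearl rho w c x 0; rewrite rho0l !addr0. Qed.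

Lemma rho_suml (I : Type) (r : seq I) (E : I -> sl F n) w :
  rho (\sum_(i <- r) E i) w = \sum_(i <- r) rho (E i) w.
Proof. by elim: r => [|i r IHr]; rewrite ?big_nil ?rho0l // !big_cons rhoDl IHr. Qed.

Lemma pbw_le s t w : (s <= t)%N -> pbw rho v s w -> pbw rho v t w.
Proof.
move=> le_st; move: w; apply: lspan_ind; first exact: lspan0.
  by move=> k u w; apply: pbw_linear.
by move=> _ [xs le_s ->]; apply: lspan_gen; exists xs => //; apply: leq_trans le_st.
Qed.

(** The hypothesis on [x] says that it lies in h + n^+. Induction on the length of a word [y w],
    from [x y w = y x w + [x, y] w]: since [[x, y]] can be any element of the Lie algebra, it must
    be known at the same time that an arbitrary element raises the filtration by at most one. *)
Lemma borel_pbw s x w : nm_of (vsval x) = 0 -> pbw rho v s w -> pbw rho v s (rho x w).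
Proof.
move=> + Pw; move: w Pw x.
suff word s' : forall xs : seq nm, (size xs <= s')%N ->
    (forall x, nm_of (vsval x) = 0 -> pbw rho v s' (rho x (nm_word xs))) /\
    (forall x, pbw rho v s'.+1 (rho x (nm_word xs))).
  move=> w Pw x x0; move: w Pw; apply: lspan_ind.
  - by rewrite sl_act0; apply: lspan0.
  - by move=> k u w Pu Pw; rewrite sl_act_linear; apply: pbw_linear.
  by move=> _ [xs le_s ->]; have [H _] := word s xs le_s; apply: H.
have any k (xs : seq nm) : (size xs <= k)%N ->
   (forall x, nm_of (vsval x) = 0 -> pbw rho v k (rho x (nm_word xs))) ->
   (forall x, pbw rho v k.+1 (rho x (nm_word xs))).
  move=> le_k H x; have [h [e [ch pe ->]]] := triangular_decomp x; rewrite rhoDl.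
  apply: lspanD; first by apply: pbw_step; apply: lspan_gen; exists xs.
  apply: (@pbw_le k) => //; apply: H.
  apply: mx_of_inj; rewrite mx_of_nm raddf0; apply/matrixP => i j; rewrite !mxE.
  case: ifP => // lt_ji; move/mem_cartan: ch => h0; move/mem_nplus: pe => e0.
  by rewrite /= ?mxE h0 ?e0 ?addr0 // ?(ltnW lt_ji) // -val_eqE /= gtn_eqF.
elim: s' => [|k IHk] [|y xs] //= le_s.
- suff H x : nm_of (vsval x) = 0 -> pbw rho v 0 (rho x v).
    by split=> //; apply: (any 0%N [::]).
  move=> x0; have [h [e [ch pe ->]]] := triangular_decomp x; rewrite x0 raddf0 add0r rhoDl.
  by rewrite v_cartan // v_nplus // addr0; apply/lspanZ/lspan_gen; exists [::].
- have [H1 H2] := IHk [::] isT; split=> x.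
    by move=> x0; apply: (@pbw_le k) => //; apply: H1.
  by apply: (@pbw_le k.+1) => //; apply: H2.
have [H1 H2] := IHk xs le_s.
suff H x : nm_of (vsval x) = 0 ->
    pbw rho v k.+1 (rho x (rho (vsval y) (nm_word xs))).
  by split=> //; apply: (any k.+1 (y :: xs)).
move=> x0; rewrite -[X in pbw _ _ _ X](subrK (rho (vsval y) (rho x (nm_word xs)))).
by rewrite -sl_act_bracket; apply: lspanD; [apply: H2 | apply: pbw_step; apply: H1].
Qed.

Lemma nm_of_nplus x : x \in nplus F n -> nm_of (vsval x) = 0.
Proof.
move/mem_nplus => e0; apply: mx_of_inj; rewrite mx_of_nm raddf0; apply/matrixP => i j.
by rewrite !mxE; case: ifP => // lt_ji; rewrite e0 // ltnW.
Qed.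

Lemma act_pbw s x w : pbw rho v s w -> pbw rho v s.+1 (rho x w).
Proof.
move=> Pw; rewrite -[x](subrK (vsval (nm_of (vsval x)))) rhoDl.
apply: lspanD; last exact: pbw_step.
apply: (@pbw_le s) => //; apply: borel_pbw Pw.
by rewrite /= raddfB /= -/(mx_of _) nm_of_mx subrr.
Qed.

(** Up to a multiple of the identity, diag(0, -1, ..., -n). Its bracket with [f_a] has eigenvalue
    minus the height of the root, so each root vector of n^- lowers its eigenvalues by a positive
    integer. *)
Definition h_grad : sl F n := diag_sl (fun i => - i%:R).
Definition top_eig : F := weight_of lam h_grad.

Lemma h_grad_cartan : h_grad \in cartan F n. Proof. exact: diag_sl_cartan. Qed.

Lemma h_grad_v : rho h_grad v = top_eig *: v.
Proof. exact: v_cartan h_grad_cartan. Qed.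

Lemma h_grad_froot a :
  sl_bracket h_grad (vsval (froot F a)) = - (rrow a - rcol a)%:R *: vsval (froot F a).
Proof.
apply: val_inj; apply/matrixP => i j; rewrite bracket_diag_entry /= !mxE.
rewrite -/(mx_of _) mx_of_froot !mxE.
case: eqP => [->|] /=; last by rewrite !mulr0.
case: eqP => [->|] /=; last by rewrite !mulr0.
by rewrite !mulr1 natrB ?(ltnW (rcol_lt_row a)) // opprB opprK addrC.
Qed.

Lemma froot_eig a w e : rho h_grad w = e *: w ->
  rho h_grad (rho (vsval (froot F a)) w) = (e - (rrow a - rcol a)%:R) *: rho (vsval (froot F a)) w.
Proof.
move=> hw; have := sl_act_bracket rho h_grad (vsval (froot F a)) w.
rewrite h_grad_froot rhoZl hw rhoZ => /eqP; rewrite eq_sym subr_eq => /eqP ->.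
by rewrite -scalerDl addrC.
Qed.

(** Plays the part of the sum of the lower weight spaces, through eigenvectors of the single
    operator [h_grad]. *)
Definition lower : V -> Prop :=
  lspan (fun w => exists k : nat, rho h_grad w = (top_eig - k.+1%:R) *: w).

Lemma lower_froot a w : lower w -> lower (rho (vsval (froot F a)) w).
Proof.
move: w; apply: lspan_ind.
- by rewrite sl_act0; apply: lspan0.
- by move=> k u w Lu Lw; rewrite sl_act_linear; apply: lspanD => //; apply: lspanZ.
move=> w [k hw]; apply: lspan_gen; exists (k + (rrow a - rcol a))%N.
by rewrite (froot_eig a hw) -addSn natrD opprD addrA.
Qed.

Lemma lower_froot_v a : lower (rho (vsval (froot F a)) v).
Proof.
apply: lspan_gen; exists (rrow a - rcol a).-1; rewrite (froot_eig a h_grad_v).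
by rewrite prednK // subn_gt0 rcol_lt_row.
Qed.

Lemma lower_sum (I : Type) (r : seq I) (E : I -> V) :
  (forall i, lower (E i)) -> lower (\sum_(i <- r) E i).
Proof.
by move=> LE; apply: (big_ind lower) => //; [apply: lspan0 | move=> *; apply: lspanD].
Qed.

Lemma pbw_lower s w : pbw rho v s w -> exists c, lower (w - c *: v).
Proof.
move: w; apply: lspan_ind.
- by exists 0; rewrite scale0r subrr; apply: lspan0.
- move=> k u w [c Lu] [d Lw]; exists (k * c + d).
  rewrite scalerDl -scalerA opprD addrACA -scalerBr.
  by apply: lspanD => //; apply: lspanZ.
move=> _ [xs _ ->]; elim: xs => [|x xs [c Lc]] /=.
  by exists 1; rewrite scale1r subrr; apply: lspan0.
exists 0; rewrite scale0r subr0; set w := foldr _ _ _ in Lc *.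
rewrite [x]nm_decomp raddf_sum rho_suml; apply: lower_sum => a /=.
rewrite rhoZl; apply: lspanZ.
rewrite -(subrK (c *: v) w) rhoD rhoZ; apply: lspanD; first exact: lower_froot.
by apply/lspanZ/lower_froot_v.
Qed.

(** The product of the operators [h_grad - (top_eig - j)] for [1 <= j <= k]. For large [k] it kills
    a given element of [lower], while it multiplies [v] by [k!], so [lower] meets the line of [v]
    only in 0. *)
Fixpoint kill_lower (k : nat) (w : V) : V :=
  if k is k'.+1 then rho h_grad (kill_lower k' w) - (top_eig - k%:R) *: kill_lower k' w
  else w.

Lemma kill_lower_linear k : linear (kill_lower k).
Proof.
elim: k => [|k IHk] c u w //=; rewrite !IHk sl_act_linear !scalerBr !scalerDr opprD.
by rewrite addrACA !scalerA [c * _]mulrC.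
Qed.

Lemma kill_lower_eig k w e : rho h_grad w = e *: w ->
  kill_lower k w = (\prod_(j < k) (e - (top_eig - j.+1%:R))) *: w.
Proof.
move=> hw; elim: k => [|k IHk] /=; first by rewrite big_ord0 scale1r.
by rewrite IHk rhoZ hw big_ord_recr /= !scalerA -scalerBl; congr (_ *: _); ring.
Qed.

Lemma lower_killed w : lower w -> exists k0, forall k, (k0 <= k)%N -> kill_lower k w = 0.
Proof.
move: w; apply: lspan_ind.
- exists 0%N => k _; have := kill_lower_linear k (-1) 0 0.
  by rewrite scaler0 addr0 scaleN1r addNr.
- move=> c u w [k1 Ku] [k2 Kw]; exists (maxn k1 k2) => k; rewrite geq_max => /andP[/Ku u0 /Kw w0].
  by rewrite kill_lower_linear u0 w0 scaler0 addr0.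
move=> w [j hw]; exists j.+1 => k lt_jk; rewrite (kill_lower_eig k hw).
by rewrite (bigD1 (Ordinal lt_jk)) //= subrr mul0r scale0r.
Qed.

Lemma lower_v c : v != 0 -> lower (c *: v) -> c = 0.
Proof.
move=> v0 /lower_killed[k /(_ k (leqnn k))].
rewrite (kill_lower_eig k (e := top_eig)); last by rewrite rhoZ h_grad_v !scalerA mulrC.
move/eqP; rewrite !scaler_eq0 (negbTE v0) orbF => /orP[|/eqP//].
rewrite prodf_seq_eq0 => /hasP[j _ /=]; rewrite opprB addrCA subrr addr0.
by rewrite pnatr_eq0.
Qed.

End HighestWeight.

(** * The submodule generated by a pair of highest weight vectors *)

Section PairRep.
Variables (F : numFieldType) (n : nat) (V V' : lmodType F).
Variables (rho : sl_rep n V) (rho' : sl_rep n V').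

Definition pair_act (x : sl F n) (w : V * V') : V * V' := (rho x w.1, rho' x w.2).

Lemma pair_act_linear x : linear (pair_act x).
Proof. by move=> a u w; rewrite /pair_act /= !sl_act_linear. Qed.

Lemma pair_act_linearl w : linear (pair_act^~ w).
Proof. by move=> a x y; rewrite /pair_act /= !(sl_act_linearl _ _ a x y). Qed.

Lemma pair_act_bracket x y w :
  pair_act (sl_bracket x y) w = pair_act x (pair_act y w) - pair_act y (pair_act x w).
Proof. by rewrite /pair_act !sl_act_bracket. Qed.

Definition pair_rep : sl_rep n (V * V')%type :=
  SlRep pair_act_linear pair_act_linearl pair_act_bracket.

Lemma lower_fst lam w : lower lam pair_rep w -> lower lam rho w.1.
Proof.
move: w; apply: lspan_ind; first exact: lspan0.
  by move=> k u w Lu Lw; apply: lspanD => //; apply: lspanZ.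
by move=> w [k hw]; apply: lspan_gen; exists k; apply: (congr1 fst hw).
Qed.

Lemma lower_snd lam w : lower lam pair_rep w -> lower lam rho' w.2.
Proof.
move: w; apply: lspan_ind; first exact: lspan0.
  by move=> k u w Lu Lw; apply: lspanD => //; apply: lspanZ.
by move=> w [k hw]; apply: lspan_gen; exists k; apply: (congr1 snd hw).
Qed.

Lemma pair_word v v' (xs : seq (subvs_of (nminus F n))) :
  foldr (fun x => pair_rep (vsval x)) (v, v') xs =
  (foldr (fun x => rho (vsval x)) v xs, foldr (fun x => rho' (vsval x)) v' xs).
Proof. by elim: xs => //= x xs ->. Qed.

Lemma pbw_snd v v' s w : pbw pair_rep (v, v') s w -> pbw rho' v' s w.2.
Proof.
move: w; apply: lspan_ind; first exact: lspan0.
  by move=> k u w Lu Lw; apply: pbw_linear.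
by move=> _ [xs le_s ->]; rewrite pair_word; apply: lspan_gen; exists xs.
Qed.

End PairRep.

Section Transfer.
Variables (C : numClosedFieldType) (n : nat) (lam : 'I_n -> nat).
Variables (V : lmodType C) (rho : sl_rep n V) (v : V).
Hypothesis V_irr : irreducible rho.
Hypothesis v_high : highest_weight_vector rho lam v.
Local Notation nm := (subvs_of (nminus C n)).
Local Notation model := {mpoly C[#|cell lam|]}.
Local Notation rho' := (model_rep C lam).
Local Notation v' := (hw_vec C lam).
Local Notation pr := (pair_rep rho rho').

(** By [linked0r] and [linked0l] this submodule is the graph of an isomorphism between cyclic
    submodules, and so it carries linear relations between words in both directions. *)
Definition linked (y : V * model) := exists s, pbw pr (v, v') s y.

Lemma pair_nplus e : e \in nplus C n -> pr e (v, v') = 0.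
Proof.
move=> pe; have [_ v0 _] := v_high.
by rewrite /= /pair_act /= v0 // [X in (_, X)]hw_vec_nplus.
Qed.

Lemma pair_cartan h : h \in cartan C n -> pr h (v, v') = weight_of lam h *: (v, v').
Proof.
move=> ch; have [_ _ vh] := v_high.
by rewrite /= /pair_act /= vh // [X in (_, X)]hw_vec_cartan.
Qed.

Lemma linked_act x y : linked y -> linked (pr x y).
Proof. by move=> [s Py]; exists s.+1; apply: act_pbw pair_nplus pair_cartan _ _ _ Py. Qed.

Lemma linkedD k u w : linked u -> linked w -> linked (k *: u + w).
Proof.
move=> [s Pu] [t Pw]; exists (maxn s t); apply: pbw_linear.
  by apply: pbw_le Pu; apply: leq_maxl.
by apply: pbw_le Pw; apply: leq_maxr.
Qed.

Lemma linked_lower y : linked y -> exists c, lower lam pr (y - c *: (v, v')).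
Proof. by move=> [s /(pbw_lower pair_cartan)]. Qed.

Lemma adj_mxK (X : 'M[C]_n.+1) : adj_mx (adj_mx X) = X.
Proof. by apply/matrixP => i j; rewrite !mxE conjCK. Qed.

Lemma h_grad_adj : adj_mx (vsval (h_grad C n)) = vsval (h_grad C n).
Proof.
apply/matrixP => i j; rewrite !mxE val_diag_sl !mxE rmorphMn eq_sym.
case: eqP => [->|]; last by rewrite !mulr0n.
rewrite !mulr1n rmorphB rmorphM /= fmorphV rmorph_nat rmorphN rmorph_nat rmorph_sum.
by congr (_ - _ * _); apply: eq_bigr => k _; rewrite rmorphN rmorph_nat.
Qed.

Lemma fform_h_grad (p q : model) :
  fform (rho' (h_grad C n) p) q = fform p (rho' (h_grad C n) q).
Proof. by rewrite /= fform_mact h_grad_adj. Qed.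

Lemma top_eig_conj : (top_eig C lam)^* = top_eig C lam.
Proof.
have vv : fform v' v' != 0.
  by apply: contra_neq (hw_vec_neq0 C lam) => /fform_eq0.
have := fform_h_grad v' v'.
rewrite (@hw_vec_cartan C n lam _ (h_grad_cartan C n)) -/(top_eig C lam) fformZl fformZr.
by move/(mulIf vv).
Qed.

(** [h_grad] is self-adjoint with real top eigenvalue, so its eigenvectors for distinct eigenvalues
    of the form [top_eig - k] are orthogonal. *)
Lemma fform_lower u : lower lam rho' u -> fform u v' = 0.
Proof.
move: u; apply: lspan_ind; first exact: fform0l.
  by move=> k u w u0 w0; rewrite fformDl fformZl u0 w0 mulr0 addr0.
move=> u [k hu]; have := fform_h_grad u v'; rewrite hu.
rewrite (@hw_vec_cartan C n lam _ (h_grad_cartan C n)) -/(top_eig C lam) fformZl fformZr.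
rewrite top_eig_conj => /eqP; rewrite -subr_eq0 -mulrBl mulf_eq0 addrAC subrr sub0r.
by rewrite oppr_eq0 pnatr_eq0 => /eqP.
Qed.

(** The letters of the word are moved onto [u] one at a time by taking adjoints, which keeps the
    first component 0. For the empty word, [u] is a multiple of [v'] plus lower terms; the same
    multiple of [v], up to lower terms, is the first component 0, so it vanishes. *)
Lemma linked0_form xs u : linked (0, u) ->
  fform u (foldr (fun x : nm => rho' (vsval x)) v' xs) = 0.
Proof.
elim: xs u => [|x xs IHxs] u Lu /=.
  have [c Lc] := linked_lower Lu.
  have c0 : c = 0.
    have := lower_fst Lc; rewrite /= sub0r -scaleNr.
    have [v0 _ vh] := v_high => /(lower_v vh v0)/eqP.
    by rewrite oppr_eq0 => /eqP.
  have := lower_snd Lc; rewrite /= c0 scale0r subr0; exact: fform_lower.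
rewrite -[X in mact X _]adj_mxK -fform_mact -val_sl_adj.
apply: IHxs; have := linked_act (sl_adj (vsval x)) Lu.
by rewrite /= /pair_act /= sl_act0.
Qed.

(* u is orthogonal to the cyclic submodule of the model, which contains it. *)
Lemma linked0r u : linked (0, u) -> u = 0.
Proof.
move=> Lu; apply: fform_eq0; have [s Pu] := Lu.
have : pbw rho' v' s u by have := pbw_snd Pu.
move: {-2}u; apply: lspan_ind; first exact: fform0r.
  by move=> k p q p0 q0; rewrite fformDr fformZr p0 q0 mulr0 addr0.
by move=> _ [xs _ ->]; apply: linked0_form.
Qed.

(** These [x] form a submodule of V. If it were all of V, then [(v, 0)] would be linked; its second
    component rules out a multiple of the top vector, and [v] itself would be lower. *)
Lemma linked0l x : linked (x, 0) -> x = 0.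
Proof.
have [_ irr] := V_irr; have [v0 _ vh] := v_high.
have [|||H|H] := irr (fun x => linked (x, 0)).
- by exists 0%N; apply: lspan0.
- move=> a u w Lu Lw; have := linkedD a Lu Lw.
  suff -> : a *: (u, 0 : model) + (w, 0) = (a *: u + w, 0) by [].
  by congr pair; rewrite /= scaler0 addr0.
- by move=> y w Lw; have := linked_act y Lw; rewrite /= /pair_act /= [X in (_, X)]mact0.
- exact: H.
have [c Lc] := linked_lower (H v).
have c0 : c = 0.
  have := lower_snd Lc; rewrite /= sub0r -scaleNr.
  move=> /(lower_v (@hw_vec_cartan C n lam) (hw_vec_neq0 C lam))/eqP.
  by rewrite oppr_eq0 => /eqP.
have := lower_fst Lc; rewrite /= c0 scale0r subr0 -[v]scale1r => /(lower_v vh v0)/eqP.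
by rewrite oner_eq0.
Qed.

Definition nm_word (W : lmodType C) (r : sl_rep n W) (w : W) (xs : seq nm) :=
  foldr (fun x => r (vsval x)) w xs.

Lemma word_transfer (I : Type) (r : seq I) (c : I -> C) (xs : I -> seq nm) :
  \sum_(i <- r) c i *: nm_word rho v (xs i) = 0 <->
  \sum_(i <- r) c i *: nm_word rho' v' (xs i) = 0.
Proof.
have L : linked (\sum_(i <- r) c i *: nm_word rho v (xs i),
                 \sum_(i <- r) c i *: nm_word rho' v' (xs i)).
  elim: r => [|i r IHr]; first by rewrite !big_nil; exists 0%N; apply: lspan0.
  rewrite !big_cons; apply: (@linkedD (c i) (nm_word rho v (xs i), nm_word rho' v' (xs i))) IHr.
  exists (size (xs i)); apply: lspan_gen; exists (xs i) => //.
  by rewrite pair_word.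
by split=> E; rewrite E in L; [apply: linked0r | apply: linked0l].
Qed.

End Transfer.

(** * The annihilator of gr V *)

Lemma poly_actC (F : fieldType) N (G : lmodType F) (T : 'I_N -> G -> G) c w :
  poly_act T c%:MP w = c *: w.
Proof.
have act1 : mon_act T 0 w = w.
  by have := poly_act1 T w; rewrite -mpolyX0 -[X in poly_act _ X]scale1r poly_actMX scale1r.
by rewrite -[c%:MP]mulr1 mul_mpolyC -mpolyX0 poly_actMX act1.
Qed.

Section Graded.
Variables (F : numFieldType) (n : nat) (lam : 'I_n -> nat).
Variables (V : lmodType F) (rho : sl_rep n V) (v : V).
Hypothesis v_nplus : forall e, e \in nplus F n -> rho e v = 0.
Hypothesis v_cartan : forall h, h \in cartan F n -> rho h v = weight_of lam h *: v.
Local Notation nm := (subvs_of (nminus F n)).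
Local Notation np := (subvs_of (nplus F n)).
Local Notation pbw_sum := (pbw_sum rho v).
Local Notation gr := (gr rho v).
Local Notation grc := (@gr_class F n V rho v : pbw_sum -> gr).
Local Notation nm_word := (foldr (fun x0 : nm => rho (vsval x0)) v).
Implicit Types (p q : Sym nm) (w : pbw_sum) (g : gr).

Definition dirac_at (s : nat) (x : V) : nat -> V := fun t => if t == s then x else 0.

Lemma dirac_pbw s x : pbw rho v s x -> dirac_at s x \in pbw_sum_pred rho v.
Proof.
move=> Px; apply/asboolP; split=> [t|]; rewrite /dirac_at.
  by case: eqP => [->|_] //; apply: lspan0.
by exists s.+1 => t lt_st; rewrite gtn_eqF.
Qed.

Lemma pbw_v : pbw rho v 0 v. Proof. by apply: lspan_gen; exists [::]. Qed.

Definition gr_one : pbw_sum := PbwSum (dirac_pbw pbw_v).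
Definition gv : gr := gr_class gr_one.

Lemma shift_word (xs : seq nm) k :
  foldr (@pbw_shift F n V rho v) gr_one xs k = if k == size xs then nm_word xs else 0.
Proof.
elim: xs k => [|x xs IHxs] [|k] //=; rewrite IHxs eqSS.
by case: eqP => // _; rewrite sl_act0.
Qed.

Lemma gr_word (xs : seq nm) :
  (\prod_(x <- xs) sym_in x) *: gv = grc (foldr (@pbw_shift F n V rho v) gr_one xs).
Proof.
elim: xs => [|x xs IHxs]; first by rewrite big_nil scale1r.
by rewrite big_cons -scalerA IHxs sym_in_gr_class.
Qed.

Lemma gr_scaleC (c : F) w : (c%:MP : Sym nm) *: grc w = grc (c *: w).
Proof.
rewrite -gr_class_scale.
exact: (poly_actC (fun i => @gr_shift F n V rho v (vbasis {:nm})`_i) c (gr_class w)).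
Qed.

Lemma gr_scaleZ (c : F) p g : (c *: p) *: g = (c%:MP : Sym nm) *: (p *: g).
Proof. by rewrite scalerA mul_mpolyC. Qed.

Lemma grc_eq0 w : grc w = 0 <-> forall s, pbw_pred rho v s (w s).
Proof.
have -> : (0 : gr) = grc 0 by rewrite /= raddf0.
rewrite gr_classP; split=> H s; have := H s.
  by rewrite -[X in _ - X]/(0 : V) subr0.
by rewrite -[X in _ - X]/(0 : V) subr0.
Qed.

(** gr V is cyclic on [gv] and S(n^-) is commutative. A family is peeled off from its top degree: in
    degree [s] a word of length [s] is its monomial applied to [gv], and a shorter word has class
    0. *)
Lemma annihilatorE p : annihilator gr p <-> p *: gv = 0.
Proof.
split=> [H|pv g]; first exact: H.
have pd s x (Px : pbw rho v s x) : p *: grc (PbwSum (dirac_pbw Px)) = 0.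
  (* The claim covers every family with these values, since the membership proof stored in a
     [PbwSum] changes along the induction. *)
  suff H y : pbw rho v s y -> pbw rho v s y /\
      forall w, (forall t, w t = dirac_at s y t) -> p *: grc w = 0.
    by have [_] := H x Px; apply.
  move: y; apply: lspan_ind.
  - split; first exact: lspan0.
    move=> w w0; rewrite (_ : grc w = 0) ?scaler0 //; apply/grc_eq0 => t.
    by rewrite w0 /dirac_at; case: ifP => _; apply: pbw_pred0.
  - move=> k u z [Pu Hu] [Pz Hz]; split; first exact: pbw_linear.
    move=> w wE; have -> : w = k *: PbwSum (dirac_pbw Pu) + PbwSum (dirac_pbw Pz).
      apply/val_inj/funext => t; rewrite /= wE -[RHS]/(k *: dirac_at s u t + dirac_at s z t).
      by rewrite /dirac_at; case: ifP => // _; rewrite scaler0 addr0.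
    rewrite /= raddfD /= scalerDr (Hz (PbwSum (dirac_pbw Pz))) // addr0.
    by rewrite -gr_scaleC scalerA mulrC -scalerA (Hu (PbwSum (dirac_pbw Pu))) // scaler0.
  move=> _ [xs le_s ->]; split; first by apply: lspan_gen; exists xs.
  move=> w wE; move: le_s; rewrite leq_eqVlt => /orP[/eqP e|lt_s].
    rewrite (_ : w = foldr (@pbw_shift F n V rho v) gr_one xs); last first.
      by apply/val_inj/funext => t; rewrite /= wE -[RHS]/((foldr _ _ _ : pbw_sum) t) shift_word e.
    by rewrite -gr_word scalerA mulrC -scalerA pv scaler0.
  rewrite (_ : grc w = 0) ?scaler0 //; apply/grc_eq0 => t; rewrite wE /dirac_at.
  case: eqP => [->|_]; last exact: pbw_pred0.
  by move: lt_s; clear; case: s => // s lt_s; apply: lspan_gen; exists xs.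
rewrite -[g]gr_class_repr; move: (repr _) => w; have /asboolP[Pw [N wN]] := pbw_valP w.
elim: N w Pw wN => [|N IHN] w Pw wN.
  rewrite (_ : gr_class w = 0 :> gr) ?scaler0 //; apply/grc_eq0 => s.
  by rewrite wN //; apply: pbw_pred0.
rewrite -[w](subrK (PbwSum (dirac_pbw (Pw N)))) /= raddfD /= scalerDr pd addr0.
have vE s : (w - PbwSum (dirac_pbw (Pw N))) s = w s - dirac_at N (w N) s by [].
apply: IHN => s.
  rewrite vE -scaleN1r addrC; apply: pbw_linear => //.
  by rewrite /dirac_at; case: eqP => [->|_] //; apply: lspan0.
rewrite leq_eqVlt vE /dirac_at => /orP[/eqP <-|lt_s]; first by rewrite eqxx subrr.
by rewrite gtn_eqF // subr0 wN.
Qed.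

Lemma emap_subproof (e : np) w : (fun s => rho (vsval e) (w s)) \in pbw_sum_pred rho v.
Proof.
have /asboolP[Pw [N wN]] := pbw_valP w; apply/asboolP; split=> [s|].
  by apply: (borel_pbw v_nplus v_cartan) => //; apply/nm_of_nplus/subvsP.
by exists N => s /wN ->; rewrite sl_act0.
Qed.

Definition emap (e : np) w : pbw_sum := PbwSum (emap_subproof e w).

Lemma borel_pbw_pred s (x : sl F n) (w : V) :
  nm_of (vsval x) = 0 -> pbw_pred rho v s w -> pbw_pred rho v s (rho x w).
Proof.
case: s => [_ /= ->|s x0 /= Pw]; first by rewrite sl_act0.
exact: (borel_pbw v_nplus v_cartan).
Qed.

Definition ehat (e : np) (g : gr) : gr := gr_class (emap e (repr g)).

Lemma ehatE e w : ehat e (grc w) = grc (emap e w).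
Proof.
apply/gr_classP => s /=; rewrite -rhoB; apply: borel_pbw_pred.
  exact/nm_of_nplus/subvsP.
by have /gr_classP := gr_class_repr (gr_class w).
Qed.

Lemma ehatD e g1 g2 : ehat e (g1 + g2) = ehat e g1 + ehat e g2.
Proof.
rewrite -[g1]gr_class_repr -[g2]gr_class_repr -raddfD !ehatE -raddfD.
by congr gr_class; apply/val_inj/funext => s; apply: rhoD.
Qed.

(** This is where the quotient in the definition of [circ] is matched: [e x w = x e w + [e, x] w]
    for [w] in V_s, and the component of [[e, x]] in h + n^+ preserves V_s, so only its component in
    n^- survives in degree [s + 1]. *)
Lemma ehat_act e p g : ehat e (p *: g) = p *: ehat e g + circ e p *: g.
Proof.
elim/Sym_ind: p g => [c|x|p q IHp IHq|p q IHp IHq] g.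
- rewrite circC scale0r addr0 -[g]gr_class_repr gr_scaleC !ehatE gr_scaleC.
  by congr gr_class; apply/val_inj/funext => s; apply: rhoZ.
- rewrite -[g]gr_class_repr; move: (repr g) => w.
  rewrite sym_in_gr_class !ehatE circ_in !sym_in_gr_class -raddfD.
  apply/gr_classP => -[|s] /=.
    by rewrite sl_act0 -[X in _ - X]/(0 + 0 : V) addr0 subrr.
  set y := sl_bracket (vsval e) (vsval x).
  have -> : vsval (vsval e) *m mx_of x - mx_of x *m vsval (vsval e) = vsval y.
    by rewrite val_sl_bracket.
  rewrite -[X in _ - X]/(rho (vsval x) (rho (vsval e) (w s)) + rho (vsval (nm_of (vsval y))) (w s)).
  rewrite opprD addrA -sl_act_bracket -/y.
  have -> : rho y (w s) - rho (vsval (nm_of (vsval y))) (w s) =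
      rho (y - vsval (nm_of (vsval y))) (w s).
    by rewrite -[- vsval _]scaleN1r rhoDl rhoZl scaleN1r.
  apply: (borel_pbw v_nplus v_cartan); last by have /asboolP[] := pbw_valP w.
  by rewrite /= raddfB /= nm_of_mx subrr.
- by rewrite !scalerDl ehatD IHp IHq (circ_derivation e).1 scalerDl addrACA.
rewrite -scalerA IHp IHq (circ_derivation e).2 scalerDl scalerDr !scalerA.
by rewrite -!addrA; congr (_ + _); rewrite addrC.
Qed.

Lemma ehat_gv e : ehat e gv = 0.
Proof.
rewrite ehatE; apply/grc_eq0 => s /=; rewrite /dirac_at; case: ifP => _.
  by rewrite v_nplus ?subvsP //; apply: pbw_pred0.
by rewrite sl_act0; apply: pbw_pred0.
Qed.

Lemma circ_gv e p : p *: gv = 0 -> circ e p *: gv = 0.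
Proof.
move=> p0; have := ehat_act e p gv; rewrite p0 ehat_gv scaler0 add0r => <-.
have := ehatD e 0 0; rewrite addr0 => /esym/eqP.
by rewrite -subr_eq0 addrK => /eqP.
Qed.

Lemma circ_ideal_gv (G : Sym nm -> Prop) :
  (forall q, G q -> q *: gv = 0) -> forall p, circ_ideal G p -> p *: gv = 0.
Proof.
move=> G0; apply: (@lspan_ind _ (Sym nm)^o).
- exact: scale0r.
- by move=> k u w u0 w0; rewrite -[k *: u]/(k * u) scalerDl -scalerA u0 w0 scaler0 addr0.
apply: (@lspan_ind F (Sym nm) _ (fun u => u *: gv = 0)).
- exact: scale0r.
- by move=> k u w u0 w0; rewrite scalerDl gr_scaleZ u0 w0 scaler0 addr0.
move=> _ [es [q [Gq ->]]]; elim: es => [|e es IHes] /=; first exact: G0.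
exact: circ_gv.
Qed.

(** An explicit lift of [p *: gv] to the direct sum, from which a relation in gr V is read off as
    membership in V_(k-1) in each degree [k]. *)
Definition gr_rep p (phi : nat -> V) :=
  exists w, p *: gv = grc w /\ forall k, w k = phi k.

Lemma gr_rep_word (xs : seq nm) :
  gr_rep (\prod_(x <- xs) sym_in x) (fun k => if k == size xs then nm_word xs else 0).
Proof. by rewrite /gr_rep gr_word; eexists; split=> // k; rewrite shift_word. Qed.

Lemma gr_rep_linear c p q phi psi : gr_rep p phi -> gr_rep q psi ->
  gr_rep (c *: p + q) (fun k => c *: phi k + psi k).
Proof.
move=> [w [pw wE]] [u [qu uE]]; exists (c *: w + u); split.
  by rewrite scalerDl gr_scaleZ pw qu gr_scaleC raddfD.
by move=> k; rewrite -wE -uE.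
Qed.

Lemma gr_rep_sum (J : Type) (r : seq J) (d : J -> F) (P : J -> Sym nm) (phi : J -> nat -> V) :
  (forall j, gr_rep (P j) (phi j)) ->
  gr_rep (\sum_(j <- r) d j *: P j) (fun k => \sum_(j <- r) d j *: phi j k).
Proof.
move=> H; elim: r => [|j r [w [pw wE]]].
  by exists 0; rewrite big_nil scale0r raddf0; split=> // k; rewrite big_nil.
have [w' [pw' wE']] := gr_rep_linear (d j) (H j) (ex_intro _ w (conj pw wE)).
by exists w'; rewrite big_cons; split=> // k; rewrite wE' big_cons.
Qed.

Lemma gr_rep_low p phi : gr_rep p phi -> p *: gv = 0 -> forall k, pbw_pred rho v k (phi k).
Proof. by move=> [w [-> wE]] /grc_eq0 H k; rewrite -wE. Qed.

End Graded.

Lemma sym_inZ (F : fieldType) (U : vectType F) c (u : U) : sym_in (c *: u) = c *: sym_in u.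
Proof. exact: linearZ. Qed.

(** * Spanning modulo the ideal by the monomials of the polytope *)

Section PolytopeSeq.
Variables (n : nat) (lam : 'I_n -> nat).
Local Notation root := (posroot n).
Local Notation expo := {ffun root -> nat}.

Definition polytope_seq : seq expo :=
  [seq s <- [seq [ffun a => val (g a)] | g : {ffun root -> 'I_(\sum_i lam i).+1}] | polytope lam s].

Lemma polytope_seq_uniq : uniq polytope_seq.
Proof.
rewrite filter_uniq // map_inj_uniq ?enum_uniq // => g h /ffunP gh.
by apply/ffunP => a; apply: val_inj; have := gh a; rewrite !ffunE.
Qed.

Lemma mem_polytope_seq s : (s \in polytope_seq) = polytope lam s.
Proof.
rewrite mem_filter andb_idr // => Ps.
have lt_s a : (s a < (\sum_i lam i).+1)%N.
  rewrite ltnS (leq_trans (polytope1 a Ps)) // weight_rootE; apply: leq_sum => i _.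
  by case: (_ <= _ <= _)%N; rewrite ?mul1n ?mul0n.
apply/mapP; exists [ffun a => Ordinal (lt_s a)]; first by rewrite mem_enum.
by apply/ffunP => a; rewrite !ffunE.
Qed.

End PolytopeSeq.

Section Spanning.
Variables (F : numFieldType) (n : nat).
Local Notation root := (posroot n).
Local Notation expo := {ffun root -> nat}.
Local Notation nm := (subvs_of (nminus F n)).
Local Notation mon := (mon (@yroot F n)).

Lemma mon_span (p : Sym nm) : lspan (fun w => exists s, w = mon s) p.
Proof.
have m1 : mon [ffun=> 0%N] = 1 by rewrite /mon big1 // => a _; rewrite ffunE expr0.
elim/Sym_ind: p => [c|x|p q Lp Lq|p q Lp Lq].
- rewrite -[c%:MP]mulr1 mul_mpolyC -m1; apply/lspanZ/lspan_gen.
  by exists [ffun=> 0%N].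
- rewrite [x]nm_decomp raddf_sum; apply: (big_ind (lspan _)) => [|u w|a _]; first exact: lspan0.
    exact: lspanD.
  rewrite /= sym_inZ; apply/lspanZ/lspan_gen; exists [ffun b => (b == a) : nat].
  rewrite /mon (bigD1 a) //= ffunE eqxx expr1 big1 ?mulr1 // => b /negbTE ne.
  by rewrite ffunE ne expr0.
- exact: lspanD.
move: p Lp; apply: lspan_ind.
- by rewrite mul0r; apply: lspan0.
- by move=> k u w Lu Lw; rewrite mulrDl -scalerAl; apply: lspanD => //; apply: lspanZ.
move=> _ [s ->]; move: q Lq; apply: lspan_ind.
- by rewrite mulr0; apply: lspan0.
- by move=> k u w Lu Lw; rewrite mulrDr -scalerAr; apply: lspanD => //; apply: lspanZ.
by move=> _ [t ->]; apply: lspan_gen; exists [ffun a => s a + t a]%N; rewrite monD.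
Qed.

Lemma mon_word s : mon s = \prod_(x <- [seq froot F a | a <- word s]) sym_in x.
Proof. by rewrite big_map prod_word. Qed.

Variables (lam : 'I_n -> nat) (G : Sym nm -> Prop).
Hypothesis G_pow : forall a, circ_ideal G (yroot F a ^+ (weight_root lam a).+1).

Lemma ideal_reducible p : reducible (@yroot F n) (circ_ideal G) lam p.
Proof.
have I0 := @circ_ideal0 F n G.
have ID := @circ_idealD F n G.
have IM := @circ_idealM F n G.
have := mon_span p; move: p; apply: lspan_ind.
- by exists 0; rewrite // subrr; apply: lspan0.
- by move=> k u w Lu Lw; apply: reducibleD => //; apply: reducibleZ.
move=> _ [s ->]; apply: mon_reducible => //.
- move=> r i lt_ri; have [e eP] := @circ_row F n r i lt_ri.
  have [eD eM] := circ_derivation e.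
  exists (fun p => - circ e p); split=> [|p Ip|]; last exact: eP.
    split=> p q; first by rewrite eD opprD.
    by rewrite eM opprD mulNr mulrN.
  by rewrite -mulN1r; apply: IM; apply: circ_ideal_circ.
- move=> r j lt_jr; have [e eP] := @circ_col F n r j lt_jr.
  by exists (circ e); split=> [|p Ip|//]; [apply: circ_derivation | apply: circ_ideal_circ].
Qed.

Lemma polytope_span p : lspan (fun w => exists2 s, polytope lam s & w = mon s) p ->
  exists d : expo -> F, p = \sum_(s <- polytope_seq lam) d s *: mon s.
Proof.
move: p; apply: lspan_ind.
- by exists (fun=> 0); rewrite big1 // => s _; rewrite scale0r.
- move=> k u w [d ->] [e ->]; exists (fun s => k * d s + e s).
  by rewrite scaler_sumr -big_split; apply: eq_bigr => s _; rewrite scalerDl scalerA.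
move=> _ [s Ps ->]; exists (fun t => (t == s)%:R).
rewrite (bigD1_seq s) ?mem_polytope_seq ?polytope_seq_uniq //= eqxx scale1r.
by rewrite big1 ?addr0 // => t /negbTE->; rewrite scale0r.
Qed.

End Spanning.

(** * Comparison of the annihilator with the ideal *)

Section Main.
Variables (C : numClosedFieldType) (n : nat) (lam : 'I_n -> nat).
Variables (V : lmodType C) (rho : sl_rep n V) (v : V).
Hypothesis V_irr : irreducible rho.
Hypothesis v_high : highest_weight_vector rho lam v.
Variable f : posroot n -> subvs_of (nminus C n).
Hypothesis f_root : forall a, root_vector a (f a).
Local Notation root := (posroot n).
Local Notation expo := {ffun root -> nat}.
Local Notation nm := (subvs_of (nminus C n)).
Local Notation gv := (gv rho v).
Local Notation mon := (mon (@yroot C n)).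
Local Notation L := (polytope_seq lam).

Let v_nplus e : e \in nplus C n -> rho e v = 0.
Proof. by case: v_high => _ H _; apply: H. Qed.

Let v_cartan h : h \in cartan C n -> rho h v = weight_of lam h *: v.
Proof. by case: v_high => _ _ H; apply: H. Qed.

Definition generators (q : Sym nm) : Prop :=
  exists a, q = sym_in (f a) ^+ (weight_root lam a).+1.

Definition root_word (s : expo) : V := nm_word rho v [seq froot C a | a <- word s].

Lemma root_word_independent (d : expo -> C) :
  \sum_(s <- L) d s *: root_word s = 0 -> forall s, s \in L -> d s = 0.
Proof.
move=> /(word_transfer V_irr v_high (polytope_seq lam) d (fun s => [seq froot C a | a <- word s])).
have E s : nm_word (model_rep C lam) (hw_vec C lam) [seq froot C a | a <- word s] =
    foldr (@froot_act C n lam) (hw_vec C lam) (word s).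
  rewrite /nm_word foldr_map; elim: (word s) => //= a l ->.
  by rewrite /froot_act -mx_of_froot.
under eq_bigr => s _ do rewrite E.
apply: model_independent (polytope_seq_uniq lam) _ => s.
by rewrite mem_polytope_seq.
Qed.

(** The vanishing of this power of [f_a] on [v] is computed in the model and carried to V by
    [word_transfer]. *)
Lemma froot_pow_gv a : yroot C a ^+ (weight_root lam a).+1 *: gv = 0.
Proof.
set m := (weight_root lam a).+1.
have -> : yroot C a ^+ m = \prod_(x <- nseq m (froot C a)) sym_in x.
  by rewrite big_nseq -Monoid.iteropE.
rewrite gr_word; apply/grc_eq0 => k; rewrite shift_word.
have nil : nm_word rho v (nseq m (froot C a)) = 0.
  have [_ T] := @word_transfer _ _ _ _ _ _ V_irr v_high unit [:: tt] (fun=> 1)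
    (fun=> nseq m (froot C a)).
  rewrite !big_seq1 !scale1r in T; apply: T.
  have := froot_nilpotent C lam a; rewrite -/m -mx_of_froot => <-.
  by elim: (m) => //= j; rewrite /nm_word /= => ->.
by case: ifP => _; [rewrite [X in pbw_pred _ _ _ X]nil | ]; apply: pbw_pred0.
Qed.

Lemma generators_gv q : generators q -> q *: gv = 0.
Proof.
move=> [a ->]; have [c _ ->] := root_vectorE (f_root a).
by rewrite sym_inZ exprZn gr_scaleZ froot_pow_gv scaler0.
Qed.

Lemma generators_ideal a :
  circ_ideal generators (yroot C a ^+ (weight_root lam a).+1).
Proof.
have [c c0 fa] := root_vectorE (f_root a).
have -> : yroot C a ^+ (weight_root lam a).+1 =
    (c^-1 ^+ (weight_root lam a).+1)%:MP * sym_in (f a) ^+ (weight_root lam a).+1.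
  rewrite fa sym_inZ exprZn mul_mpolyC scalerA -exprMn mulVf // expr1n.
  by rewrite scale1r.
by apply: circ_idealM; apply: circ_ideal_gen; exists a.
Qed.

Lemma gr_rep_mon_sum (d : expo -> C) :
  gr_rep rho v (\sum_(s <- L) d s *: mon s)
    (fun k => \sum_(s <- L) d s *: if k == size (word s) then root_word s else 0).
Proof.
apply: gr_rep_sum => s; rewrite mon_word /root_word /nm_word -(size_map (@froot C n) (word s)).
exact: gr_rep_word.
Qed.

Lemma gens_circ_gv q : circ_ideal generators q -> q *: gv = 0.
Proof. exact: (circ_ideal_gv v_nplus v_cartan generators_gv). Qed.

Lemma ideal_split p : exists d : expo -> C, exists2 q,
  circ_ideal generators q & p = q + \sum_(s <- L) d s *: mon s.
Proof.
have [q Iq /polytope_span[d def_r]] := ideal_reducible generators_ideal p.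
by exists d, q => //; rewrite -def_r addrC subrK.
Qed.

(** The bound on the lengths is strict, so that [low_span k] corresponds to V_(k-1), that is to
    [pbw_pred]. *)
Definition low_span (k : nat) (x : V) := exists2 e : expo -> C,
  forall s, (k <= size (word s))%N -> e s = 0 & x = \sum_(s <- L) e s *: root_word s.

Lemma low_spanD k c x y : low_span k x -> low_span k y -> low_span k (c *: x + y).
Proof.
move=> [d d0 ->] [e e0 ->]; exists (fun s => c * d s + e s).
  by move=> s ks; rewrite d0 // e0 // mulr0 addr0.
by rewrite scaler_sumr -big_split; apply: eq_bigr => s _; rewrite scalerDl scalerA.
Qed.

Lemma low_span0 k : low_span k 0.
Proof. by exists (fun=> 0) => //; rewrite big1 // => s _; rewrite scale0r. Qed.

Lemma low_span_le k l x : (k <= l)%N -> low_span k x -> low_span l x.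
Proof. by move=> kl [e e0 ->]; exists e => // s /(leq_trans kl)/e0. Qed.

(** A word of length [k] is straightened modulo the ideal, which annihilates [gv]; hence it differs
    from a combination of polytope words of length [k] by an element of V_(k-1), where the induction
    applies. *)
Lemma pbw_low_span k x : pbw_pred rho v k x -> low_span k x.
Proof.
elim: k x => [|k IHk] x /=; first by move=> ->; apply: low_span0.
move: x; apply: lspan_ind; first exact: low_span0.
  by move=> c u w; apply: low_spanD.
move=> _ [xs le_k ->]; move: le_k; rewrite leq_eqVlt => /orP[/eqP size_xs|lt_k]; last first.
  apply: (@low_span_le k) => //; apply: IHk; case: (k) lt_k => // k' lt_k.
  by apply: lspan_gen; exists xs.
have [d [q Iq E]] := ideal_split (\prod_(x <- xs) sym_in x).
(* The splitting modulo the ideal is not known to be homogeneous, so only its part of degree [k] is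
   kept. *)
pose W := \sum_(s <- L) d s *: if k == size (word s) then root_word s else 0.
have low_W : low_span k.+1 W.
  exists (fun s => if k == size (word s) then d s else 0) => [s lt_ks|].
    by rewrite ltn_eqF.
  by apply: eq_bigr => s _; case: eqP; rewrite ?scale0r ?scaler0.
rewrite -[X in low_span _ X](subrK W) -[X in low_span _ (X + _)]scale1r.
apply: low_spanD => //; apply: (@low_span_le k) => //; apply: IHk.
have R := gr_rep_linear (-1) (gr_rep_mon_sum d) (gr_rep_word rho v xs).
have := gr_rep_low R; rewrite scaleN1r addrC E addrK => /(_ (gens_circ_gv Iq) k).
by rewrite size_xs eqxx scaleN1r addrC.
Qed.

(** Once [p] is reduced to polytope monomials, the component of [p *: gv] in degree [k] puts a
    combination of words of length [k] into V_(k-1), hence into the span of shorter polytope words.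
    Independence in V then makes every coefficient vanish. *)
Lemma annihilator_ideal p : annihilator (gr rho v) p <-> circ_ideal generators p.
Proof.
split=> [/annihilatorE pv|Ip]; last by apply/annihilatorE/gens_circ_gv.
have [d [q Iq E]] := ideal_split p.
suff d0 s : s \in L -> d s = 0.
  by rewrite E big1_seq ?addr0 // => s /andP[_ /d0->]; rewrite scale0r.
move=> Ls; have rv : (\sum_(s <- L) d s *: mon s) *: gv = 0.
  have : p *: gv = 0 := pv.
  by rewrite E scalerDl gens_circ_gv // add0r.
have [e e0 sum_e] := pbw_low_span (gr_rep_low (gr_rep_mon_sum d) rv (size (word s))).
have := @root_word_independent
  (fun t => (if size (word s) == size (word t) then d t else 0) - e t) _ s Ls.
rewrite eqxx e0 // subr0; apply.
rewrite (eq_bigr (fun t => d t *: (if size (word s) == size (word t) then root_word t else 0)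
  - e t *: root_word t)).
  by rewrite sumrB sum_e subrr.
by move=> t _; rewrite scalerBl; case: eqP; rewrite ?scale0r ?scaler0.
Qed.

End Main.

Theorem theoremA (R : realType) (n : nat) (n_gt0 : (0 < n)%N)
    (lambda : 'I_n -> nat)
    (V : lmodType R[i]) (rho : sl_rep n V) (v : V)
    (V_irreducible : irreducible rho)
    (v_highest : highest_weight_vector rho lambda v)
    (f : posroot n -> subvs_of (nminus R[i] n))
    (f_root : forall a, root_vector a (f a))
    (p : Sym (subvs_of (nminus R[i] n))) :
  annihilator (gr rho v) p <->
  ideal_gen
    (Unplus_span (fun q => exists a, q = sym_in (f a) ^+ (weight_root lambda a).+1))
    p.
Proof. exact: annihilator_ideal. Qed.
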